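(* Let $a$ be a nonzero complex number, let $n$ be a nonnegative integer, let $k\geq 1$, and let $n_1,\dots,n_k,t_1,\dots,t_k$ be positive integers. Let $\mathcal F$ be a family of holomorphic functions in a domain $D\subset\mathbb C$ such that for every $f\in\mathcal F$ the function $$f^n(f^{n_1})^{(t_1)}\cdots(f^{n_k})^{(t_k)}-a$$ is nowhere vanishing on $D$. Assume that a) $n_j\geq t_j$ for all $1\leq j\leq k$; b) $n+\sum_{j=1}^k n_j\geq 2+\sum_{j=1}^k t_j$. Then $\mathcal F$ is normal on $D$.
   Context: Here $h^{(t)}$ denotes the $t$-th derivative of $h$, and $f^{m}$ denotes the $m$-th power of $f$. A family $\mathcal F$ of meromorphic (in particular, holomorphic) functions in a domain $D\subset\mathbb C$ is normal in $D$ (in the sense of Montel) if every sequence in $\mathcal F$ has a subsequence that converges locally uniformly in $D$ with respect to the spherical metric, to a meromorphic function or to the constant $\infty$. *)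

(* Defs.v *)
From HB Require Import structures.
From mathcomp Require Import all_boot all_order all_algebra.
From mathcomp Require Export complex.
From mathcomp Require Export all_classical all_reals all_analysis.
Set Implicit Arguments.
Unset Strict Implicit.
Unset Printing Implicit Defensive.
Import Order.TTheory GRing.Theory Num.Theory.
Import numFieldNormedType.Exports.
Local Open Scope ring_scope.
Local Open Scope complex_scope.
Local Open Scope classical_set_scope.

(* The complex plane is R[i] for R : realType.
   The instance below gives R[i] the topology of its modulus and makes it a
   normed space over itself, so that [derivable f z 1] is complex
   differentiability at z and [derive1n t f] is the t-th complex derivative. *)
HB.instance Definition _ (R : realType) := NormedModule.copy R[i] R[i]^o.

Section ComplexAnalysis.
Variable R : realType.
Local Notation C := R[i].

(* The modulus with values in R; the generic norm of z lives in R[i]. *)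
Local Notation modulus := (@Normc.normc R).

(* None is the point at infinity. *)
Definition sphere : Type := one_point_compactification C.

Definition fin_part (p : sphere) : C := if p is Some z then z else 0.

(* Half the length of the chord between the stereographic images of the two
   points on the unit sphere of R^3; it lies in [0, 1]. *)
Definition half_chord (p q : sphere) : R :=
  match p, q with
  | Some z, Some w =>
      modulus (z - w) /
        (Num.sqrt (1 + modulus z ^+ 2) * Num.sqrt (1 + modulus w ^+ 2))
  | Some z, None | None, Some z => (Num.sqrt (1 + modulus z ^+ 2))^-1
  | None, None => 0
  end.

(* Great-circle distance on the unit sphere, i.e. the distance induced by the
   line element 2 |dz| / (1 + |z|^2). *)
Definition spherical_dist (p q : sphere) : R := 2 * asin (half_chord p q).

Definition domain (D : set C) : Prop := [/\ D !=set0, open D & connected D].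

(* Functions on D are represented by total functions whose values outside D
   are irrelevant; the next definitions are meant for an open D. *)
Definition holomorphic_on (D : set C) (f : C -> C) : Prop :=
  forall z, D z -> derivable f z 1.

(* Holomorphic on D except for isolated poles, at which the value is
   infinity. *)
Definition meromorphic_on (D : set C) (g : C -> sphere) : Prop :=
  forall z, D z ->
    (\forall w \near z^', g w <> None /\ derivable (fin_part \o g) w 1) /\
    (if g z is Some _ then derivable (fin_part \o g) z 1
     else modulus (fin_part (g w)) @[w --> z^'] --> +oo).

Definition locally_uniform_cvg (D : set C) (u : nat -> C -> sphere)
    (g : C -> sphere) : Prop :=
  forall z, D z -> exists2 U, nbhs z U &
    forall e : R, 0 < e ->
      \forall m \near \oo, forall w, U w -> D w ->
        spherical_dist (u m w) (g w) < e.

Definition normal_on (D : set C) (F : set (C -> sphere)) : Prop :=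
  forall u : nat -> C -> sphere, (forall m, F (u m)) ->
    exists (phi : nat -> nat) (g : C -> sphere),
      [/\ {homo phi : i j / (i < j)%N},
          meromorphic_on D g \/ (forall z, D z -> g z = None)
        & locally_uniform_cvg D (u \o phi) g].

Definition to_sphere (f : C -> C) : C -> sphere := fun z => Some (f z).

End ComplexAnalysis.

(* Main.v *)
(** Clunie and Hayman's and Zalcman's methods, with the level set {|f| <= 1} in
    place of the spherical derivative.

    If |f'| <= M wherever |f| <= 1, then comparing ln |f|, which is positive and
    harmonic on the largest disc about z where |f| > 1, with its normal
    derivative at the nearest point q where |f q| = 1 (Hopf's lemma, here a
    consequence of Harnack's inequality) gives ln |f z| <= 2 M |z - q|.  Such a
    bound M, locally uniform over the family, therefore yields the dichotomy
    that a sequence is locally bounded or tends locally to infinity, hence normality.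

    If there is no such M, a rescaling g(z) = s^-T f(z1 + s^N z) with
    N = n + sum n_j and T = sum t_j, which leaves the differential monomial P(f)
    invariant, produces in the limit a nonconstant entire G of exponential type
    such that Q = P(G) - a is zero-free or identically 0, whence Q' = b Q for a
    constant b.  If G has a zero, then P(G) vanishes there to an order at least
    2, which forces b = 0 and P(G) = 0, against the finite order of that zero.
    If G has no zero, then G' = beta G with beta <> 0 and P(G) = c G^N, which
    contradicts Q' = b Q.

    Cauchy's theory is obtained from Goursat's lemma through the fact that the
    mean of f over circles about z0 is the period of a primitive of
    f(z0 + exp w); see [circle_mean]. *)
Require Import Defs.
From mathcomp Require Import all_boot all_order all_algebra.
From mathcomp Require Import ring lra.
From mathcomp Require Import complex.
From mathcomp Require Import all_classical all_reals all_analysis.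
Set Implicit Arguments.
Unset Strict Implicit.
Unset Printing Implicit Defensive.
Import Order.TTheory GRing.Theory Num.Theory.
Import numFieldNormedType.Exports.
Local Open Scope ring_scope.
Local Open Scope complex_scope.
Local Open Scope classical_set_scope.

(** The limit function has to have exponential type, since [Q' = b Q] with a constant [b] rests on
    Liouville's theorem for [Q' / Q]. A bound for [f'] on a level set yields this growth at once, by
    comparison with the nearest point of the level set, whereas a bound for the spherical derivative
    would call for the Clunie-Hayman theorem.

    Invariance under the rescaling is the identity [(s^-T)^N * (s^N)^T = 1]; the derivative is
    multiplied by [s^(N - T)], so that b), in the form [T < N], makes [|f'| >= s^-(N - T)] a
    condition of large derivative. The full strength [N >= T + 2] of b) serves for the multiplicity
    of the zeros of [P(G)], and a) keeps the order of each factor of [P(G)] nonnegative there.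

    In the zero-free case [Q' = b Q] reads [(N beta - b) c G^N = - b a]. Differentiation gives
    [b = N beta], and then [b a = 0], although neither [a] nor [N beta] vanishes. *)

Local Notation modulus := (@Normc.normc _).
Local Notation Re := (@complex.Re _).
Local Notation Im := (@complex.Im _).

(** * The modulus and complex differentiability in epsilon-delta form *)

Section Modulus.
Variable R : realType.
Local Notation C := R[i].
Implicit Types (x y : R) (z w : C).

Lemma modulus0 : modulus (0 : C) = 0. Proof. exact: Normc.normc0. Qed.
Lemma modulus1 : modulus (1 : C) = 1. Proof. exact: Normc.normc1. Qed.
Lemma modulusM z w : modulus (z * w) = modulus z * modulus w.
Proof. exact: Normc.normcM. Qed.
Lemma modulusV z : modulus z^-1 = (modulus z)^-1.
Proof. exact: Normc.normcV. Qed.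
Lemma modulusX z n : modulus (z ^+ n) = modulus z ^+ n.
Proof. by elim: n => [|n IH]; rewrite ?expr0 ?modulus1// !exprS modulusM IH. Qed.
Lemma modulusD z w : modulus (z + w) <= modulus z + modulus w.
Proof. exact: le_normcD. Qed.
Lemma modulusN z : modulus (- z) = modulus z. Proof. exact: normcN. Qed.
Lemma modulusC z w : modulus (z - w) = modulus (w - z).
Proof. by rewrite -opprB modulusN. Qed.
Lemma modulusB z w : modulus (z - w) <= modulus z + modulus w.
Proof. by rewrite -(modulusN w) modulusD. Qed.
Lemma modulus_trans w z v : modulus (z - v) <= modulus (z - w) + modulus (w - v).
Proof. by rewrite (_ : z - v = (z - w) + (w - v)) ?modulusD //; ring. Qed.
Lemma modulus_leD z w : modulus z <= modulus w + modulus (z - w).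
Proof. by rewrite {1}(_ : z = w + (z - w)) ?modulusD //; ring. Qed.
Lemma modulus_ge0 z : 0 <= modulus z.
Proof. by case: z => a b; exact: sqrtr_ge0. Qed.
Lemma modulus_eq0 z : (modulus z == 0) = (z == 0).
Proof.
by apply/eqP/eqP => [/Normc.eq0_normc|->]; rewrite ?modulus0.
Qed.
Lemma modulus_gt0 z : (0 < modulus z) = (z != 0).
Proof. by rewrite lt_neqAle modulus_ge0 andbT eq_sym modulus_eq0. Qed.
Lemma modulus_sqr z : modulus z ^+ 2 = Re z ^+ 2 + Im z ^+ 2.
Proof. by case: z => a b /=; rewrite sqr_sqrtr ?addr_ge0 ?sqr_ge0. Qed.
Lemma normr_modulus z : `|z| = (modulus z)%:C.
Proof. by rewrite normc_def; case: z. Qed.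
Lemma modulus_real x : modulus x%:C = `|x|.
Proof. by rewrite /= expr0n /= addr0 sqrtr_sqr. Qed.
Lemma normr_Re z : `|Re z| <= modulus z.
Proof.
rewrite -(ler_pXn2r (n := 2)) ?nnegrE ?modulus_ge0 //.
by rewrite modulus_sqr real_normK ?num_real // lerDl sqr_ge0.
Qed.
Lemma normr_Im z : `|Im z| <= modulus z.
Proof.
rewrite -(ler_pXn2r (n := 2)) ?nnegrE ?modulus_ge0 //.
by rewrite modulus_sqr real_normK ?num_real // lerDr sqr_ge0.
Qed.
Lemma modulus_le_ReIm z : modulus z <= `|Re z| + `|Im z|.
Proof.
rewrite -(ler_pXn2r (n := 2)) ?nnegrE ?addr_ge0 ?modulus_ge0 //.
rewrite modulus_sqr sqrrD !real_normK ?num_real //.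
by rewrite -addrA lerD2l lerDr mulrn_wge0 ?mulr_ge0.
Qed.
Lemma cReD z w : Re (z + w) = Re z + Re w. Proof. by case: z w => [a b] []. Qed.
Lemma cImD z w : Im (z + w) = Im z + Im w. Proof. by case: z w => [a b] []. Qed.
Lemma cReN z : Re (- z) = - Re z. Proof. by case: z. Qed.
Lemma cImN z : Im (- z) = - Im z. Proof. by case: z. Qed.
Lemma modulus_conj z : modulus z^* = modulus z.
Proof. by case: z => a b /=; rewrite sqrrN. Qed.

(** The value [l] is carried along and the quotient is multiplied out, so that [h = 0] needs no
    separate treatment. [cderivP] relates this form to [derivable] and [derive1]. *)
Definition cderiv (f : C -> C) z (l : C) : Prop :=
  forall e, 0 < e -> exists2 d, 0 < d & forall h, modulus h < d ->
    modulus (f (z + h) - f z - l * h) <= e * modulus h.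

Definition ccontinuous (f : C -> C) z : Prop :=
  forall e, 0 < e -> exists2 d, 0 < d & forall w, modulus (w - z) < d ->
    modulus (f w - f z) < e.

Lemma cderiv_lipschitz f z l : cderiv f z l -> exists2 d, 0 < d &
  forall h, modulus h < d -> modulus (f (z + h) - f z) <= (modulus l + 1) * modulus h.
Proof.
move=> /(_ 1 ltr01)[d d0 H]; exists d => // h /H; rewrite mul1r => {}H.
have := modulus_leD (f (z + h) - f z) (l * h).
by rewrite modulusM mulrDl mul1r; lra.
Qed.

Lemma cderiv_continuous f z l : cderiv f z l -> ccontinuous f z.
Proof.
move=> /cderiv_lipschitz[d d0 H] e e0.
have K0 : 0 < modulus l + 1 by rewrite ltr_wpDl ?modulus_ge0.
exists (Num.min d (e / (modulus l + 1))); first by rewrite lt_min d0 divr_gt0.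
move=> w; rewrite lt_min => /andP[wd we].
have := H _ wd; rewrite [z + _]addrC subrK => /le_lt_trans; apply.
by rewrite mulrC -ltr_pdivlMr.
Qed.

Lemma cderiv_near f g z l d : 0 < d ->
  (forall w, modulus (w - z) < d -> f w = g w) -> cderiv f z l -> cderiv g z l.
Proof.
move=> d0 fg fl e e0; have [d' d'0 H] := fl e e0.
exists (Num.min d d'); first by rewrite lt_min d0.
move=> h; rewrite lt_min => /andP[hd hd'].
by rewrite -!fg ?H// ?subrr ?modulus0// addrC addKr.
Qed.

Lemma cderiv_ext f g z l : f =1 g -> cderiv f z l -> cderiv g z l.
Proof. by move=> fg; apply: (@cderiv_near _ _ _ _ 1) => // w _. Qed.

Lemma cderiv_cst c z : cderiv (fun=> c) z 0.
Proof.
move=> e e0; exists 1 => // h _; rewrite subrr mul0r subr0 modulus0.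
by rewrite mulr_ge0 ?modulus_ge0 // ltW.
Qed.

Lemma cderiv_id z : cderiv id z 1.
Proof.
move=> e e0; exists 1 => // h _.
rewrite (_ : _ - _ = 0) ?modulus0 ?mulr_ge0 ?modulus_ge0 ?ltW//; ring.
Qed.

Lemma cderivD f g z l m : cderiv f z l -> cderiv g z m ->
  cderiv (fun w => f w + g w) z (l + m).
Proof.
move=> fl gm e e0; have e2 : 0 < e / 2 by rewrite divr_gt0.
have [d d0 H] := fl _ e2; have [d' d'0 H'] := gm _ e2.
exists (Num.min d d'); first by rewrite lt_min d0.
move=> h; rewrite lt_min => /andP[/H hd /H' hd'].
have := modulusD (f (z + h) - f z - l * h) (g (z + h) - g z - m * h).
rewrite (_ : _ + _ = f (z + h) + g (z + h) - (f z + g z) - (l + m) * h); last by ring.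
by move=> /le_trans; apply; nra.
Qed.

Lemma cderivM f g z l m : cderiv f z l -> cderiv g z m ->
  cderiv (fun w => f w * g w) z (l * g z + f z * m).
Proof.
move=> fl gm e e0.
have [d1 d10 Hf] := cderiv_lipschitz fl.
set A := modulus (f z); set B := modulus (g z); set L := modulus l + 1.
have [d3 d30 Hg] := cderiv_lipschitz gm.
set M := modulus m + 1 in Hg.
have A0 : 0 <= A := modulus_ge0 _. have B0 : 0 <= B := modulus_ge0 _.
have L0 : 0 < L by rewrite ltr_wpDl ?modulus_ge0.
have M0 : 0 < M by rewrite ltr_wpDl ?modulus_ge0.
(* The three error terms below cost at most [B], [A] and [L * M] times [e / K * |h|]; the third is
   quadratic in [h] and uses [|h| < e / K]. *)
set K := A + B + L * M + 1.
have LM0 : 0 < L * M by rewrite mulr_gt0.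
have K0 : 0 < K by rewrite /K; lra.
have eK : 0 < e / K by rewrite divr_gt0.
have [d2 d20 Hf'] := fl _ eK; have [d4 d40 Hg'] := gm _ eK.
exists (Num.min (Num.min d1 d2) (Num.min (Num.min d3 d4) (e / K))).
  by rewrite !lt_min d10 d20 d30 d40 eK.
move=> h; rewrite !lt_min => /andP[/andP[/Hf h1 /Hf' h2] /andP[/andP[/Hg h3 /Hg' h4] h5]].
set F := f (z + h) - f z in h1 h2; set G := g (z + h) - g z in h3 h4.
have -> : f (z + h) * g (z + h) - f z * g z - (l * g z + f z * m) * h =
  ((F - l * h) * g z + f z * (G - m * h)) + F * G by rewrite /F /G; ring.
have n0 := modulus_ge0 h.
apply: le_trans (modulusD _ _) _.
apply: le_trans (lerD (modulusD _ _) (lexx _)) _; rewrite !modulusM -/A -/B.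
have q1 : modulus (F - l * h) * B <= e / K * modulus h * B by rewrite ler_wpM2r.
have q2 : A * modulus (G - m * h) <= A * (e / K * modulus h) by rewrite ler_wpM2l.
have q3 : modulus F * modulus G <= (L * modulus h) * (M * modulus h).
  by rewrite ler_pM ?modulus_ge0.
have q4 : (L * modulus h) * (M * modulus h) <= (L * M * modulus h) * (e / K).
  by rewrite mulrACA mulrA ler_wpM2l ?(ltW h5) // mulr_ge0 // ltW.
have tK : e / K * modulus h * K = e * modulus h.
  by rewrite mulrAC divfK// gt_eqF.
have t0 : 0 <= e / K * modulus h by rewrite mulr_ge0 // ltW.
rewrite (_ : L * M * modulus h * (e / K) = L * M * (e / K * modulus h)) in q4; last by ring.
set t := e / K * modulus h in q1 q2 q4 tK t0.
apply: (@le_trans _ _ (t * B + A * t + L * M * t)).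
  exact: lerD (lerD q1 q2) (le_trans q3 q4).
by rewrite -tK (_ : t * K = t * B + A * t + L * M * t + t) ?lerDl // /K; ring.
Qed.

Lemma cderivZ c f z l : cderiv f z l -> cderiv (fun w => c * f w) z (c * l).
Proof.
move=> fl; have := cderivM (cderiv_cst c z) fl; by rewrite mul0r add0r.
Qed.

Lemma cderivN f z l : cderiv f z l -> cderiv (fun w => - f w) z (- l).
Proof.
by move=> /(cderivZ (-1)); rewrite mulN1r; apply: cderiv_ext => w; rewrite mulN1r.
Qed.

Lemma cderivB f g z l m : cderiv f z l -> cderiv g z m ->
  cderiv (fun w => f w - g w) z (l - m).
Proof. by move=> fl /cderivN; exact: cderivD. Qed.

Lemma cderivX f z l n : cderiv f z l ->
  cderiv (fun w => f w ^+ n) z (n%:R * f z ^+ n.-1 * l).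
Proof.
move=> fl; elim: n => [|n IH].
  by rewrite !mul0r; apply: cderiv_ext (cderiv_cst 1 z) => w; rewrite expr0.
have := cderivM fl IH.
rewrite (_ : _ + _ = n.+1%:R * f z ^+ n.+1.-1 * l); last first.
  case: n {IH} => [|n]; first by rewrite expr0; ring.
  by rewrite /= exprS -[n.+2%:R]natr1; ring.
by apply: cderiv_ext => w; rewrite exprS.
Qed.

Lemma cderiv_comp f g z l m : cderiv f z l -> cderiv g (f z) m ->
  cderiv (fun w => g (f w)) z (m * l).
Proof.
move=> fl gm e e0.
have [d1 d10 Hf] := cderiv_lipschitz fl.
set L := modulus l + 1 in Hf; set M := modulus m + 1.
have L0 : 0 < L by rewrite ltr_wpDl ?modulus_ge0.
have M0 : 0 < M by rewrite ltr_wpDl ?modulus_ge0.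
have e1 : 0 < e / (2 * L) by rewrite divr_gt0 // mulr_gt0.
have e2 : 0 < e / (2 * M) by rewrite divr_gt0 // mulr_gt0.
have [d2 d20 Hg] := gm _ e1; have [d3 d30 Hf'] := fl _ e2.
exists (Num.min (Num.min d1 d3) (d2 / L)).
  by rewrite !lt_min d10 d30 divr_gt0.
move=> h; rewrite !lt_min => /andP[/andP[/Hf h1 /Hf' h2] h3].
have n0 := modulus_ge0 h.
set F := f (z + h) - f z in h1 h2.
have Fd : modulus F < d2.
  by apply: le_lt_trans h1 _; rewrite mulrC -ltr_pdivlMr.
have := Hg _ Fd; rewrite {1}/F [f z + _]addrC subrK => h4.
have -> : g (f (z + h)) - g (f z) - m * l * h =
  (g (f (z + h)) - g (f z) - m * F) + m * (F - l * h) by rewrite /F; ring.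
apply: le_trans (modulusD _ _) _; rewrite modulusM.
have q1 : modulus (g (f (z + h)) - g (f z) - m * F) <= e / 2 * modulus h.
  apply: le_trans h4 _; apply: le_trans (ler_wpM2l (ltW e1) h1) _.
  rewrite le_eqVlt; apply/orP; left; apply/eqP; field; exact: lt0r_neq0.
have q2 : modulus m * modulus (F - l * h) <= e / 2 * modulus h.
  apply: (@le_trans _ _ (M * (e / (2 * M) * modulus h))).
    by rewrite ler_pM ?modulus_ge0 // lerDl.
  rewrite le_eqVlt; apply/orP; left; apply/eqP; field; exact: lt0r_neq0.
lra.
Qed.

Lemma cderivV z : z != 0 -> cderiv (fun w => w^-1) z (- (z ^- 2)).
Proof.
move=> z0 e e0; have a0 : 0 < modulus z by rewrite modulus_gt0.
set a := modulus z in a0.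
exists (Num.min (a / 2) (e * a ^+ 3 / 2)).
  by rewrite lt_min !divr_gt0 // mulr_gt0 // exprn_gt0.
move=> h; rewrite lt_min => /andP[h1 h2]; have n0 := modulus_ge0 h.
have zh : a / 2 < modulus (z + h).
  have := modulus_leD z (z + h); rewrite (_ : z - (z + h) = - h); last by ring.
  by rewrite modulusN -/a; lra.
have zh0 : z + h != 0 by rewrite -modulus_gt0; lra.
(* The error is quadratic in [h], and [|z + h| > |z| / 2] bounds its denominator from below. *)
have -> : (z + h)^-1 - z^-1 - - z ^- 2 * h = h ^+ 2 / (z ^+ 2 * (z + h)).
  by field; rewrite z0 zh0.
rewrite modulusM modulusV (modulusX h) (modulusM (z ^+ 2)) (modulusX z) -/a.
have p0 : 0 < a ^+ 2 * modulus (z + h) by rewrite mulr_gt0 ?exprn_gt0 //; lra.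
rewrite ler_pdivrMr // expr2 mulrAC ler_wpM2r //.
apply: le_trans (ltW h2) _; rewrite -[e * a ^+ 3 / 2]mulrA ler_wpM2l ?ltW//.
rewrite (_ : a ^+ 3 / 2 = a ^+ 2 * (a / 2)); last by ring.
by rewrite ltr_pM2l ?exprn_gt0.
Qed.

Lemma cderiv_inv f z l : f z != 0 -> cderiv f z l ->
  cderiv (fun w => (f w)^-1) z (- (f z ^- 2) * l).
Proof. by move=> f0 fl; apply: (cderiv_comp fl); exact: cderivV. Qed.

Lemma cderiv_affine a b z : cderiv (fun w => a + b * w) z b.
Proof.
have := cderivD (cderiv_cst a z) (cderivZ b (cderiv_id z)).
by rewrite mulr1 add0r.
Qed.

Lemma cderiv_neq0_near f z l : cderiv f z l -> f z != 0 ->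
  exists2 d, 0 < d & forall w, modulus (w - z) < d -> f w != 0.
Proof.
move=> /cderiv_continuous fc f0.
have [|d d0 H] := fc (modulus (f z)); first by rewrite modulus_gt0.
exists d => // w /H wz; apply/eqP => fw; move: wz.
by rewrite fw sub0r modulusN ltxx.
Qed.

End Modulus.

(** * Relation to the filter-based derivatives; mean values and antiderivatives along paths *)

Section Bridge.
Variable R : realType.
Local Notation C := R[i].

(** The radius of a ball in [R[i]] is itself a complex number; being positive it is real, and its
    real part serves as radius in [R]. *)
Lemma nbhsCP (z : C) (A : set C) : nbhs z A <->
  exists2 d : R, 0 < d & forall w, modulus (w - z) < d -> A w.
Proof.
split => [/nbhs_ballP[e /= e0 H]|[d d0 H]].
  have eR : e = (Re e)%:C by rewrite RRe_real // ger0_real // ltW.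
  exists (Re e); first by rewrite -ltcR -eR.
  move=> w wz; apply: H; rewrite -ball_normE /= distrC normr_modulus eR.
  by rewrite ltcR.
apply/nbhs_ballP; exists d%:C => /=; first by rewrite ltcR.
by move=> w; rewrite -ball_normE /= distrC normr_modulus ltcR; exact: H.
Qed.

Lemma cderivP (f : C -> C) z l :
  cderiv f z l <-> derivable f z 1 /\ derive1 f z = l.
Proof.
have key : cderiv f z l <-> (h^-1 *: (f (h *: 1 + z) - f z) @[h --> 0^'] --> l).
  split => [fl|fl].
    apply/cvgrPdist_le => e e0.
    have eR : e = (Re e)%:C by rewrite RRe_real // ger0_real // ltW.
    have eR0 : 0 < Re e by rewrite -ltcR -eR.
    have [d d0 H] := fl _ eR0.
    apply/nbhsCP; exists d => // h; rewrite subr0 => hd h0.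
    rewrite eR normr_modulus lecR.
    have nh : 0 < modulus h by rewrite modulus_gt0.
    rewrite -(ler_pM2r nh) -modulusM -[h *: 1]/(h * 1) mulr1.
    rewrite -[h^-1 *: _]/(h^-1 * _) mulrBl mulrAC mulVf // mul1r modulusC.
    by rewrite [h + z]addrC; exact: H.
  move=> e e0; move/cvgrPdist_le : fl => /(_ e%:C); rewrite ltcR => /(_ e0).
  move=> /nbhsCP[d d0 H]; exists d => // h hd.
  have [->|h0] := eqVneq h 0.
    by rewrite addr0 subrr mulr0 subr0 modulus0 mulr0.
  have := H h; rewrite subr0 => /(_ hd h0).
  rewrite normr_modulus lecR; have nh : 0 < modulus h by rewrite modulus_gt0.
  rewrite -(ler_pM2r nh) -modulusM -[h *: 1]/(h * 1) mulr1.
  rewrite -[h^-1 *: _]/(h^-1 * _) mulrBl mulrAC mulVf // mul1r modulusC.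
  by rewrite [h + z]addrC.
split => [/key fl|[fd fE]].
  split; first by apply/cvg_ex; exists l.
  by rewrite derive1E; exact: cvg_lim fl.
by apply/key; rewrite -fE derive1E; exact: fd.
Qed.

Lemma real_is_derive (f : R -> R) t l :
  (forall e : R, 0 < e -> exists2 d : R, 0 < d & forall h, `|h| < d ->
     `|f (t + h) - f t - l * h| <= e * `|h|) <-> is_derive t 1 f l.
Proof.
have key : (forall e : R, 0 < e -> exists2 d : R, 0 < d & forall h, `|h| < d ->
    `|f (t + h) - f t - l * h| <= e * `|h|) <->
    (h^-1 *: (f (h *: 1 + t) - f t) @[h --> 0^'] --> l).
  split => [fl|fl].
    apply/cvgrPdist_le => e e0; have [d d0 H] := fl _ e0.
    apply/nbhs_ballP; exists d => // h; rewrite -ball_normE /= sub0r normrN => hd h0.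
    rewrite -[h *: 1]/(h * 1) mulr1 -[h^-1 *: _]/(h^-1 * _).
    have nh : 0 < `|h| by rewrite normr_gt0.
    rewrite -(ler_pM2r nh) -normrM mulrBl mulrAC mulVf // mul1r distrC.
    by rewrite [h + t]addrC; exact: H.
  move=> e e0; move/cvgrPdist_le : fl => /(_ e e0)/nbhs_ballP[d /= d0 H].
  exists d => // h hd; have [->|h0] := eqVneq h 0.
    by rewrite addr0 subrr mulr0 subr0 normr0 mulr0.
  have := H h; rewrite /= -ball_normE /= sub0r normrN => /(_ hd h0).
  rewrite -[h *: 1]/(h * 1) mulr1 -[h^-1 *: _]/(h^-1 * _).
  have nh : 0 < `|h| by rewrite normr_gt0.
  rewrite -(ler_pM2r nh) -normrM mulrBl mulrAC mulVf // mul1r distrC.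
  by rewrite [h + t]addrC.
split => [/key fl|[fd fE]].
  split; first by apply/cvg_ex; exists l.
  exact: cvg_lim fl.
by apply/key; rewrite -fE; exact: fd.
Qed.

Definition pderiv (phi : R -> C) t (l : C) : Prop :=
  forall e : R, 0 < e -> exists2 d : R, 0 < d & forall h : R, `|h| < d ->
    modulus (phi (t + h) - phi t - l * h%:C) <= e * `|h|.

Lemma cderiv_line (f : C -> C) a b t l : cderiv f (a + t%:C * b) l ->
  pderiv (fun s => f (a + s%:C * b)) t (l * b).
Proof.
move=> fl e e0; set B := modulus b + 1.
have B0 : 0 < B by rewrite ltr_wpDl ?modulus_ge0.
have [d d0 H] := fl (e / B) (divr_gt0 e0 B0).
have bB : modulus b <= B by rewrite lerDl.
exists (d / B) => [|h hd]; first by rewrite divr_gt0.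
have := H (h%:C * b); rewrite modulusM modulus_real.
rewrite (_ : a + t%:C * b + h%:C * b = a + (t + h)%:C * b); last first.
  by rewrite rmorphD /=; ring.
rewrite (_ : l * (h%:C * b) = l * b * h%:C); last by ring.
have hB : `|h| * modulus b <= `|h| * B by rewrite ler_wpM2l.
have hd' : `|h| * B < d by rewrite -ltr_pdivlMr.
move=> /(_ (le_lt_trans hB hd')) /le_trans; apply.
rewrite mulrAC ler_pdivrMr // -mulrA ler_wpM2l // ltW//.
Qed.

Lemma pderiv_Re phi t l c : pderiv phi t l ->
  is_derive t 1 (fun s => Re (c * phi s)) (Re (c * l)).
Proof.
move=> pl; apply/real_is_derive => e e0; set B := modulus c + 1.
have B0 : 0 < B by rewrite ltr_wpDl ?modulus_ge0.
have [d d0 H] := pl (e / B) (divr_gt0 e0 B0).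
exists d => // h /H {}H.
have -> : Re (c * phi (t + h)) - Re (c * phi t) - Re (c * l) * h =
    Re (c * (phi (t + h) - phi t - l * h%:C)).
  by move: (phi (t + h)) (phi t) => [a1 a2] [b1 b2]; case: (c) (l) => [c1 c2] [l1 l2] /=; ring.
apply: le_trans (normr_Re _) _; rewrite modulusM.
apply: (@le_trans _ _ (B * (e / B * `|h|))).
  by rewrite ler_pM ?modulus_ge0 // lerDl.
by rewrite mulrA [B * _]mulrC divfK ?gt_eqF.
Qed.

Lemma pderiv_ReIm (phi : R -> C) (t : R) (l : C) : is_derive t 1 (fun s => Re (phi s)) (Re l) ->
  is_derive t 1 (fun s => Im (phi s)) (Im l) -> pderiv phi t l.
Proof.
move=> /real_is_derive p1 /real_is_derive p2 e e0.
have e2 : 0 < e / 2 by rewrite divr_gt0.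
have [d d0 H] := p1 _ e2; have [d' d'0 H'] := p2 _ e2.
exists (Num.min d d') => [|h]; first by rewrite lt_min d0.
rewrite lt_min => /andP[/H h1 /H' h2].
apply: le_trans (modulus_le_ReIm _) _.
have -> : Re (phi (t + h) - phi t - l * h%:C) = Re (phi (t + h)) - Re (phi t) - Re l * h.
  by move: (phi (t + h)) (phi t) => [a1 a2] [b1 b2]; case: (l) => [l1 l2] /=; ring.
have -> : Im (phi (t + h) - phi t - l * h%:C) = Im (phi (t + h)) - Im (phi t) - Im l * h.
  by move: (phi (t + h)) (phi t) => [a1 a2] [b1 b2]; case: (l) => [l1 l2] /=; ring.
by rewrite (splitr e) mulrDl lerD.
Qed.

(** The real mean value theorem is applied to the real part of [conj v * phi] with
    [v = phi 1 - phi 0], whose increment is [|v|^2]; one factor [|v|] is then cancelled. *)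
Lemma path_mean_value (phi dphi : R -> C) (K : R) :
  (forall t : R, 0 <= t <= 1 -> pderiv phi t (dphi t)) ->
  (forall t : R, 0 <= t <= 1 -> modulus (dphi t) <= K) ->
  modulus (phi 1 - phi 0) <= K.
Proof.
move=> pd dK; set v := phi 1 - phi 0.
have [v0|v0] := eqVneq v 0.
  rewrite v0 modulus0; apply: le_trans (dK 0 _); first exact: modulus_ge0.
  by rewrite lexx ler01.
have nv : 0 < modulus v by rewrite modulus_gt0.
pose f t := Re (v^* * phi t).
have fd (t : R) : 0 <= t <= 1 -> is_derive t (1 : R) f (Re (v^* * dphi t)).
  by move=> /pd; exact: pderiv_Re.
have [||t /[!in_itv] t01] := @MVT_segment R f (fun t => Re (v^* * dphi t)) 0 1 ler01.
- by move=> x /[!in_itv] /= /andP[x0 x1]; apply: fd; rewrite !ltW.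
- apply: derivable_within_continuous => x /[!in_itv] /= x01.
  by have [] := fd x x01.
rewrite subr0 mulr1.
have -> : f 1 - f 0 = modulus v ^+ 2.
  rewrite modulus_sqr /f /v; case: (phi 1) (phi 0) => [a b] [c d] /=; ring.
move=> E; rewrite -(ler_pM2l nv) -expr2 E.
apply: le_trans (ler_norm _) _; apply: le_trans (normr_Re _) _.
by rewrite modulusM modulus_conj ler_wpM2l ?modulus_ge0 // dK.
Qed.

(** Integrating over [[-1, 2]] makes all of [[0, 1]] interior, so that the derivative is two-sided
    at 0 and 1 as well. *)
Lemma antiderivative (phi : R -> R) : continuous phi ->
  exists Phi : R -> R, forall t : R, 0 <= t <= 1 -> is_derive t 1 Phi (phi t).
Proof.
move=> pc.
have ti : (lebesgue_measure : measure _ _).-integrable `[(-1)%R, 2%R] (EFin \o phi).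
  apply: continuous_compact_integrable; first exact: segment_compact.
  by apply: continuous_subspaceT.
have H t t2 t1 := @continuous_FTC1_closed R phi (-1) t 2 t2 ti t1 (pc t).
eexists => t /andP[t0 t1].
have [||fd fE] := H t; [lra|lra|].
by split; [exact: fd|rewrite -derive1E; exact: fE].
Qed.

Definition path_continuous (phi : R -> C) := forall t e, 0 < e ->
  exists2 d, 0 < d & forall s, `|s - t| < d -> modulus (phi s - phi t) < e.

Lemma path_antiderivative (phi : R -> C) : path_continuous phi ->
  exists Phi : R -> C, forall t : R, 0 <= t <= 1 -> pderiv Phi t (phi t).
Proof.
move=> pc.
have aux (g : C -> R) : (forall z w, `|g z - g w| <= modulus (z - w)) ->
    continuous (fun t => g (phi t)).
  move=> gl t; apply/cvgrPdist_lt => e e0; have [d d0 H] := pc t e e0.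
  apply/nbhs_ballP; exists d => // s; rewrite /ball /= distrC => /H.
  by apply: le_lt_trans; rewrite distrC.
have [|F FE] := @antiderivative (fun t => Re (phi t)).
  by apply: aux => z w; rewrite -cReN -cReD normr_Re.
have [|G GE] := @antiderivative (fun t => Im (phi t)).
  by apply: aux => z w; rewrite -cImN -cImD normr_Im.
exists (fun t => F t +i* G t) => t t01; apply: pderiv_ReIm; [exact: FE|exact: GE].
Qed.

(** This is [path_mean_value] for [f - l * id]. Taking [l = 0] gives Lipschitz bounds, [l = df a]
    gives Taylor remainders. *)
Lemma cderiv_mean_value (f : C -> C) (df : C -> C) a b l (K : R) :
  (forall t : R, 0 <= t <= 1 -> let z := a + t%:C * (b - a) in
    cderiv f z (df z) /\ modulus (df z - l) <= K) ->
  modulus (f b - f a - l * (b - a)) <= K * modulus (b - a).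
Proof.
move=> H; pose g w := f w - l * w.
have gd (t : R) : 0 <= t <= 1 ->
    pderiv (fun s : R => g (a + s%:C * (b - a))) t
      ((df (a + t%:C * (b - a)) - l) * (b - a)).
  move=> /H /= [fd _]; apply: (@cderiv_line g).
  apply: cderivB fd _; have := cderivZ l (cderiv_id (a + t%:C * (b - a))).
  by rewrite mulr1.
have := path_mean_value gd; rewrite /g mul1r mul0r addr0 [a + _]addrC subrK.
rewrite (_ : _ - _ - _ = f b - l * b - (f a - l * a)); last by ring.
by apply => t /H /= [_ ?]; rewrite modulusM ler_wpM2r ?modulus_ge0.
Qed.

End Bridge.

(** * Limits along a free ultrafilter *)

Section Ultralimit.
Variable R : realType.
Local Notation C := R[i].

(* A fixed free ultrafilter on nat replaces the choice of subsequences. *)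
Definition nat_ultra : set_system nat :=
  projT1 (cid (@ultraFilterLemma nat \oo _)).

Fact nat_ultraP : UltraFilter nat_ultra.
Proof. by rewrite /nat_ultra; case: cid => G []. Qed.
Existing Instance nat_ultraP.

Definition most (P : nat -> Prop) : Prop := nat_ultra P.

Lemma most_geq k : most (fun m => (k <= m)%N).
Proof.
rewrite /most /nat_ultra; case: cid => G /= [_ sub]; apply: sub.
exact: nbhs_infty_ge.
Qed.
Lemma most_sub (P Q : nat -> Prop) : (forall m, P m -> Q m) -> most P -> most Q.
Proof. by move=> PQ; apply: (@filterS _ nat_ultra). Qed.
Lemma most_and (P Q : nat -> Prop) : most P -> most Q -> most (fun m => P m /\ Q m).
Proof. by move=> p q; apply: (@filterI _ nat_ultra). Qed.
Lemma most_sub2 (P Q S : nat -> Prop) : (forall m, P m -> Q m -> S m) ->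
  most P -> most Q -> most S.
Proof. by move=> H p q; apply: most_sub (most_and p q) => m []; exact: H. Qed.
Lemma most_all (P : nat -> Prop) : (forall m, P m) -> most P.
Proof. by move=> H; apply: most_sub (most_geq 0) => m _. Qed.
Lemma most_ex (P : nat -> Prop) : most P -> exists m, P m.
Proof. by move=> p; apply: (@filter_ex _ nat_ultra). Qed.
Lemma most_or (P : nat -> Prop) : most P \/ most (fun m => ~ P m).
Proof. exact: (@in_ultra_setVsetC _ nat_ultra P). Qed.
Lemma most_not (P : nat -> Prop) : ~ most P -> most (fun m => ~ P m).
Proof. by case: (most_or P). Qed.

Definition tends (u : nat -> C) l : Prop :=
  forall e : R, 0 < e -> most (fun m => modulus (u m - l) < e).

(** The limit is the supremum of the [y] that lie below most [x m]. The ultrafilter decides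
    [sup A + e / 2 <= x m], and this inequality cannot hold for most [m]. *)
Lemma real_most_lim (x : nat -> R) B : most (fun m => `|x m| <= B) ->
  exists l, forall e : R, 0 < e -> most (fun m => `|x m - l| < e).
Proof.
move=> xB; pose A := [set y : R | most (fun m => y <= x m)].
have Asup : has_sup A.
  split; first by exists (- B); apply: most_sub xB => m; rewrite ler_norml => /andP[].
  exists B => y /= yA; have [m []] := most_ex (most_and yA xB).
  by move=> yx /ler_normlW; exact: le_trans.
exists (sup A) => e e0.
have [y yA ly] := sup_adherent e0 Asup.
have H : most (fun m => ~ (sup A + e / 2 <= x m)).
  apply: most_not => h; have : sup A + e / 2 <= sup A by apply: ub_le_sup => //; case: Asup.
  by rewrite gerDl leNgt divr_gt0.
apply: most_sub2 yA H => m h1 /negP; rewrite -ltNge => h2.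
by rewrite ltr_norml; apply/andP; split; lra.
Qed.

Lemma most_lim (u : nat -> C) B : most (fun m => modulus (u m) <= B) ->
  exists l, tends u l.
Proof.
move=> uB.
have [|x xl] := @real_most_lim (fun m => Re (u m)) B.
  by apply: most_sub uB => m; apply: le_trans (normr_Re _).
have [|y yl] := @real_most_lim (fun m => Im (u m)) B.
  by apply: most_sub uB => m; apply: le_trans (normr_Im _).
exists (x +i* y) => e e0; have e2 : 0 < e / 2 by rewrite divr_gt0.
apply: most_sub2 (xl _ e2) (yl _ e2) => m h1 h2.
apply: le_lt_trans (modulus_le_ReIm _) _.
by case: (u m) h1 h2 => a b /= h1 h2; rewrite (splitr e) ltrD.
Qed.

Lemma tends_le (u : nat -> C) l w K : tends u l ->
  most (fun m => modulus (u m - w) <= K) -> modulus (l - w) <= K.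
Proof.
move=> ul H; apply/ler_addgt0Pr => e e0.
have [m [h1 h2]] := most_ex (most_and H (ul e e0)).
by have := modulus_trans (u m) l w; rewrite (modulusC l (u m)); lra.
Qed.

Lemma tends_bounded u l : tends u l -> most (fun m => modulus (u m) <= modulus l + 1).
Proof.
move=> ul; apply: most_sub (ul 1 ltr01) => m h.
by have := modulus_leD (u m) l; lra.
Qed.

Lemma tends_cst c : tends (fun=> c) c.
Proof. by move=> e e0; apply: most_all => m; rewrite subrr modulus0. Qed.

Lemma tendsD u v l k : tends u l -> tends v k -> tends (fun m => u m + v m) (l + k).
Proof.
move=> ul vk e e0; have e2 : 0 < e / 2 by rewrite divr_gt0.
apply: most_sub2 (ul _ e2) (vk _ e2) => m h1 h2.
rewrite (_ : _ - _ = (u m - l) + (v m - k)); last by ring.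
by apply: le_lt_trans (modulusD _ _) _; rewrite (splitr e) ltrD.
Qed.

Lemma tendsM u v l k : tends u l -> tends v k -> tends (fun m => u m * v m) (l * k).
Proof.
move=> ul vk e e0; set A := modulus l + 1; set B := modulus k + 1.
have A0 : 0 < A by rewrite ltr_wpDl ?modulus_ge0.
have B0 : 0 < B by rewrite ltr_wpDl ?modulus_ge0.
have eA : 0 < e / (2 * A) by rewrite divr_gt0 // mulr_gt0.
have eB : 0 < e / (2 * B) by rewrite divr_gt0 // mulr_gt0.
apply: most_sub2 (tends_bounded ul) (most_and (ul _ eB) (vk _ eA)) => m h1 [h2 h3].
rewrite (_ : _ - _ = u m * (v m - k) + (u m - l) * k); last by ring.
apply: le_lt_trans (modulusD _ _) _; rewrite !modulusM.
have q1 : modulus (u m) * modulus (v m - k) <= A * modulus (v m - k).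
  by rewrite ler_wpM2r ?modulus_ge0.
have q2 : modulus (u m - l) * modulus k <= modulus (u m - l) * B.
  by rewrite ler_wpM2l ?modulus_ge0 // lerDl.
have q3 : A * modulus (v m - k) < e / 2.
  by rewrite mulrC -ltr_pdivlMr // -mulrA -invfM.
have q4 : modulus (u m - l) * B < e / 2.
  by rewrite -ltr_pdivlMr // -mulrA -invfM.
lra.
Qed.

Lemma tends_comp u l f : tends u l -> ccontinuous f l -> tends (fun m => f (u m)) (f l).
Proof.
move=> ul fc e e0; have [d d0 H] := fc e e0.
by apply: most_sub (ul d d0) => m; exact: H.
Qed.

Lemma exp2_small (K d : R) : 0 < d -> exists n, K / 2 ^+ n < d.
Proof.
move=> d0; have K0 : 0 <= `|K| / d by rewrite divr_ge0 // ltW.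
exists (Num.bound (`|K| / d)); have := archi_boundP K0.
set n := Num.bound _ => h.
have h2 : `|K| / d < 2 ^+ n.
  by apply: (lt_le_trans h); rewrite -natrX ler_nat ltnW // ltn_expl.
rewrite ltr_pdivrMr ?exprn_gt0 //; apply: le_lt_trans (ler_norm _) _.
by move: h2; rewrite ltr_pdivrMr // mulrC.
Qed.

Lemma inv_small (d : R) : 0 < d -> exists n : nat, n.+1%:R^-1 < d.
Proof.
move=> d0; have d1 : 0 <= d^-1 by rewrite invr_ge0 ltW.
have := archi_boundP d1; set n := Num.bound _ => h; exists n.
rewrite invf_plt ?posrE ?ltr0n //; apply: lt_trans h _.
by rewrite ltr_nat.
Qed.

End Ultralimit.

(** * Goursat's lemma and primitives on convex regions *)

Section Goursat.
Variables (R : realType) (f : R[i] -> R[i]).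
Local Notation C := R[i].

Definition line_point (a b : C) (t : R) : C := a + t%:C * (b - a).

Definition is_segint (a b : C) (Phi : R -> C) : Prop :=
  forall t : R, 0 <= t <= 1 -> pderiv Phi t (f (line_point a b t) * (b - a)).

(** The line integral of [f] is the increment of any antiderivative of the integrand along the
    segment; two antiderivatives have the same increment by [path_mean_value] (see [segintE]). The
    default 0 matters only if there is none. *)
Definition segint (a b : C) : C :=
  xget 0 [set S | exists2 Phi, is_segint a b Phi & S = Phi 1 - Phi 0].

Lemma line_point_sub (a b : C) (t : R) : 0 <= t <= 1 ->
  modulus (line_point a b t - a) <= modulus (b - a).
Proof.
move=> /andP[t0 t1]; rewrite /line_point addrC addKr modulusM modulus_real ger0_norm //.
by rewrite ler_piMl ?modulus_ge0.
Qed.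

Lemma pderivB phi psi t (l k : C) : pderiv phi t l -> pderiv psi t k ->
  pderiv (fun s : R => phi s - psi s) t (l - k).
Proof.
move=> fl gm e e0; have e2 : 0 < e / 2 by rewrite divr_gt0.
have [d d0 H] := fl _ e2; have [d' d'0 H'] := gm _ e2.
exists (Num.min d d'); first by rewrite lt_min d0.
move=> h; rewrite lt_min => /andP[/H hd /H' hd'].
have := modulusB (phi (t + h) - phi t - l * h%:C) (psi (t + h) - psi t - k * h%:C).
rewrite (_ : _ - _ = phi (t + h) - psi (t + h) - (phi t - psi t) - (l - k) * h%:C); last by ring.
by move=> /le_trans; apply; rewrite (splitr e) mulrDl lerD.
Qed.

Lemma pderiv_reparam (phi : R -> C) (p q t : R) (l : C) : pderiv phi (p + q * t) l ->
  pderiv (fun s => phi (p + q * s)) t (l * q%:C).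
Proof.
move=> fl e e0; set Q := `|q| + 1.
have Q0 : 0 < Q by rewrite ltr_wpDl.
have [d d0 H] := fl (e / Q) (divr_gt0 e0 Q0).
exists (d / Q) => [|h hd]; first by rewrite divr_gt0.
have qh : `|q * h| <= Q * `|h| by rewrite normrM ler_wpM2r // lerDl.
rewrite (_ : p + q * (t + h) = p + q * t + q * h); last by ring.
rewrite (_ : l * q%:C * h%:C = l * (q * h)%:C); last by rewrite rmorphM /=; ring.
have qd : `|q * h| < d.
  by apply: le_lt_trans qh _; rewrite mulrC -ltr_pdivlMr.
apply: le_trans (H _ qd) _; apply: le_trans (ler_wpM2l _ qh) _.
  by rewrite ltW ?divr_gt0.
by rewrite mulrA divfK ?gt_eqF.
Qed.

Lemma segintE a b Phi : is_segint a b Phi -> segint a b = Phi 1 - Phi 0.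
Proof.
move=> H; rewrite /segint; case: xgetP => [S _ [Psi HPsi ->]|/(_ (Phi 1 - Phi 0))].
  apply/eqP; rewrite -subr_eq0 -modulus_eq0 eq_le modulus_ge0 andbT.
  have := @path_mean_value R (fun s => Psi s - Phi s) (fun=> 0) 0.
  rewrite (_ : _ - _ - _ = Psi 1 - Psi 0 - (Phi 1 - Phi 0)); last by ring.
  apply=> [t t01|t _]; last by rewrite modulus0.
  by have := pderivB (HPsi t t01) (H t t01); rewrite subrr.
by case; exists Phi.
Qed.

Lemma is_segint_sub a b Phi (p q : R) : 0 <= p <= 1 -> 0 <= p + q <= 1 ->
  is_segint a b Phi ->
  is_segint (line_point a b p) (line_point a b (p + q)) (fun s => Phi (p + q * s)).
Proof.
move=> p01 q01 H t t01.
have : 0 <= p + q * t <= 1.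
  by move: p01 q01 t01 => /andP[? ?] /andP[? ?] /andP[? ?]; apply/andP; split; nra.
move=> /H/pderiv_reparam.
rewrite /line_point (_ : a + p%:C * (b - a) + _ = a + (p + q * t)%:C * (b - a)); last first.
  by rewrite !rmorphD !rmorphM /=; ring.
rewrite (_ : _ * q%:C = f (a + (p + q * t)%:C * (b - a)) *
  (a + (p + q)%:C * (b - a) - (a + p%:C * (b - a)))) //.
by rewrite !rmorphD /=; ring.
Qed.

Lemma line_point0 a b : line_point a b 0 = a.
Proof. by rewrite /line_point mul0r addr0. Qed.
Lemma line_point1 a b : line_point a b 1 = b.
Proof. by rewrite /line_point mul1r addrC subrK. Qed.

Lemma segint_sub a b Phi (p q : R) : 0 <= p <= 1 -> 0 <= p + q <= 1 ->
  is_segint a b Phi ->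
  segint (line_point a b p) (line_point a b (p + q)) = Phi (p + q) - Phi p.
Proof.
move=> p01 q01 H; rewrite (segintE (is_segint_sub p01 q01 H)).
by rewrite mulr1 mulr0 addr0.
Qed.

(** An affine integrand has the explicit primitive [g], and the terms [c * (b - a)] and
    [b ^+ 2 - a ^+ 2] telescope around a closed polygon, which is how [goursat] disposes of the
    affine part of [f]. *)
Lemma segint_approx a b Phi c d (K : R) : is_segint a b Phi ->
  (forall t : R, 0 <= t <= 1 ->
     modulus (f (line_point a b t) - (c + d * line_point a b t)) <= K) ->
  modulus (segint a b - (c * (b - a) + d / 2 * (b ^+ 2 - a ^+ 2))) <= K * modulus (b - a).
Proof.
move=> H HK; rewrite (segintE H).
pose g w := c * w + d / 2 * w ^+ 2.
have gd w : cderiv g w (c + d * w).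
  have := cderivD (cderivZ c (cderiv_id w)) (cderivZ (d / 2) (cderivX 2 (cderiv_id w))).
  rewrite (_ : c * 1 + _ = c + d * w) //.
  by rewrite expr1; field.
have gp (t : R) : pderiv (fun s : R => g (line_point a b s)) t
   ((c + d * line_point a b t) * (b - a)) by apply: cderiv_line; exact: gd.
have := @path_mean_value R (fun s => Phi s - g (line_point a b s))
  (fun t => f (line_point a b t) * (b - a) - (c + d * line_point a b t) * (b - a))
  (K * modulus (b - a)).
rewrite line_point0 line_point1.
rewrite (_ : _ - _ - _ = Phi 1 - Phi 0 - (c * (b - a) + d / 2 * (b ^+ 2 - a ^+ 2))); last first.
  by rewrite /g; ring.
apply=> t t01; first exact: pderivB (H t t01) (gp t).
by rewrite -mulrBl modulusM ler_wpM2r ?modulus_ge0 ?HK.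
Qed.

(** The convex open region is the sublevel set [nu < r] of a quasiconvex 1-Lipschitz function, which
    covers both half-planes ([nu = Re]) and discs ([nu z = |z - z0|]). *)
Variables (nu : C -> R) (r : R).
Hypothesis nu_convex : forall a b (t : R), 0 <= t <= 1 ->
  nu (line_point a b t) <= Num.max (nu a) (nu b).
Hypothesis nu_lip : forall z w, nu z <= nu w + modulus (z - w).
Hypothesis f_cderiv : forall z, nu z < r -> exists l, cderiv f z l.

Lemma is_segint_ex a b : nu a < r -> nu b < r -> exists Phi, is_segint a b Phi.
Proof.
move=> ar br.
(* [path_antiderivative] wants a path continuous on the whole line; the parameter is clamped to
   [[0, 1]], outside of which the line may leave the region. *)
pose clamp (t : R) := Num.max 0 (Num.min t 1).
have clamp01 t : 0 <= clamp t <= 1.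
  by rewrite /clamp le_max lexx /= ge_max ler01 ge_min lexx orbT.
have clamp_id (t : R) : 0 <= t <= 1 -> clamp t = t.
  by move=> /andP[t0 t1]; rewrite /clamp min_l // max_r.
have clamp_lip s t : `|clamp s - clamp t| <= `|s - t|.
  rewrite /clamp !(maxEle, minEle).
  case: (leP s 1) => ?; case: (leP t 1) => ?; do ?case: ifP => ?; 
  rewrite ler_norml; apply/andP; split;
  (have := ler_norm (s - t); have := ler_norm (t - s); rewrite (distrC t s); lra).
have [|Phi H] := @path_antiderivative R
    (fun t => f (line_point a b (clamp t)) * (b - a)).
  move=> t e e0; set z := line_point a b (clamp t).
  have zr : nu z < r.
    by apply: le_lt_trans (nu_convex _ _ (clamp01 t)) _; rewrite gt_max ar.
  have [l /cderiv_continuous fc] := f_cderiv zr.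
  set B := modulus (b - a) + 1.
  have B0 : 0 < B by rewrite ltr_wpDl ?modulus_ge0.
  have [d d0 Hd] := fc (e / B) (divr_gt0 e0 B0).
  exists (d / B) => [|s st]; first by rewrite divr_gt0.
  rewrite -mulrBl modulusM.
  have : modulus (f (line_point a b (clamp s)) - f z) < e / B.
    apply: Hd; rewrite (_ : _ - z = (clamp s - clamp t)%:C * (b - a)); last first.
      by rewrite /z /line_point rmorphB /=; ring.
    rewrite modulusM modulus_real.
    apply: (@le_lt_trans _ _ (`|s - t| * B)); last by rewrite -ltr_pdivlMr.
    by rewrite ler_pM ?modulus_ge0 // lerDl.
  rewrite ltr_pdivlMr //; apply: le_lt_trans.
  by rewrite ler_wpM2l ?modulus_ge0 // lerDl.
exists Phi => t t01; have := H t t01; by rewrite clamp_id.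
Qed.

Lemma segint_rev a b : nu a < r -> nu b < r -> segint b a = - segint a b.
Proof.
move=> ar br; have [Phi H] := is_segint_ex ar br.
have := @segint_sub a b Phi 1 (-1) _ _ H; rewrite subrr line_point0 line_point1 => ->.
- by rewrite (segintE H) opprB.
- by rewrite ler01 lexx.
- by rewrite ler01 lexx.
Qed.

Definition midpoint (a b : C) := line_point a b 2^-1.

Lemma half01 : 0 <= (2^-1 : R) <= 1. Proof. by apply/andP; split; lra. Qed.

Lemma nu_midpoint m a b : nu a <= m -> nu b <= m -> nu (midpoint a b) <= m.
Proof. by move=> am bm; apply: le_trans (nu_convex _ _ half01) _; rewrite ge_max am. Qed.

Lemma segint_mid a b : nu a < r -> nu b < r ->
  segint a b = segint a (midpoint a b) + segint (midpoint a b) b.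
Proof.
move=> ar br; have [Phi H] := is_segint_ex ar br.
have := @segint_sub a b Phi 0 2^-1 _ _ H; rewrite add0r line_point0 => ->.
- have := @segint_sub a b Phi 2^-1 2^-1 half01 _ H.
  rewrite (_ : 2^-1 + 2^-1 = 1 :> R) ?line_point1; last by field.
  move=> ->; last by rewrite ler01 lexx.
  by rewrite (segintE H); ring.
- by rewrite ler01 lexx.
- exact: half01.
Qed.

Let tri : Type := (C * C * C)%type.
Let bdry (t : tri) : C :=
  segint t.1.1 t.1.2 + segint t.1.2 t.2 + segint t.2 t.1.1.
Let perim (t : tri) : R :=
  modulus (t.1.1 - t.1.2) + modulus (t.1.2 - t.2) + modulus (t.2 - t.1.1).
Let within m (t : tri) := [/\ nu t.1.1 <= m, nu t.1.2 <= m & nu t.2 <= m].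

Lemma modulus_half (z : C) : modulus (z / 2) = modulus z / 2.
Proof. by rewrite modulusM modulusV -(rmorph_nat (real_complex R)) modulus_real normr_nat. Qed.

(** The triangle is cut along its midpoints. The inner edges cancel in the sum of the four boundary
    integrals, so one of these is at least a quarter of the whole, while the perimeter is halved. *)
Lemma triangle_step m t : m < r -> within m t -> exists t', [/\ within m t',
  perim t' = perim t / 2, modulus (bdry t) / 4 <= modulus (bdry t') &
  modulus (t'.1.1 - t.1.1) <= perim t].
Proof.
case: t => [[a b] c] mr [/= am bm cm].
have ab := nu_midpoint am bm; have bc := nu_midpoint bm cm; have ca := nu_midpoint cm am.
set x := midpoint a b in ab; set y := midpoint b c in bc; set z := midpoint c a in ca.
have lt w : nu w <= m -> nu w < r by move=> /le_lt_trans; apply.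
pose t1 : tri := (a, x, z); pose t2 : tri := (x, b, y).
pose t3 : tri := (z, y, c); pose t4 : tri := (y, z, x).
have E : bdry (a, b, c) = bdry t1 + bdry t2 + bdry t3 + bdry t4.
  rewrite /bdry /= (@segint_mid a b) ?lt // (@segint_mid b c) ?lt // (@segint_mid c a) ?lt //.
  rewrite -/x -/y -/z (@segint_rev x z) ?lt // (@segint_rev y z) ?lt // (@segint_rev x y) ?lt //.
  by ring.
have xE : x = a + (b - a) / 2 by rewrite /x /midpoint /line_point fmorphV rmorph_nat mulrC.
have yE : y = b + (c - b) / 2 by rewrite /y /midpoint /line_point fmorphV rmorph_nat mulrC.
have zE : z = c + (a - c) / 2 by rewrite /z /midpoint /line_point fmorphV rmorph_nat mulrC.
have p1 : perim t1 = perim (a, b, c) / 2.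
  rewrite /perim /= xE zE.
  rewrite (_ : a - _ = (a - b) / 2); last by field.
  rewrite (_ : _ - (c + _) = (b - c) / 2); last by field.
  rewrite (_ : c + _ - a = (c - a) / 2); last by field.
  by rewrite !modulus_half; field.
have p2 : perim t2 = perim (a, b, c) / 2.
  rewrite /perim /= xE yE.
  rewrite (_ : _ - b = (a - b) / 2); last by field.
  rewrite (_ : b - _ = (b - c) / 2); last by field.
  rewrite (_ : b + _ - _ = (c - a) / 2); last by field.
  by rewrite !modulus_half; field.
have p3 : perim t3 = perim (a, b, c) / 2.
  rewrite /perim /= zE yE.
  rewrite (_ : c + _ - _ = (a - b) / 2); last by field.
  rewrite (_ : _ - c = (b - c) / 2); last by field.
  rewrite (_ : c - _ = (c - a) / 2); last by field.
  by rewrite !modulus_half; field.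
have p4 : perim t4 = perim (a, b, c) / 2.
  rewrite /perim /= zE yE xE.
  rewrite (_ : b + _ - _ = (b - a) / 2); last by field.
  rewrite (_ : c + _ - _ = (c - b) / 2); last by field.
  rewrite (_ : a + _ - _ = (a - c) / 2); last by field.
  rewrite !modulus_half (modulusC b) (modulusC c b) (modulusC a c); by field.
have da : modulus (x - a) <= perim (a, b, c) /\ modulus (y - a) <= perim (a, b, c)
    /\ modulus (z - a) <= perim (a, b, c).
  rewrite /perim /= xE yE zE.
  have := modulus_ge0 (a - b); have := modulus_ge0 (b - c); have := modulus_ge0 (c - a).
  have -> : a + (b - a) / 2 - a = (b - a) / 2 by field.
  have -> : c + (a - c) / 2 - a = (c - a) / 2 by field.
  have -> : b + (c - b) / 2 - a = (b - a) + (c - b) / 2 by field.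
  have := modulusD (b - a) ((c - b) / 2).
  by rewrite !modulus_half (modulusC b a) (modulusC c b); split; [|split]; lra.
have : [\/ modulus (bdry (a, b, c)) / 4 <= modulus (bdry t1),
   modulus (bdry (a, b, c)) / 4 <= modulus (bdry t2),
   modulus (bdry (a, b, c)) / 4 <= modulus (bdry t3) |
   modulus (bdry (a, b, c)) / 4 <= modulus (bdry t4)].
  have := modulusD (bdry t1 + bdry t2 + bdry t3) (bdry t4); rewrite -E.
  have := modulusD (bdry t1 + bdry t2) (bdry t3); have := modulusD (bdry t1) (bdry t2).
  set A := modulus (bdry (a, b, c)).
  case: (leP (A / 4) (modulus (bdry t1))); first by constructor 1.
  case: (leP (A / 4) (modulus (bdry t2))); first by constructor 2.
  case: (leP (A / 4) (modulus (bdry t3))); first by constructor 3.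
  case: (leP (A / 4) (modulus (bdry t4))); first by constructor 4.
  by move=> *; exfalso; lra.
case: da => da1 [da2 da3].
case=> h; [exists t1|exists t2|exists t3|exists t4]; split => //.
by rewrite subrr modulus0 !addr_ge0 ?modulus_ge0.
Qed.

(** Around the limit point [z] of the nested triangles, [f] is affine up to [e' * |v - z|]. The
    affine part integrates to 0, so the [n]-th boundary integral is at most [3 * e' * q ^+ 2] with
    [q = p / 2 ^+ n], which balances the factor [4 ^+ n] lost in the subdivision. *)
Lemma goursat a b c : nu a < r -> nu b < r -> nu c < r ->
  segint a b + segint b c + segint c a = 0.
Proof.
move=> ar br cr; pose t0 : tri := (a, b, c).
pose m := Num.max (nu a) (Num.max (nu b) (nu c)).
have mr : m < r by rewrite !gt_max ar br.
have w0 : within m t0 by split; rewrite /= !le_max lexx ?orbT.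
have step_ex t : exists t', within m t -> [/\ within m t',
  perim t' = perim t / 2, modulus (bdry t) / 4 <= modulus (bdry t') &
  modulus (t'.1.1 - t.1.1) <= perim t].
  have [/(triangle_step mr)[t' H]|] := pselect (within m t); first by exists t'.
  by exists t.
have [step stepP] := choice step_ex.
pose T n := iter n step t0.
have wT n : within m (T n).
  by elim: n => [//|n IH]; have [] := stepP (T n) IH.
set p := perim t0.
have p0 : 0 <= p by rewrite !addr_ge0 ?modulus_ge0.
have pT n : perim (T n) = p / 2 ^+ n.
  elim: n => [|n IH]; first by rewrite expr0 divr1.
  by have [_ -> _ _] := stepP (T n) (wT n); rewrite IH exprS; field; rewrite expf_neq0.
have bT n : modulus (bdry t0) / 4 ^+ n <= modulus (bdry (T n)).
  elim: n => [|n IH]; first by rewrite expr0 divr1.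
  have [_ _ h _] := stepP (T n) (wT n); apply: le_trans h.
  rewrite exprSr invfM mulrA ler_wpM2r // invr_ge0 //.
have dT n k : modulus ((T (n + k)%N).1.1 - (T n).1.1) <= 2 * (p / 2 ^+ n) - 2 * (p / 2 ^+ (n + k)).
  elim: k => [|k IH]; first by rewrite addn0 subrr modulus0 subrr.
  have [_ _ _ h] := stepP (T (n + k)%N) (wT _).
  rewrite addnS; apply: le_trans (modulus_trans (T (n + k)%N).1.1 _ _) _.
  rewrite pT in h.
  have -> : p / 2 ^+ (n + k).+1 = p / 2 ^+ (n + k) / 2.
    by rewrite exprSr invfM mulrA.
  by move: h IH; rewrite [T _.+1]iterS -/(T _); lra.
have pn0 n : 0 <= p / 2 ^+ n by rewrite divr_ge0 // exprn_ge0.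
have dT' n k : (n <= k)%N -> modulus ((T k).1.1 - (T n).1.1) <= 2 * (p / 2 ^+ n).
  by move=> /subnKC <-; have := dT n (k - n)%N; have := pn0 (n + (k - n))%N; lra.
have [|z zl] := @most_lim R (fun n => (T n).1.1) (2 * p + modulus a).
  apply: most_all => n; have := dT' 0%N n (leq0n _).
  rewrite expr0 divr1 /= => h; have := modulus_leD (T n).1.1 a; lra.
have zT n : modulus (z - (T n).1.1) <= 2 * (p / 2 ^+ n).
  by apply: (tends_le zl); apply: most_sub (most_geq n) => k; exact: dT'.
have zr : nu z < r.
  apply: le_lt_trans mr; apply/ler_addgt0Pr => e e0.
  have [n hn] := @exp2_small R (2 * p) e e0.
  have [wn _ _] := wT n; have := nu_lip z (T n).1.1; have := zT n.
  by rewrite mulrA; lra.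
have [l fl] := f_cderiv zr.
apply/eqP; rewrite -modulus_eq0 eq_le modulus_ge0 andbT -[X in modulus X]/(bdry t0).
apply/ler_addgt0Pr => e e0; rewrite add0r.
set e' := e / (3 * p ^+ 2 + 1).
have D0 : 0 < 3 * p ^+ 2 + 1 by rewrite ltr_wpDl // mulr_ge0 // exprn_ge0.
have e'0 : 0 < e' by rewrite divr_gt0.
have [d d0 H] := fl e' e'0.
have [n hn] := @exp2_small R (3 * p) d d0.
set q := p / 2 ^+ n; rewrite -mulrA -/q in hn.
move: (wT n) (pT n) (bT n) (zT n).
case: (T n) => [[x y] w] [/= xm ym wm]; rewrite -/q /perim /bdry /= => pq bq zq.
have near v : modulus (v - x) <= q ->
    modulus (f v - (f z - l * z + l * v)) <= e' * (3 * q).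
  move=> vx.
  have vz : modulus (v - z) <= 3 * q.
    by have := modulus_trans x v z; rewrite (modulusC x z); lra.
  have := H (v - z) (le_lt_trans vz hn); rewrite [z + _]addrC subrK.
  rewrite (_ : f v - f z - _ = f v - (f z - l * z + l * v)); last by ring.
  by move=> /le_trans; apply; rewrite ler_wpM2l // ltW.
have [n1 n2 n3] : [/\ 0 <= modulus (x - y), 0 <= modulus (y - w) & 0 <= modulus (w - x)].
  by rewrite !modulus_ge0.
have side u v : nu u <= m -> nu v <= m ->
   (forall t : R, 0 <= t <= 1 -> modulus (line_point u v t - x) <= q) ->
   modulus (segint u v - ((f z - l * z) * (v - u) + l / 2 * (v ^+ 2 - u ^+ 2)))
     <= e' * (3 * q) * modulus (v - u).
  move=> um vm uv; have [Phi HPhi] := is_segint_ex (le_lt_trans um mr) (le_lt_trans vm mr).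
  by apply: segint_approx HPhi _ => t /uv; exact: near.
have s1 := @side x y xm ym; have s2 := @side y w ym wm; have s3 := @side w x wm xm.
have {}s1 := s1 (fun t t01 => ltac:(
   by have := line_point_sub x y t01; rewrite (modulusC y x); lra)).
have {}s2 := s2 (fun t t01 => ltac:(
   by have := line_point_sub y w t01; have := modulus_trans y (line_point y w t) x; rewrite (modulusC w y) (modulusC y x); lra)).
have {}s3 := s3 (fun t t01 => ltac:(
   by have := line_point_sub w x t01; have := modulus_trans w (line_point w x t) x; have := modulus_trans y x w; rewrite (modulusC x w); lra)).
rewrite (modulusC y x) in s1; rewrite (modulusC w y) in s2; rewrite (modulusC x w) in s3.
have tot : modulus (segint x y + segint y w + segint w x) <= e' * (3 * q) * q.
  have -> : e' * (3 * q) * q = e' * (3 * q) * modulus (x - y) +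
      e' * (3 * q) * modulus (y - w) + e' * (3 * q) * modulus (w - x).
    by rewrite -!mulrDr pq.
  rewrite (_ : segint x y + segint y w + segint w x =
    (segint x y - ((f z - l * z) * (y - x) + l / 2 * (y ^+ 2 - x ^+ 2))) +
    (segint y w - ((f z - l * z) * (w - y) + l / 2 * (w ^+ 2 - y ^+ 2))) +
    (segint w x - ((f z - l * z) * (x - w) + l / 2 * (x ^+ 2 - w ^+ 2)))); last by ring.
  apply: le_trans (modulusD _ _) _; apply: lerD => //.
  by apply: le_trans (modulusD _ _) _; apply: lerD.
have := le_trans bq tot.
have p4 : 0 < 4 ^+ n :> R by rewrite exprn_gt0.
rewrite ler_pdivrMr //.
rewrite (_ : e' * (3 * q) * q * 4 ^+ n = e' * (3 * p ^+ 2)); last first.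
  rewrite /q (_ : 4 = 2 * 2 :> R); last by ring.
  by rewrite exprMn; field; rewrite expf_neq0.
move=> /le_trans; apply.
by rewrite /e' mulrAC ler_pdivrMr // ler_wpM2l ?lerDl // ltW.
Qed.

(** The primitive is the integral from a base point; [goursat] turns its increment into the integral
    over [[z, z + h]], where [f] is within [e] of [f z]. *)
Theorem primitive_ex : exists F, forall z, nu z < r -> cderiv F z (f z).
Proof.
have [[z0 z0r]|no] := pselect (exists z, nu z < r); last first.
  by exists f => z zr; exfalso; apply: no; exists z.
exists (segint z0) => z zr e e0.
have [l /cderiv_continuous fc] := f_cderiv zr.
have [d d0 H] := fc e e0.
exists (Num.min d (r - nu z)); first by rewrite lt_min d0 subr_gt0.
move=> h; rewrite lt_min => /andP[hd hr].
have zhr : nu (z + h) < r.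
  by have := nu_lip (z + h) z; rewrite [z + h]addrC addrK; lra.
have := goursat z0r zr zhr; rewrite (@segint_rev z0 (z + h)) // => G.
have -> : segint z0 (z + h) - segint z0 z = segint z (z + h).
  by apply/eqP; rewrite -subr_eq0 -oppr_eq0; apply/eqP; rewrite -[RHS]G; ring.
have [Phi HPhi] := is_segint_ex zr zhr.
have := @segint_approx z (z + h) Phi (f z) 0 e HPhi.
rewrite mul0r mul0r addr0 [z + h - z]addrC addKr; apply => t t01.
rewrite mul0r addr0 ltW //; apply: H.
by apply: le_lt_trans (line_point_sub _ _ t01) _; rewrite addrC addKr.
Qed.

End Goursat.

(** * The complex exponential *)

Section ComplexExponential.
Variable R : realType.
Local Notation C := R[i].

Definition cexp (z : C) : C := (expR (Re z) * cos (Im z)) +i* (expR (Re z) * sin (Im z)).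

Lemma cexpD z w : cexp (z + w) = cexp z * cexp w.
Proof.
case: z w => [a b] [c d]; rewrite /cexp /= expRD cosD sinD.
by apply/eqP; rewrite eq_complex /=; apply/andP; split; apply/eqP; ring.
Qed.

Lemma cexp0 : cexp 0 = 1.
Proof. by rewrite /cexp /= expR0 cos0 sin0 mulr0 mulr1. Qed.

Lemma modulus_cexp z : modulus (cexp z) = expR (Re z).
Proof.
by rewrite /cexp /= !exprMn -mulrDr cos2Dsin2 mulr1 sqrtr_sqr ger0_norm ?expR_ge0.
Qed.

Lemma cexp_neq0 z : cexp z != 0.
Proof. by rewrite -modulus_gt0 modulus_cexp expR_gt0. Qed.

(** The addition formula transports the derivative from the origin, where it follows from the
    derivatives of [expR], [cos] and [sin] at 0. *)
Lemma cderiv_cexp z : cderiv cexp z (cexp z).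
Proof.
suff : cderiv cexp 0 1.
  move=> H e e0.
  have E0 : 0 < modulus (cexp z) by rewrite modulus_gt0 cexp_neq0.
  have [d d0 Hd] := H _ (divr_gt0 e0 E0).
  exists d => // h /Hd; rewrite add0r cexp0 mul1r => {}Hd.
  rewrite cexpD (_ : _ - _ - _ = cexp z * (cexp h - 1 - h)); last by ring.
  by rewrite modulusM mulrC -ler_pdivlMr // mulrAC.
move=> e e0.
(* The four error terms below amount to [1 + 3 + 3 + 2 = 9] times [n * h], where [h] is the modulus
   of the increment. *)
have [n [n0 n1 n9]] : exists n : R, [/\ 0 < n, n <= 1 & 9 * n <= e].
  exists (Num.min 1 (e / 9)); split; first by rewrite lt_min ltr01 divr_gt0.
    by rewrite ge_min lexx.
  by rewrite mulrC -ler_pdivlMr // ge_min lexx orbT.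
have [d1 d10 H1] := (real_is_derive expR 0 _).2 (is_derive_expR (0 : R)) n n0.
have [d2 d20 H2] := (real_is_derive cos 0 _).2 (is_derive_cos (0 : R)) n n0.
have [d3 d30 H3] := (real_is_derive sin 0 _).2 (is_derive_sin (0 : R)) n n0.
exists (Num.min (Num.min d1 d2) (Num.min d3 n)).
  by rewrite !lt_min d10 d20 d30 n0.
move=> [x y]; move: x y => x y; rewrite !lt_min => /andP[/andP[k1 k2] /andP[k3 k4]].
have xh := normr_Re (x +i* y); have yh := normr_Im (x +i* y).
rewrite /= in xh yh.
set h := modulus (x +i* y) in k1 k2 k3 k4 *.
rewrite -/h in xh yh.
have h1 := H1 x (le_lt_trans xh k1); have h2 := H2 y (le_lt_trans yh k2).
have h3 := H3 y (le_lt_trans yh k3).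
rewrite expR0 add0r mul1r in h1.
rewrite cos0 sin0 add0r oppr0 mul0r subr0 in h2.
rewrite sin0 cos0 add0r subr0 mul1r in h3.
rewrite cexp0 add0r mul1r; apply: le_trans (modulus_le_ReIm _) _.
rewrite /cexp /=.
set X := expR x in h1 *; set c := cos y in h2 *; set s := sin y in h3 *.
have x1 : `|x| <= 1 by apply: le_trans xh _; apply: le_trans (ltW k4) _.
have nx : n * `|x| <= `|x| by rewrite ler_piMl.
have X3 : `|X| <= 3.
  have := ler_normD (X - 1 - x) (1 + x); rewrite (_ : X - 1 - x + (1 + x) = X); last by lra.
  by have := ler_normD 1 x; rewrite normr1; lra.
have X1 : `|X - 1| <= 2 * `|x|.
  have := ler_normD (X - 1 - x) x; rewrite subrK.
  lra.
have -> : X * c - 1 - x = (X - 1 - x) + X * (c - 1) by ring.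
have -> : X * s - 0 - y = X * (s - y) + (X - 1) * y by ring.
have q1 := ler_normD (X - 1 - x) (X * (c - 1)).
have q2 := ler_normD (X * (s - y)) ((X - 1) * y).
rewrite !normrM in q1 q2.
have r1 : `|X| * `|c - 1| <= 3 * (n * `|y|) by rewrite ler_pM.
have r2 : `|X| * `|s - y| <= 3 * (n * `|y|) by rewrite ler_pM.
have r3 : `|X - 1| * `|y| <= 2 * (n * `|y|).
  have xn : `|x| <= n by apply: le_trans xh (ltW k4).
  rewrite mulrA ler_wpM2r //; apply: le_trans X1 _; lra.
have r4 : n * `|y| <= n * h by rewrite ler_wpM2l // ltW.
have r5 : n * `|x| <= n * h by rewrite ler_wpM2l // ltW.
apply: (@le_trans _ _ (9 * n * h)); last by rewrite ler_wpM2r // (le_trans _ xh).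
lra.
Qed.

Definition tau : C := 0 +i* (pi *+ 2).

Lemma tau_neq0 : tau != 0.
Proof. by rewrite eq_complex /= eqxx /= mulrn_eq0 /= gt_eqF ?pi_gt0. Qed.

Lemma cexp_tau z : cexp (z + tau) = cexp z.
Proof.
by rewrite cexpD /tau /(cexp (0 +i* _)) /= expR0 cos2pi sin2pi mulr0 mulr1 mulr1.
Qed.

Lemma cderiv_cexp_comp f z l : cderiv f z l ->
  cderiv (fun w => cexp (f w)) z (cexp (f z) * l).
Proof. by move=> fl; apply: cderiv_comp fl _; exact: cderiv_cexp. Qed.

End ComplexExponential.

(** * Mean values over circles *)

Section CircleMean.
Variable R : realType.
Local Notation C := R[i].

(* The mean mu of f over the circles about z0 is the period, divided by
   [tau], of a primitive of [f (z0 + cexp w)] on a half-plane. *)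
Lemma circle_mean (f : C -> C) z0 (r : R) : 0 < r ->
  (forall z, 0 < modulus (z - z0) < r -> exists l, cderiv f z l) ->
  exists mu, forall (s : R) (c : C) (K : R), 0 < s < r ->
    (forall z, modulus (z - z0) = s -> modulus (f z - c) <= K) ->
    modulus (mu - c) <= K.
Proof.
move=> r0 fd.
have half (w : C) : Re w < ln r -> expR (Re w) < r.
  by rewrite -{2}(lnK (r0 : r \in Num.pos)) ltr_expR.
pose phi w := f (z0 + cexp w).
have convRe (a b : C) (t : R) : Re (line_point a b t) = (1 - t) * Re a + t * Re b.
  by case: a b => [a1 a2] [b1 b2] /=; ring.
have [|z w|w wr|F HF] := @primitive_ex R phi Re (ln r).
- move=> a b t /andP[t0 t1]; rewrite convRe.
  set x := Re a; set y := Re b.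
  by rewrite maxEle; case: ifP => [|/negbT]; rewrite -?ltNge => xy; nra.
- have := normr_Re (z - w); case: z w => [a b] [c d] /=.
  by move=> h; have := ler_norm (a - c); lra.
- have [|l fl] := fd (z0 + cexp w).
    by rewrite addrC addKr modulus_cexp expR_gt0 half.
  exists (l * cexp w); apply: (cderiv_comp (f := fun w => z0 + cexp w) _ fl).
  have := cderivD (cderiv_cst z0 w) (cderiv_cexp w); by rewrite add0r.
have ReT w : Re (w + tau R) = Re w by case: w => a b; rewrite /= addr0.
have phiT w : phi (w + tau R) = phi w by rewrite /phi cexp_tau.
(* The increment of [F] over one turn has derivative [phi (w + tau) - phi w = 0], so it is the same
   for all circles. *)
pose D w := F (w + tau R) - F w.
have Dd w : Re w < ln r -> cderiv D w 0.
  move=> wr; rewrite -(subrr (phi w)); apply: cderivB; last exact: HF.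
  rewrite -[phi w]mulr1; apply: (cderiv_comp (f := fun w => w + tau R)).
    have := cderivD (cderiv_id w) (cderiv_cst (tau R) w); by rewrite addr0.
  by rewrite -phiT; apply: HF; rewrite ReT.
have Dc u v : Re u < ln r -> Re v < ln r -> D v = D u.
  move=> ur vr; apply/eqP; rewrite -subr_eq0 -modulus_eq0 eq_le modulus_ge0 andbT.
  suff : modulus (D v - D u - 0 * (v - u)) <= 0 * modulus (v - u) by rewrite !mul0r subr0.
  apply: (@cderiv_mean_value R D (fun=> 0)) => t /andP[t0 t1].
  split; last by rewrite subrr modulus0.
  apply: Dd; rewrite convRe.
  have [->|t1'] := eqVneq t 1; first lra.
  have : 0 < 1 - t by rewrite subr_gt0 lt_neqAle t1'.
  by nra.
pose w0 : C := (ln r - 1)%:C.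
have w0r : Re w0 < ln r by rewrite /=; lra.
have T0 := tau_neq0 R; have nT : 0 < modulus (tau R) by rewrite modulus_gt0.
exists (D w0 / tau R) => s c K /andP[s0 sr] HK.
pose w : C := (ln s)%:C.
have wr : Re w < ln r by rewrite /= ltr_ln.
rewrite (Dc _ _ wr w0r).
have -> : D w / tau R - c = (F (w + tau R) - F w - c * (w + tau R - w)) / tau R.
  by rewrite /D; field.
rewrite modulusM modulusV ler_pdivrMr // [X in _ * modulus X](_ : tau R = w + tau R - w); last by ring.
(* The vertical segment from [w] to [w + tau] is mapped by [z0 + cexp] onto the circle of radius
   [s]. *)
apply: (@cderiv_mean_value R F phi) => t t01 /=.
set u := (_ + _ * _).
have uE : Re u = ln s by rewrite /u /w /tau /=; ring.
split; first by apply: HF; rewrite uE ltr_ln.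
by apply: HK; rewrite addrC addKr modulus_cexp uE lnK.
Qed.

(** Circles shrinking to [z0] identify the mean as [f z0]. Differentiability off the centre together
    with continuity at it is what is known of a difference quotient. *)
Lemma circle_mean_center (f : C -> C) z0 (r s : R) (c : C) (K : R) :
  (forall z, 0 < modulus (z - z0) < r -> exists l, cderiv f z l) ->
  ccontinuous f z0 -> 0 < s < r ->
  (forall z, modulus (z - z0) = s -> modulus (f z - c) <= K) ->
  modulus (f z0 - c) <= K.
Proof.
move=> fd fc /[dup] sr /andP[s0 s1] HK.
have [mu Hmu] := circle_mean (lt_trans s0 s1) fd.
suff -> : f z0 = mu by exact: Hmu HK.
apply/eqP; rewrite -subr_eq0 -modulus_eq0 eq_le modulus_ge0 andbT.
apply/ler_addgt0Pr => e e0; rewrite add0r modulusC.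
have [d d0 H] := fc e e0; pose s' := Num.min s (d / 2).
have s'0 : 0 < s' by rewrite lt_min s0 divr_gt0.
have s's : s' <= s by rewrite ge_min lexx.
have s'd : s' <= d / 2 by rewrite ge_min lexx orbT.
apply: (Hmu s'); first by rewrite s'0; lra.
by move=> z zs; apply/ltW/H; rewrite zs; lra.
Qed.

End CircleMean.

(** * Cauchy's estimates and the regularity of holomorphic functions *)

Section Holomorphic.
Variable R : realType.
Local Notation C := R[i].

(* [derive1], locked so that [ring] and conversion treat it as an atom. *)
Definition dc : (C -> C) -> C -> C := locked (fun f z => derive1 f z).

Lemma dcE f : dc f = derive1 f. Proof. by rewrite /dc; unlock. Qed.

Definition disc (z0 : C) (r : R) : set C := [set z | modulus (z - z0) < r].

Definition hol (f : C -> C) z0 r := forall z, disc z0 r z -> exists l, cderiv f z l.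

Lemma cderiv_dc f z l : cderiv f z l -> dc f z = l.
Proof. by move=> /cderivP[_]; rewrite dcE. Qed.

Lemma dcP f z : (exists l, cderiv f z l) -> cderiv f z (dc f z).
Proof. by case=> l fl; rewrite (cderiv_dc fl). Qed.

Lemma hol_cderiv f z0 r z : hol f z0 r -> disc z0 r z -> cderiv f z (dc f z).
Proof. by move=> H /H /dcP. Qed.

Lemma disc_sub z0 (r : R) z1 (r1 : R) : modulus (z1 - z0) + r1 <= r ->
  disc z1 r1 `<=` disc z0 r.
Proof. by move=> h z; rewrite /disc /= => h1; have := modulus_trans z1 z z0; lra. Qed.

Lemma hol_sub f z0 r z1 r1 : disc z1 r1 `<=` disc z0 r -> hol f z0 r -> hol f z1 r1.
Proof. by move=> h H z /h; exact: H. Qed.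

Definition dquot (f : C -> C) w z : C :=
  if z == w then dc f w else (f z - f w) / (z - w).

Lemma dquotE f w z : f z = f w + (z - w) * dquot f w z.
Proof.
rewrite /dquot; case: eqP => [->|/eqP zw]; first by rewrite subrr mul0r addr0.
by rewrite mulrC divfK ?subr_eq0 // addrC subrK.
Qed.

Lemma dquot_diag f w : dquot f w w = dc f w.
Proof. by rewrite /dquot eqxx. Qed.

Lemma dquot_off f w z : z != w -> dquot f w z = (f z - f w) / (z - w).
Proof. by rewrite /dquot => /negPf ->. Qed.

Lemma dquot_cderiv_off f w z l : z != w -> cderiv f z l ->
  exists l', cderiv (dquot f w) z l'.
Proof.
move=> zw fl; have zw0 : z - w != 0 by rewrite subr_eq0.
have g1 := cderivB fl (cderiv_cst (f w) z).
have g2 := cderiv_inv (f := fun u => u - w) zw0 (cderivB (cderiv_id z) (cderiv_cst w z)).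
eexists; apply: (@cderiv_near _ _ _ _ _ (modulus (z - w))) (cderivM g1 g2).
  by rewrite modulus_gt0.
move=> u uz; rewrite /dquot; have [uw|//] := eqVneq u w.
by move: uz; rewrite uw modulusC ltxx.
Qed.

Lemma dquot_continuous f w : cderiv f w (dc f w) -> ccontinuous (dquot f w) w.
Proof.
move=> fl e e0; have [d d0 H] := fl _ (divr_gt0 e0 (ltr0Sn _ 1)).
exists d => // z zd; have [->|zw] := eqVneq z w; first by rewrite subrr modulus0.
rewrite dquot_diag dquot_off //.
have zw0 : z - w != 0 by rewrite subr_eq0.
have := H _ zd; rewrite [w + _]addrC subrK => h.
apply: (@le_lt_trans _ _ (e / 2)); last by rewrite ltr_pdivrMr // ltr_pMr // ltr1n.
have -> : (f z - f w) / (z - w) - dc f w = (f z - f w - dc f w * (z - w)) / (z - w).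
  by move: (dc f w) => u; field.
by rewrite modulusM modulusV ler_pdivrMr // modulus_gt0.
Qed.

(** [dc f z0] is the central value of the difference quotient [dquot f z0], hence its mean over the
    circle of radius [s], where the quotient is at most [K / s]. *)
Lemma cauchy_diff f z0 (r s K : R) : hol f z0 r -> 0 < s < r ->
  (forall z, modulus (z - z0) = s -> modulus (f z - f z0) <= K) ->
  modulus (dc f z0) <= K / s.
Proof.
move=> fh /[dup] sr /andP[s0 s1] HK.
have z0r : disc z0 r z0 by rewrite /disc /= subrr modulus0; lra.
have := @circle_mean_center R (dquot f z0) z0 r s 0 (K / s).
rewrite dquot_diag !subr0; apply => //.
- move=> z /andP[z1 z2]; have [l fl] := fh z z2.
  by apply: dquot_cderiv_off fl; rewrite -subr_eq0 -modulus_gt0.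
- by apply: dquot_continuous; exact: hol_cderiv fh z0r.
move=> z zs; have zz0 : z != z0 by rewrite -subr_eq0 -modulus_gt0 zs.
by rewrite subr0 dquot_off // modulusM modulusV zs ler_pM2r ?invr_gt0 // HK.
Qed.

Definition bounded_hol f z0 (r B : R) :=
  hol f z0 r /\ forall z, disc z0 r z -> modulus (f z) <= B.

Lemma bounded_hol_sub f z0 r z1 r1 B : disc z1 r1 `<=` disc z0 r ->
  bounded_hol f z0 r B -> bounded_hol f z1 r1 B.
Proof. by move=> h [H1 H2]; split; [exact: hol_sub H1|move=> z /h/H2]. Qed.

Lemma cauchy_bound f z0 (r B : R) : 0 < r -> bounded_hol f z0 r B ->
  modulus (dc f z0) <= 4 * B / r.
Proof.
move=> r0 [fh fB].
have z0r : disc z0 r z0 by rewrite /disc /= subrr modulus0; lra.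
have := @cauchy_diff f z0 r (r / 2) (2 * B) fh.
rewrite (_ : 2 * B / (r / 2) = 4 * B / r); last by field; exact: lt0r_neq0.
apply => [|z zr]; first by apply/andP; split; lra.
have z1 : modulus (f z) <= B by apply: fB; rewrite /disc /= zr; lra.
by have := modulusB (f z) (f z0); have := fB _ z0r; lra.
Qed.

Lemma cauchy_bound_half f z0 (r B : R) z : 0 < r -> bounded_hol f z0 r B ->
  disc z0 (r / 2) z -> modulus (dc f z) <= 8 * B / r.
Proof.
move=> r0 fB zr.
have -> : 8 * B / r = 4 * B / (r / 2) by field; exact: lt0r_neq0.
apply: cauchy_bound; first by rewrite divr_gt0.
by apply: bounded_hol_sub fB; apply: disc_sub; move: zr; rewrite /disc /=; lra.
Qed.

Lemma modulus_segment (a b z0 : C) (r t : R) : 0 <= t <= 1 ->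
  disc z0 r a -> disc z0 r b -> disc z0 r (a + t%:C * (b - a)).
Proof.
move=> /andP[t0 t1]; rewrite /disc /= => ar br.
have -> : a + t%:C * (b - a) - z0 = (1 - t)%:C * (a - z0) + t%:C * (b - z0).
  by rewrite rmorphB rmorph1; ring.
apply: le_lt_trans (modulusD _ _) _; rewrite !modulusM !modulus_real !ger0_norm ?subr_ge0 //.
have [->|t1'] := eqVneq t 1; first by rewrite subrr mul0r mul1r add0r.
have : 0 < 1 - t by rewrite subr_gt0 lt_neqAle t1'.
by nra.
Qed.

Lemma disc_lipschitz f z0 (r K : R) z w : hol f z0 r ->
  (forall u, disc z0 r u -> modulus (dc f u) <= K) ->
  disc z0 r z -> disc z0 r w -> modulus (f w - f z) <= K * modulus (w - z).
Proof.
move=> fh fK zr wr.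
have := @cderiv_mean_value R f (dc f) z w 0 K; rewrite mul0r subr0; apply => t t01 /=.
have h := modulus_segment t01 zr wr; rewrite subr0.
by split; [exact: hol_cderiv fh h|exact: fK].
Qed.

Lemma dc_shift f z a : cderiv f (z + a) (dc f (z + a)) ->
  cderiv (fun z => f (z + a)) z (dc f (z + a)).
Proof.
move=> fl; rewrite -[dc f _]mulr1; apply: (cderiv_comp (f := fun z => z + a) _ fl).
by have := cderivD (cderiv_id z) (cderiv_cst a z); rewrite addr0.
Qed.

(** Cauchy's estimate is applied to the increment [f (u + a) - f u], which is at most
    [8 * B / r * |a|]; at this stage [dc f] itself is not yet known to be differentiable. The
    constant is [2 * 8 * 16], from the circle of radius [r / 16]. *)
Lemma dc_lipschitz f z0 (r B : R) z w : 0 < r -> bounded_hol f z0 r B ->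
  disc z0 (r / 8) z -> disc z0 (r / 8) w ->
  modulus (dc f w - dc f z) <= 256 * B / r ^+ 2 * modulus (w - z).
Proof.
move=> r0 fB zr wr; have [fh _] := fB; pose a := w - z.
have da : modulus a < r / 4.
  by have := modulus_trans z0 w z; rewrite (modulusC z0) /a; move: zr wr; rewrite /disc /=; lra.
have hb : hol f z0 (r / 2) by apply: hol_sub fh; apply: disc_sub; rewrite subrr modulus0; lra.
have in1 u : modulus (u - z) < r / 8 -> disc z0 (r / 2) u.
  by move=> uz; have := modulus_trans z u z0; move: zr; rewrite /disc /=; lra.
have in2 u : modulus (u - z) < r / 8 -> disc z0 (r / 2) (u + a).
  move=> uz; have := modulus_trans u (u + a) z0; have := modulus_trans z u z0.
  by rewrite [u + a - u]addrC addKr; move: zr; rewrite /disc /=; lra.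
pose g u := f (u + a) - f u.
have gh u : modulus (u - z) < r / 8 -> cderiv g u (dc f (u + a) - dc f u).
  move=> uz; apply: cderivB; last exact: hol_cderiv hb (in1 _ uz).
  by apply: dc_shift; exact: hol_cderiv hb (in2 _ uz).
have zz : modulus (z - z) < r / 8 by rewrite subrr modulus0; lra.
have gB u : modulus (u - z) < r / 8 -> modulus (g u) <= 8 * B / r * modulus a.
  move=> uz; have := disc_lipschitz hb _ (in1 _ uz) (in2 _ uz).
  rewrite [u + a - u]addrC addKr; apply => v; exact: cauchy_bound_half.
have := @cauchy_diff g z (r / 8) (r / 16) (2 * (8 * B / r * modulus a)).
rewrite (cderiv_dc (gh z zz)) [z + a]addrC subrK.
rewrite (_ : _ / (r / 16) = 256 * B / r ^+ 2 * modulus a); last first.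
  by field; exact: lt0r_neq0.
apply => [u /gh|| u us]; first by exists (dc f (u + a) - dc f u).
  by apply/andP; split; lra.
have := gB u; rewrite us => h1; have := gB z zz; have := modulusB (g u) (g z).
by have : r / 16 < r / 8 by [lra]; move=> /h1; lra.
Qed.

Lemma second_order f z0 (r B : R) z w : 0 < r -> bounded_hol f z0 r B ->
  disc z0 (r / 8) z -> disc z0 (r / 8) w ->
  modulus (f w - f z - dc f z * (w - z)) <= 256 * B / r ^+ 2 * modulus (w - z) ^+ 2.
Proof.
move=> r0 fB zr wr; rewrite expr2 mulrA.
have B0 : 0 <= B.
  apply: le_trans (modulus_ge0 (f z0)) _; case: fB => _; apply.
  by rewrite /disc /= subrr modulus0.
apply: (@cderiv_mean_value R f (dc f)) => t t01 /=.
have h := modulus_segment t01 zr wr; split.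
  by case: fB => fh _; apply: (hol_cderiv fh); apply: disc_sub h; rewrite subrr modulus0; lra.
apply: le_trans (dc_lipschitz r0 fB zr h) _.
apply: ler_wpM2l; first by rewrite divr_ge0 ?mulr_ge0 ?exprn_ge0 // ltW.
exact: line_point_sub.
Qed.

Lemma cderiv_square f z l (d M : R) : 0 < d ->
  (forall h, modulus h < d -> modulus (f (z + h) - f z - l * h) <= M * modulus h ^+ 2) ->
  cderiv f z l.
Proof.
move=> d0 H e e0; set K := `|M| + 1.
have K0 : 0 < K by rewrite ltr_wpDl.
exists (Num.min d (e / K)) => [|h]; first by rewrite lt_min d0 divr_gt0.
rewrite lt_min => /andP[/H hd he]; apply: le_trans hd _.
rewrite expr2 mulrA ler_wpM2r ?modulus_ge0 //.
move: he; rewrite ltr_pdivlMr // => he; apply: le_trans (ltW he); rewrite mulrC.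
by rewrite ler_wpM2l ?modulus_ge0 //; have := ler_norm M; rewrite /K; lra.
Qed.

Lemma hol_locally_bounded f z0 r z : hol f z0 r -> disc z0 r z ->
  exists rho B : R, [/\ 0 < rho, disc z rho `<=` disc z0 r & bounded_hol f z rho B].
Proof.
move=> fh zr; have [l /cderiv_continuous fc] := fh z zr.
have [d d0 H] := fc 1 ltr01.
have rz : 0 < r - modulus (z - z0) by rewrite subr_gt0.
have sub : disc z (Num.min d (r - modulus (z - z0))) `<=` disc z0 r.
  by apply: disc_sub; rewrite addrC -lerBrDr ge_min lexx orbT.
exists (Num.min d (r - modulus (z - z0))), (modulus (f z) + 1); split => //.
  by rewrite lt_min d0.
split; first exact: hol_sub fh.
move=> w; rewrite /disc /= lt_min => /andP[/H wd _].
by have := modulus_leD (f w) (f z); lra.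
Qed.

(** The difference quotients [dq h] are holomorphic and, by [second_order], uniformly within
    [K * |h|] of [dc f]. Cauchy's estimate for [dq k - dq h] makes their derivatives [D h] at [z] a
    Cauchy family, with an explicit rate, as [h] tends to 0. *)
Theorem hol_dc f z0 r : hol f z0 r -> hol (dc f) z0 r.
Proof.
move=> fh z zr; have [rho [B [rho0 _ fB]]] := hol_locally_bounded fh zr.
have [gh _] := fB.
set K := 256 * B / rho ^+ 2.
have B0 : 0 <= B.
  apply: le_trans (modulus_ge0 (f z)) _; case: fB => _; apply.
  by rewrite /disc /= subrr modulus0.
have K0 : 0 <= K by rewrite divr_ge0 ?mulr_ge0 ?exprn_ge0 // ltW.
pose dq (h : C) u := (f (u + h) - f u) / h.
have in1 u : modulus (u - z) < rho / 16 -> disc z (rho / 8) u.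
  by rewrite /disc /=; lra.
have in2 u h : modulus (u - z) < rho / 16 -> modulus h < rho / 16 -> disc z (rho / 8) (u + h).
  move=> uz hr; have := modulus_trans u (u + h) z.
  by rewrite [u + h - u]addrC addKr /disc /=; lra.
have big : disc z (rho / 8) `<=` disc z rho.
  by apply: disc_sub; rewrite subrr modulus0; lra.
have dqK h u : h != 0 -> modulus h < rho / 16 -> modulus (u - z) < rho / 16 ->
    modulus (dq h u - dc f u) <= K * modulus h.
  move=> h0 hr uz; have := second_order rho0 fB (in1 _ uz) (in2 _ _ uz hr).
  rewrite [u + h - u]addrC addKr -/K => so.
  have -> : dq h u - dc f u = (f (u + h) - f u - dc f u * h) / h.
    by rewrite /dq; move: (dc f u) => v; field.
  by rewrite modulusM modulusV ler_pdivrMr ?modulus_gt0 // -mulrA -expr2.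
have dqd h u : modulus h < rho / 16 -> modulus (u - z) < rho / 16 ->
    cderiv (dq h) u ((dc f (u + h) - dc f u) / h).
  move=> hr uz.
  have := cderivZ h^-1 (cderivB (dc_shift (hol_cderiv gh (big _ (in2 _ _ uz hr))))
    (hol_cderiv gh (big _ (in1 _ uz)))).
  by rewrite mulrC; apply: cderiv_ext => v; rewrite mulrC.
have zz : modulus (z - z) < rho / 16 by rewrite subrr modulus0 divr_gt0.
pose D h := (dc f (z + h) - dc f z) / h.
set M := 64 * K / rho.
have M0 : 0 <= M.
  by apply: divr_ge0; [exact: mulr_ge0|exact: ltW].
have DD h k : h != 0 -> k != 0 -> modulus h < rho / 16 -> modulus k < rho / 16 ->
    modulus (D k - D h) <= M * (modulus h + modulus k).
  move=> h0 k0 hr kr; pose g u := dq k u - dq h u.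
  have gd u : modulus (u - z) < rho / 16 -> cderiv g u
      ((dc f (u + k) - dc f u) / k - (dc f (u + h) - dc f u) / h).
    by move=> uz; apply: cderivB; exact: dqd.
  have gb : bounded_hol g z (rho / 16) (K * (modulus h + modulus k)).
    split => [u /gd dg|u uz]; first by eexists; exact: dg.
    have := modulusB (dq k u - dc f u) (dq h u - dc f u).
    rewrite (_ : _ - _ - (_ - _) = g u); last first.
      by rewrite /g; move: (dc f u) => v; ring.
    by have := dqK _ _ h0 hr uz; have := dqK _ _ k0 kr uz; lra.
  have := cauchy_bound (_ : 0 < rho / 16) gb; rewrite divr_gt0 // => /(_ isT).
  rewrite (cderiv_dc (gd z zz)) -/(D k) -/(D h) => /le_trans; apply.
  rewrite le_eqVlt /M; apply/orP; left; apply/eqP; field; exact: lt0r_neq0.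
(* A null sequence of increments: the limit [l] of [D] is taken along it, and the rate in [DD]
   extends it to all [h]. *)
pose hn n : C := (rho / 32 / n.+1%:R)%:C.
have hnE n : modulus (hn n) = rho / 32 / n.+1%:R.
  by rewrite modulus_real ger0_norm // divr_ge0 // divr_ge0 // ltW.
have hn0 n : hn n != 0 by rewrite -modulus_gt0 hnE divr_gt0 // divr_gt0.
have hnr n : modulus (hn n) < rho / 16.
  rewrite hnE; apply: (@le_lt_trans _ _ (rho / 32)); last lra.
  by rewrite ler_pdivrMr // ler_pMr ?ler1n // divr_gt0.
have hn_small e : 0 < e -> most (fun n => M * modulus (hn n) < e).
  move=> e0; have P0 : 0 < e / (M * (rho / 32) + 1).
    by rewrite divr_gt0 // ltr_wpDl // mulr_ge0 // divr_ge0 // ltW.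
  have [n0 n0P] := inv_small P0.
  apply: most_sub (most_geq n0) => n n0n; rewrite hnE mulrA.
  have q0 : 0 <= M * (rho / 32) by rewrite mulr_ge0 // divr_ge0 // ltW.
  apply: (@le_lt_trans _ _ ((M * (rho / 32) + 1) / n0.+1%:R)).
    apply: ler_pM => //; first by rewrite lerDl.
    by rewrite lef_pV2 ?posrE // ler_nat.
  by rewrite mulrC -ltr_pdivlMr // ltr_wpDl.
have [|l Dl] := @most_lim R (fun n => D (hn n)) (modulus (D (hn 0%N)) + M * (rho / 8)).
  apply: most_all => n; have := DD _ _ (hn0 0%N) (hn0 n) (hnr 0%N) (hnr n).
  have := modulus_leD (D (hn n)) (D (hn 0%N)).
  have : M * (modulus (hn 0%N) + modulus (hn n)) <= M * (rho / 8).
    by rewrite ler_wpM2l //; have := hnr n; have := hnr 0%N; lra.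
  lra.
exists l; apply: (@cderiv_square _ _ _ (rho / 16) M); first by rewrite divr_gt0.
move=> h hr; have [->|h0] := eqVneq h 0.
  by rewrite addr0 subrr mulr0 subr0 modulus0 expr0n mulr0.
have -> : dc f (z + h) - dc f z - l * h = (D h - l) * h.
  by rewrite /D; move: (dc f z) (dc f (z + h)) => u v; field.
rewrite modulusM expr2 mulrA ler_wpM2r ?modulus_ge0 // modulusC.
apply/ler_addgt0Pr => e e0; apply: (tends_le Dl).
apply: most_sub (hn_small e e0) => n ne.
by have := DD _ _ h0 (hn0 n) hr (hnr n); lra.
Qed.

(** The diagonal point is the delicate one. There the derivative is half the second derivative of
    [f], found by applying the mean value inequality to [f] minus its quadratic term. *)
Theorem hol_dquot f z0 r w : hol f z0 r -> disc z0 r w -> hol (dquot f w) z0 r.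
Proof.
move=> fh wr z zr; have [zw|zw] := eqVneq z w; last first.
  by have [l fl] := fh z zr; exact: dquot_cderiv_off zw fl.
rewrite {z zr}zw; have fw := hol_cderiv (hol_dc fh) wr.
set l2 := dc (dc f) w in fw.
exists (l2 / 2) => e e0; have [d d0 H] := fw e e0.
have rw : 0 < r - modulus (w - z0) by rewrite subr_gt0.
exists (Num.min d (r - modulus (w - z0))); first by rewrite lt_min d0.
move=> h; rewrite lt_min => /andP[hd hr].
have [->|h0] := eqVneq h 0.
  by rewrite addr0 subrr mulr0 subr0 modulus0 mulr0.
pose g u := f u - l2 / 2 * (u - w) ^+ 2.
have gd u : disc z0 r u -> cderiv g u (dc f u - l2 * (u - w)).
  move=> ur; apply: cderivB; first exact: hol_cderiv fh ur.
  have := cderivZ (l2 / 2) (cderivX 2 (cderivB (cderiv_id u) (cderiv_cst w u))).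
  by rewrite (_ : _ * (_ * _ * _) = l2 * (u - w)) //= expr1 subr0; field.
have := @cderiv_mean_value R g (fun u => dc f u - l2 * (u - w)) w (w + h) (dc f w)
  (e * modulus h).
have -> : g (w + h) - g w - dc f w * (w + h - w) =
    f (w + h) - f w - dc f w * h - l2 / 2 * h ^+ 2.
  by rewrite /g; move: (dc f w) => u; ring.
rewrite [w + h - w]addrC addKr => so.
have {}so : modulus (f (w + h) - f w - dc f w * h - l2 / 2 * h ^+ 2) <=
    e * modulus h * modulus h.
  apply: so => t /[dup] t01 /andP[t0 t1] /=.
  have th : modulus (t%:C * h) <= modulus h.
    by rewrite modulusM modulus_real ger0_norm // ler_piMl ?modulus_ge0.
  split.
    apply: gd; rewrite /disc /=; have := modulus_trans w (w + t%:C * h) z0.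
    by rewrite [w + _ - w]addrC addKr; lra.
  have := H (t%:C * h) (le_lt_trans th hd).
  rewrite [w + _ - w]addrC addKr => h1.
  have -> : dc f (w + t%:C * h) - l2 * (t%:C * h) - dc f w =
    dc f (w + t%:C * h) - dc f w - l2 * (t%:C * h).
    by move: (dc f w) (dc f _) => u v; ring.
  by apply: le_trans h1 _; rewrite ler_wpM2l // ltW.
rewrite dquot_diag dquot_off; last by rewrite -subr_eq0 [w + h - w]addrC addKr.
rewrite [w + h - w]addrC addKr.
have -> : (f (w + h) - f w) / h - dc f w - l2 / 2 * h =
    (f (w + h) - f w - dc f w * h - l2 / 2 * h ^+ 2) / h.
  by move: (dc f w) (l2) => u v; field.
by rewrite modulusM modulusV ler_pdivrMr // modulus_gt0.
Qed.

End Holomorphic.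

Arguments dc {R}.

(** * Maximum modulus principle and Schwarz's lemma *)

Section MaximumModulus.
Variable R : realType.
Local Notation C := R[i].

(** Compactness by ultralimits: [lim] excludes a sequence along which [phi] is unbounded, and then
    yields the maximum as the limit of a maximizing sequence. *)
Lemma closed_disc_max (phi : C -> R) z0 (s : R) : 0 <= s ->
  (forall z, modulus (z - z0) <= s -> forall e : R, 0 < e -> exists2 d : R, 0 < d &
     forall w, modulus (w - z) < d -> phi w < phi z + e) ->
  exists2 p, modulus (p - z0) <= s & forall z, modulus (z - z0) <= s -> phi z <= phi p.
Proof.
move=> s0 usc.
have lim (u : nat -> C) : (forall n, modulus (u n - z0) <= s) ->
    exists2 p, modulus (p - z0) <= s & forall e : R, 0 < e -> most (fun n => phi (u n) < phi p + e).
  move=> us; have [|p up] := @most_lim R u (modulus z0 + s).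
    by apply: most_all => n; have := us n; have := modulus_leD (u n) z0; lra.
  have ps : modulus (p - z0) <= s by apply: (tends_le up); apply: most_all.
  exists p => // e e0; have [d d0 H] := usc p ps e e0.
  by apply: most_sub (up d d0) => n /H.
pose S := [set phi z | z in [set z | modulus (z - z0) <= s]].
have z0s : modulus (z0 - z0) <= s by rewrite subrr modulus0.
have Sb : has_ubound S.
  have [//|no] := pselect (has_ubound S).
  have H (n : nat) : exists z, modulus (z - z0) <= s /\ n%:R < phi z.
    have [//|H] := pselect (exists z, modulus (z - z0) <= s /\ n%:R < phi z).
    exfalso; apply: no; exists n%:R => _ [z zs <-]; rewrite leNgt; apply/negP => h.
    by apply: H; exists z.
  have [u uH] := choice H.
  have [|p ps up] := lim u; first by move=> n; case: (uH n).
  pose b := Num.bound (`|phi p| + 1).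
  have bP : `|phi p| + 1 < b%:R by apply: archi_boundP; rewrite addr_ge0.
  have [n [h1 h2]] := most_ex (most_and (up 1 ltr01) (most_geq b)).
  have [_ h3] := uH n; have h4 : b%:R <= n%:R :> R by rewrite ler_nat.
  by have := ler_norm (phi p); lra.
have Ssup : has_sup S by split => //; exists (phi z0), z0.
have H (n : nat) : exists z, modulus (z - z0) <= s /\ sup S - n.+1%:R^-1 < phi z.
  have n0 : 0 < n.+1%:R^-1 :> R by rewrite invr_gt0.
  by have [_ [z zs <-] h] := sup_adherent n0 Ssup; exists z.
have [u uH] := choice H.
have [|p ps up] := lim u; first by move=> n; case: (uH n).
exists p => // z zs; apply/ler_addgt0Pr => e e0.
have e2 : 0 < e / 2 by rewrite divr_gt0.
have [k kP] := inv_small e2.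
have [n [h1 h2]] := most_ex (most_and (up _ e2) (most_geq k)).
have [_ h3] := uH n.
have h4 : phi z <= sup S by apply: ub_le_sup => //; exists z.
have h5 : n.+1%:R^-1 <= k.+1%:R^-1 :> R by rewrite lef_pV2 ?posrE // ler_nat.
by move: (n.+1%:R^-1) (k.+1%:R^-1) h3 h5 kP => x y h3 h5 kP; lra.
Qed.

Lemma le_of_sqr_le (x y : R) : 0 <= y -> x ^+ 2 <= y ^+ 2 -> x <= y.
Proof.
move=> y0 h; rewrite leNgt; apply/negP => yx.
by move: h; rewrite leNgt => /negP; apply; rewrite ltr_pXn2r // ?nnegrE //; lra.
Qed.

(* A maximum of |f|^2 + eps |z - z0|^2 at an interior point p contradicts the
   mean value property of f times the exponential whose modulus has the
   logarithm eps Re (conj (p - z0) (z - p)) / |f p|^2. *)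
Theorem maximum_modulus (f : C -> C) z0 (r s K : R) z : hol f z0 r -> 0 < s < r ->
  (forall z, modulus (z - z0) = s -> modulus (f z) <= K) ->
  modulus (z - z0) <= s -> modulus (f z) <= K.
Proof.
move=> fh /andP[s0 sr] HK zs; rewrite leNgt; apply/negP => Kz.
have K0 : 0 <= K.
  apply: le_trans (modulus_ge0 _) (HK (z0 + s%:C) _).
  by rewrite addrC addKr modulus_real gtr0_norm.
set D := modulus (f z) ^+ 2 - K ^+ 2.
have D0 : 0 < D by rewrite subr_gt0 ltr_pXn2r ?nnegrE ?modulus_ge0.
(* With this [e] the perturbation is at most [D / 2] on the disc, too little for a maximum of [phi]
   on the boundary circle. *)
pose e := D / (2 * s ^+ 2).
have s20 : 0 < s ^+ 2 by rewrite exprn_gt0.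
have e0 : 0 < e by rewrite divr_gt0 // mulr_gt0.
have es : e * s ^+ 2 = D / 2 by rewrite /e; field; exact: lt0r_neq0.
pose phi w := modulus (f w) ^+ 2 + e * modulus (w - z0) ^+ 2.
have [|w ws x x0|p ps pmax] := @closed_disc_max phi z0 s; first exact: ltW.
  have [|l fl] := fh w; first by rewrite /disc /=; lra.
  have fc := cderiv_continuous fl.
  set a := modulus (f w); set b := modulus (w - z0).
  have [a0 b0] : 0 <= a /\ 0 <= b by rewrite !modulus_ge0.
  pose k := Num.min 1 (x / (2 * a + 1 + e * (2 * b + 1) + 1)).
  have Q0 : 0 < 2 * a + 1 + e * (2 * b + 1) + 1 by nra.
  have k0 : 0 < k by rewrite lt_min ltr01 divr_gt0.
  have k1 : k <= 1 by rewrite ge_min lexx.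
  have kx : k * (2 * a + 1 + e * (2 * b + 1) + 1) <= x.
    by rewrite -ler_pdivlMr // ge_min lexx orbT.
  have [d d0 H] := fc k k0; clearbody k.
  exists (Num.min d k); first by rewrite lt_min d0.
  move=> v; rewrite lt_min => /andP[/H h1 h2]; rewrite /phi.
  have h3 := modulus_leD (f v) (f w); have h4 := modulus_leD (v - z0) (w - z0).
  rewrite (_ : v - z0 - (w - z0) = v - w) in h4; last by ring.
  rewrite -/a -/b in h3 h4 *.
  have h5 : modulus (f v) ^+ 2 <= (a + k) ^+ 2.
    by rewrite ler_pXn2r ?nnegrE ?modulus_ge0 //; lra.
  have h6 : e * modulus (v - z0) ^+ 2 <= e * (b + k) ^+ 2.
    by rewrite ler_pM2l // ler_pXn2r ?nnegrE ?modulus_ge0 //; lra.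
  have kk : k * k <= k by rewrite ler_piMl // ltW.
  have ekk : e * (k * k) <= e * k by rewrite ler_pM2l.
  by rewrite !expr2 in h5 h6 *; nra.
have pz := pmax z zs.
have fp : K ^+ 2 + D / 2 < phi p.
  apply: (lt_le_trans _ pz); rewrite /phi.
  have : 0 <= e * modulus (z - z0) ^+ 2 by rewrite mulr_ge0 ?exprn_ge0 ?modulus_ge0 // ltW.
  by move: D0; rewrite /D; lra.
have ps' : modulus (p - z0) < s.
  rewrite lt_neqAle ps andbT; apply/eqP => E; move: fp; rewrite /phi E es.
  have : modulus (f p) ^+ 2 <= K ^+ 2 by rewrite ler_pXn2r ?nnegrE ?modulus_ge0 ?HK.
  by lra.
set A := modulus (f p) ^+ 2.
have A0 : 0 < A.
  have : e * modulus (p - z0) ^+ 2 <= e * s ^+ 2.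
    by rewrite ler_pM2l // ler_pXn2r ?nnegrE ?modulus_ge0 // ltW.
  have : 0 <= K ^+ 2 by rewrite exprn_ge0.
  by move: fp; rewrite /phi -/A; lra.
pose rho := (s - modulus (p - z0)) / 2.
have rho0 : 0 < rho by rewrite divr_gt0 // subr_gt0.
pose m : C := (e / A)%:C * (p - z0)^*.
pose h w := f w * cexp (m * (w - p)).
have hd w : disc z0 r w -> exists l, cderiv h w l.
  move=> /fh[l fl]; eexists; apply: (cderivM fl); apply: cderiv_cexp_comp.
  by apply: cderivZ; apply: cderivB (cderiv_id w) (cderiv_cst p w).
have sub w : modulus (w - p) <= rho -> modulus (w - z0) < s.
  by move=> wp; have := modulus_trans p w z0; rewrite /rho in wp; lra.
have hp : h p = f p by rewrite /h subrr mulr0 cexp0 mulr1.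
have := @circle_mean_center R h p (rho + (s - modulus (p - z0)) / 2) rho 0
  (modulus (f p) * expR (- (e * rho ^+ 2 / A / 2))).
rewrite hp subr0 leNgt => contra.
have {contra} : ~~ (modulus (f p) * expR (- (e * rho ^+ 2 / A / 2)) < modulus (f p)).
  apply: contra.
  - move=> w /andP[_ wp]; apply: hd; have := modulus_trans p w z0.
    by rewrite /disc /=; move: wp; rewrite /rho; lra.
  - have [|l hl] := hd p; first by rewrite /disc /=; lra.
    exact: cderiv_continuous hl.
  - by rewrite rho0 ltrDl divr_gt0 // subr_gt0.
  (* With [x = Re (conj (p - z0) * (w - p))], maximality gives [|f w|^2 <= A - e * (rho^2 + 2 x) <=
     A * exp (- e * (rho^2 + 2 x) / A)]; the exponential in [h] removes [x], which leaves
     [A * exp (- e * rho^2 / A)]. *)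
  move=> w wp; rewrite subr0; apply: le_of_sqr_le.
    by rewrite mulr_ge0 ?modulus_ge0 ?expR_ge0.
  rewrite exprMn -/A -expRM_natl.
  set x := Re ((p - z0)^* * (w - p)).
  have -> : modulus (h w) ^+ 2 = modulus (f w) ^+ 2 * expR (2 * (e / A * x)).
    rewrite /h modulusM exprMn modulus_cexp -expRM_natl; congr (_ * expR _).
    congr (_ * _); rewrite /m /x.
    move: (e / A) => k; case: (p - z0) => [p1 p2]; case: (w - p) => [w1 w2] /=; ring.
  have fw : modulus (f w) ^+ 2 <= A + - (e * (rho ^+ 2 + 2 * x)).
    have ws : modulus (w - z0) <= s by apply/ltW/sub; rewrite wp.
    have := pmax w ws; rewrite /phi -/A.
    have -> : modulus (w - z0) ^+ 2 = modulus (p - z0) ^+ 2 + (rho ^+ 2 + 2 * x).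
      rewrite -wp (_ : w - z0 = (p - z0) + (w - p)); last by ring.
      rewrite !modulus_sqr /x.
      by case: (p - z0) => [p1 p2]; case: (w - p) => [w1 w2] /=; ring.
    by lra.
  apply: (@le_trans _ _ (A * expR (- (e * (rho ^+ 2 + 2 * x)) / A) * expR (2 * (e / A * x)))).
    rewrite ler_wpM2r ?expR_ge0 //; apply: le_trans fw _.
    apply: (@le_trans _ _ (A * (1 + - (e * (rho ^+ 2 + 2 * x)) / A))).
      by rewrite le_eqVlt; apply/orP; left; apply/eqP; field; exact: lt0r_neq0.
    by rewrite ler_pM2l // expR_ge1Dx.
  rewrite -mulrA -expRD ler_pM2l // ler_expR.
  by rewrite le_eqVlt; apply/orP; left; apply/eqP; field; exact: lt0r_neq0.
apply/negP; rewrite negbK.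
have f0 : 0 < modulus (f p).
  by rewrite lt_neqAle modulus_ge0 andbT eq_sym; apply/eqP => E; move: A0; rewrite /A E expr0n ltxx.
rewrite gtr_pMr // -expR0 ltr_expR oppr_lt0 !divr_gt0 // mulr_gt0 // exprn_gt0 //.
Qed.

(** The quotient [dquot f z0] is holomorphic across [z0], so the maximum modulus principle bounds it
    by [1 / s] for every [s < r] large enough. *)
Theorem schwarz (f : C -> C) z0 (r : R) z : hol f z0 r -> f z0 = 0 ->
  (forall z, disc z0 r z -> modulus (f z) <= 1) ->
  disc z0 r z -> modulus (f z) <= modulus (z - z0) / r.
Proof.
move=> fh f0 f1 zr; have z0' := modulus_ge0 (z - z0).
have r0 : 0 < r by move: zr; rewrite /disc /=; lra.
have z0r : disc z0 r z0 by rewrite /disc /= subrr modulus0.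
have qh := hol_dquot fh z0r.
have fE := dquotE f z0; rewrite f0 in fE.
rewrite fE add0r modulusM ler_wpM2l ?modulus_ge0 // -[r^-1]mul1r ler_pdivlMr //.
apply/ler_addgt0Pr => e e0.
set Q := modulus (dquot f z0 z); have Q0 : 0 <= Q := modulus_ge0 _.
(* A circle that encloses [z] and is so close to the boundary that [Q * (r - s) <= e]. *)
pose s := Num.max (Num.max (modulus (z - z0)) (r / 2)) (r - e / (Q + 1)).
have Q1 : 0 < Q + 1 by rewrite ltr_wpDl.
have sr : s < r.
  rewrite !gt_max; apply/andP; split; [apply/andP; split; [exact: zr|lra]|].
  by rewrite gtrBl divr_gt0.
have s1 : modulus (z - z0) <= s by rewrite !le_max lexx.
have s2 : r / 2 <= s by rewrite !le_max lexx orbT.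
have s3 : r - e / (Q + 1) <= s by rewrite !le_max lexx !orbT.
clearbody s; have s0 : 0 < s by lra.
have : Q <= 1 / s.
  apply: (maximum_modulus qh (s := s)) => //; first by rewrite s0.
  move=> w ws; rewrite ler_pdivlMr //.
  have := f1 w; rewrite fE add0r modulusM ws mulrC; apply.
  by rewrite /disc /= ws.
rewrite ler_pdivlMr // => Qs.
have : Q * (e / (Q + 1)) <= e.
  by rewrite mulrCA ler_piMr ?ltW // ltr_pdivrMr // mul1r ltrDl.
nra.
Qed.

End MaximumModulus.

(** * Harnack's inequality and growth off the level set *)

Section Harnack.
Variable R : realType.
Local Notation C := R[i].

Lemma hol_const (f : C -> C) z0 (r : R) z w : (forall u, disc z0 r u -> cderiv f u 0) ->
  disc z0 r z -> disc z0 r w -> f w = f z.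
Proof.
move=> fd zr wr; apply/eqP; rewrite -subr_eq0 -modulus_eq0 eq_le modulus_ge0 andbT.
rewrite -[X in _ <= X](mul0r (modulus (w - z))); apply: disc_lipschitz zr wr.
  by move=> u /fd; exists 0.
by move=> u /fd /cderiv_dc ->; rewrite modulus0.
Qed.

Lemma hol_primitive (f : C -> C) z0 (r : R) : hol f z0 r ->
  exists F, forall z, disc z0 r z -> cderiv F z (f z).
Proof.
move=> fh; apply: (@primitive_ex R f (fun z => modulus (z - z0)) r) => //.
- move=> a b t t01; rewrite leNgt; apply/negP => h.
  have := @modulus_segment R a b z0 (modulus (line_point a b t - z0)) t t01.
  by move: h; rewrite /disc /= gt_max => /andP[h1 h2] /(_ h1 h2); rewrite ltxx.
- by move=> z w; rewrite [X in _ <= X]addrC modulus_trans.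
Qed.

(** With [F] a primitive of [f' / f], the product [f * exp (- F)] is constant; the logarithm of its
    modulus is the constant that makes the real part equal to [ln |f|]. *)
Lemma hol_log (f : C -> C) z0 (r : R) : 0 < r -> hol f z0 r ->
  (forall z, disc z0 r z -> f z != 0) ->
  exists L, [/\ hol L z0 r, forall z, disc z0 r z -> Re (L z) = ln (modulus (f z)) &
    forall z, disc z0 r z -> cderiv L z (dc f z / f z)].
Proof.
move=> r0 fh f0.
have z0r : disc z0 r z0 by rewrite /disc /= subrr modulus0.
have dh := hol_dc fh.
have [|F HF] := @hol_primitive (fun z => dc f z / f z) z0 r.
  move=> z zr; eexists; apply: (cderivM (hol_cderiv dh zr)).
  by apply: cderiv_inv (f0 z zr) (hol_cderiv fh zr).
have const z : disc z0 r z -> f z * cexp (- F z) = f z0 * cexp (- F z0).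
  move=> zr; apply: (@hol_const (fun u => f u * cexp (- F u)) z0 r) => // u ur.
  have := cderivM (hol_cderiv fh ur) (cderiv_cexp_comp (cderivN (HF u ur))).
  rewrite (_ : _ + _ = 0) //; move: (dc f u) (f0 u ur) => v fu; field; exact: fu.
pose L z := F z + (ln (modulus (f z0 * cexp (- F z0))))%:C.
have Ld z : disc z0 r z -> cderiv L z (dc f z / f z).
  by move=> zr; have := cderivD (HF z zr) (cderiv_cst _ z); rewrite addr0; exact.
exists L; split => // z zr; first by eexists; exact: Ld.
rewrite /L -(const z zr) modulusM modulus_cexp lnM ?posrE ?modulus_gt0 ?f0 ?expR_gt0 //.
by rewrite expRK; case: (F z) => x y /=; ring.
Qed.

(** Schwarz's lemma for the Cayley transform [(L - L w) / (L + conj (L w))], which takes the right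
    half-plane to the unit disc and [L w] to 0. *)
Lemma half_plane_schwarz (L : C -> C) w (r : R) : 0 < r -> hol L w r ->
  (forall z, disc w r z -> 0 < Re (L z)) ->
  (forall z, disc w r z -> modulus (L z - L w) <= modulus (z - w) / r * modulus (L z + (L w)^*)).
Proof.
move=> r0 Lh Lp; have wr : disc w r w by rewrite /disc /= subrr modulus0.
have Aw := Lp w wr.
have den z : disc w r z -> 0 < modulus (L z + (L w)^*).
  move=> zr; apply: lt_le_trans (le_trans (ler_norm _) (normr_Re _)).
  by have := Lp z zr; move: Aw; case: (L z) (L w) => [a b] [c d] /=; lra.
pose h z := (L z - L w) / (L z + (L w)^*).
have hh : hol h w r.
  move=> z zr; have Ld := hol_cderiv Lh zr.
  eexists; apply: (cderivM (cderivB Ld (cderiv_cst (L w) z))).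
  apply: cderiv_inv; first by rewrite -modulus_gt0 den.
  exact: cderivD Ld (cderiv_cst _ z).
have hm z : modulus (h z) = modulus (L z - L w) / modulus (L z + (L w)^*).
  by rewrite /h modulusM modulusV.
move=> z zr; rewrite -ler_pdivrMr ?den // -hm.
apply: schwarz hh _ _ zr; first by rewrite /h subrr mul0r.
move=> u ur; rewrite hm ler_pdivrMr ?den // mul1r.
apply: le_of_sqr_le; first exact: modulus_ge0.
have := Lp u ur; rewrite !modulus_sqr; move: Aw.
by case: (L u) (L w) => [a b] [c d] /=; nra.
Qed.

Lemma half_plane_harnack (L : C -> C) w (r : R) z : 0 < r -> hol L w r ->
  (forall z, disc w r z -> 0 < Re (L z)) -> disc w r z ->
  Re (L w) * (1 - modulus (z - w) / r) <= Re (L z) * (1 + modulus (z - w) / r).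
Proof.
move=> r0 Lh Lp zr; have := half_plane_schwarz r0 Lh Lp zr.
have wr : disc w r w by rewrite /disc /= subrr modulus0.
have Aw := Lp w wr; have Az := Lp z zr.
set t := modulus (z - w) / r => h.
have t0 : 0 <= t by rewrite divr_ge0 ?modulus_ge0 // ltW.
have t1 : t <= 1 by rewrite ler_pdivrMr // mul1r ltW.
have : modulus (L z - L w) ^+ 2 <= t ^+ 2 * modulus (L z + (L w)^*) ^+ 2.
  rewrite -exprMn; apply: lerXn2r => //; rewrite nnegrE ?modulus_ge0 //.
  by apply: mulr_ge0 => //; exact: modulus_ge0.
rewrite !modulus_sqr; move: Aw Az; case: (L z) (L w) => [x y] [a b] /= Aw Az h2.
suff : a - x <= t * (x + a) by lra.
apply: le_of_sqr_le; first by apply: mulr_ge0 => //; lra.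
have t2 : t ^+ 2 <= 1 by rewrite expr_le1.
have Y0 : 0 <= (y - b) ^+ 2 by rewrite sqr_ge0.
have : t ^+ 2 * (y - b) ^+ 2 <= (y - b) ^+ 2 by rewrite ler_piMl.
have : t ^+ 2 * ((x + a) ^+ 2 + (y - b) ^+ 2) = (t * (x + a)) ^+ 2 + t ^+ 2 * (y - b) ^+ 2 by ring.
have : (x - a) ^+ 2 = (a - x) ^+ 2 by ring.
have -> : (a - x) ^+ 2 = (x - a) ^+ 2 by ring.
move: h2.
lra.
Qed.

(** On the circle of radius [s], [half_plane_schwarz] gives [|L z - L w| <= 2 * s * Re (L w) / (r -
    s)]; Cauchy's estimate divides by [s], and [s] tends to 0. *)
Lemma half_plane_derivative (L : C -> C) w (r : R) : 0 < r -> hol L w r ->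
  (forall z, disc w r z -> 0 < Re (L z)) ->
  modulus (dc L w) <= 2 * Re (L w) / r.
Proof.
move=> r0 Lh Lp; have wr : disc w r w by rewrite /disc /= subrr modulus0.
have Aw := Lp w wr.
have H s : 0 < s < r -> modulus (dc L w) <= 2 * Re (L w) / (r - s).
  move=> /[dup] sr /andP[s0 s1].
  have rs : 0 < r - s by lra.
  have -> : 2 * Re (L w) / (r - s) = 2 * Re (L w) * s / (r - s) / s.
    by field; rewrite !lt0r_neq0.
  apply: (cauchy_diff Lh sr) => z zs; rewrite ler_pdivlMr //.
  have zr : disc w r z by rewrite /disc /= zs.
  have := half_plane_schwarz r0 Lh Lp zr; rewrite zs.
  have h1 : modulus (L z + (L w)^*) <= modulus (L z - L w) + 2 * Re (L w).
    rewrite (_ : L z + _ = (L z - L w) + (2 * Re (L w))%:C); last first.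
      case: (L z) (L w) => [a b] [c d] /=; apply/eqP; rewrite eq_complex /=.
      by apply/andP; split; apply/eqP; ring.
    apply: le_trans (modulusD _ _) _; rewrite modulus_real ger0_norm //.
    by rewrite mulr_ge0 // ltW.
  rewrite mulrAC ler_pdivlMr // => h2.
  have : s * modulus (L z + (L w)^*) <= s * (modulus (L z - L w) + 2 * Re (L w)).
    by rewrite ler_pM2l.
  nra.
rewrite ler_pdivlMr //; apply/ler_addgt0Pr => e e0.
set m := modulus (dc L w) in H *; have m0 : 0 <= m := modulus_ge0 _.
have m1 : 0 < m + 1 by rewrite ltr_wpDl.
pose s := Num.min (r / 2) (e / (m + 1)).
have s0 : 0 < s by rewrite lt_min !divr_gt0.
have s1 : s <= r / 2 by rewrite ge_min lexx.
have s2 : s <= e / (m + 1) by rewrite ge_min lexx orbT.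
have := H s; rewrite ler_pdivlMr; last lra.
move=> h; have {}h : m * (r - s) <= 2 * Re (L w) by apply: h; rewrite s0; lra.
have : m * s <= (m + 1) * s by rewrite ler_wpM2r ?lerDl // ltW.
move: s2; rewrite ler_pdivlMr // => s2; lra.
Qed.

Section ZeroFree.
Variables (f : C -> C) (w : C) (r B : R).
Hypotheses (r0 : 0 < r) (fh : hol f w r) (f0 : forall z, disc w r z -> f z != 0)
  (fB : forall z, disc w r z -> modulus (f z) <= B).

(** The function with positive real part is [ln B + e - log f]; the margin [e] keeps positivity
    strict where [|f| = B], and is later made to tend to 0. *)
Lemma zero_free_log (e : R) : 0 < e -> exists L, [/\ hol L w r,
  forall z, disc w r z -> Re (L z) = ln B - ln (modulus (f z)) + e,
  forall z, disc w r z -> 0 < Re (L z) &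
  forall z, disc w r z -> dc L z = - (dc f z / f z)].
Proof.
move=> e0; have [L [Lh LE Ld]] := hol_log r0 fh f0.
pose L' z := (ln B + e)%:C - L z.
have L'd z : disc w r z -> cderiv L' z (- (dc f z / f z)).
  by move=> zr; have := cderivB (cderiv_cst (ln B + e)%:C z) (Ld z zr); rewrite sub0r; exact.
have L'E z : disc w r z -> Re (L' z) = ln B - ln (modulus (f z)) + e.
  by move=> zr; rewrite /L' -(LE z zr); case: (L z) => a b /=; ring.
exists L'; split => //.
- by move=> z zr; eexists; exact: L'd.
- move=> z zr; rewrite L'E //; have m0 : 0 < modulus (f z) by rewrite modulus_gt0 f0.
  have : ln (modulus (f z)) <= ln B.
    by rewrite ler_ln ?posrE ?fB //; apply: lt_le_trans m0 (fB zr).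
  by lra.
- by move=> z zr; exact/cderiv_dc/L'd.
Qed.

Theorem harnack z : disc w r z ->
  (ln B - ln (modulus (f w))) * (1 - modulus (z - w) / r) <=
  (ln B - ln (modulus (f z))) * (1 + modulus (z - w) / r).
Proof.
move=> zr; apply/ler_addgt0Pr => e e0.
have wr : disc w r w by rewrite /disc /= subrr modulus0.
have e2 : 0 < e / 2 by rewrite divr_gt0.
have [L [Lh LE Lp _]] := zero_free_log e2.
have := half_plane_harnack r0 Lh Lp zr; rewrite !LE //.
set t := modulus (z - w) / r.
have t1 : t < 1 by rewrite ltr_pdivrMr // mul1r.
by have t0 : 0 <= t by [rewrite divr_ge0 ?modulus_ge0 // ltW]; nra.
Qed.

Theorem log_derivative_bound :
  modulus (dc f w / f w) <= 2 * (ln B - ln (modulus (f w))) / r.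
Proof.
have wr : disc w r w by rewrite /disc /= subrr modulus0.
rewrite ler_pdivlMr //; apply/ler_addgt0Pr => e e0.
have e2 : 0 < e / 2 by rewrite divr_gt0.
have [L [Lh LE Lp Ld]] := zero_free_log e2.
have := half_plane_derivative r0 Lh Lp.
by rewrite ler_pdivlMr // Ld // modulusN LE //; lra.
Qed.

End ZeroFree.

Definition entire (f : C -> C) := forall z, exists l, cderiv f z l.

Lemma entire_hol f z0 r : entire f -> hol f z0 r.
Proof. by move=> fe z _; exact: fe. Qed.

Lemma liouville_derive (f : C -> C) B z : entire f -> (forall z, modulus (f z) <= B) ->
  dc f z = 0.
Proof.
move=> fe fB; apply/eqP; rewrite -modulus_eq0 eq_le modulus_ge0 andbT.
apply/ler_addgt0Pr => e e0; rewrite add0r.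
have B0 : 0 <= B := le_trans (modulus_ge0 _) (fB z).
pose r := (4 * B + 1) / e.
have r0 : 0 < r by rewrite divr_gt0 // ltr_wpDl // mulr_ge0.
apply: le_trans (cauchy_bound r0 (B := B) _) _.
  by split; [exact: entire_hol|move=> *; exact: fB].
rewrite ler_pdivrMr // /r mulrCA divff ?lt0r_neq0 // mulr1.
by rewrite lerDl.
Qed.

(** The distance to the sublevel set attains its infimum at an ultralimit of a minimizing sequence;
    the point [p] keeps this limit inside the disc. *)
Lemma nearest_sublevel (f : C -> C) z0 (r : R) p : hol f z0 r -> 1 < modulus (f z0) ->
  disc z0 r p -> modulus (f p) <= 1 ->
  exists q, [/\ 0 < modulus (q - z0), modulus (q - z0) <= modulus (p - z0),
    modulus (f q) <= 1 & forall z, disc z0 (modulus (q - z0)) z -> 1 < modulus (f z)].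
Proof.
move=> fh f1 pr fp.
pose S := [set modulus (q - z0) | q in [set q | disc z0 r q /\ modulus (f q) <= 1]].
have Sinf : has_inf S.
  by split; [exists (modulus (p - z0)), p|exists 0 => _ [q _ <-]; exact: modulus_ge0].
have lb q : disc z0 r q -> modulus (f q) <= 1 -> inf S <= modulus (q - z0).
  by move=> q1 q2; apply: ge_inf; [case: Sinf|exists q].
have H (n : nat) : exists q, [/\ disc z0 r q, modulus (f q) <= 1 &
    modulus (q - z0) < inf S + n.+1%:R^-1].
  have n0 : 0 < n.+1%:R^-1 :> R by rewrite invr_gt0.
  by have [_ [q [q1 q2] <-] h] := inf_adherent n0 Sinf; exists q.
have [u uH] := choice H.
have [|q uq] := @most_lim R u (r + modulus z0).
  apply: most_all => n; have [+ _ _] := uH n; rewrite /disc /= => h.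
  by have := modulus_leD (u n) z0; lra.
have qS : modulus (q - z0) <= inf S.
  apply/ler_addgt0Pr => e e0; apply: (tends_le uq).
  have [k kP] := inv_small e0.
  apply: most_sub (most_geq k) => n kn; have [_ _ h] := uH n.
  have h5 : n.+1%:R^-1 <= k.+1%:R^-1 :> R by rewrite lef_pV2 ?posrE // ler_nat.
  by move: (n.+1%:R^-1) (k.+1%:R^-1) h h5 kP => x y h h5 kP; lra.
have Sp := lb p pr fp.
have qr : disc z0 r q by move: pr; rewrite /disc /=; lra.
have [l /cderiv_continuous fc] := fh q qr.
have fq : modulus (f q) <= 1.
  have := tends_le (w := 0) (K := 1) (tends_comp uq fc); rewrite subr0; apply.
  by apply: most_all => n; rewrite subr0; case: (uH n).
have Sq := lb q qr fq.
exists q; split => //; last 1 first.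
- move=> z; rewrite /disc /= => zq; rewrite ltNge; apply/negP => fz.
  by have := lb z _ fz; rewrite /disc /=; move: qr; rewrite /disc /=; lra.
- rewrite modulus_gt0 subr_eq0; apply/eqP => E; move: fq; rewrite E; lra.
- lra.
Qed.

Section Level.
Variables (f : C -> C) (z0 : C) (r M : R).
Hypotheses (fh : hol f z0 r) (f1 : 1 < modulus (f z0))
  (fM : forall z, disc z0 r z -> modulus (f z) <= 1 -> modulus (dc f z) <= M).

Let fz0_gt0 : 0 < modulus (f z0) := lt_trans ltr01 f1.

(** Where [|f| > 1], Harnack's inequality is applied to [1 / f] with [B = 1], so that
    [ln B - ln |1 / f| = ln |f|]. *)
Let inv_hol rho : 0 < rho -> rho <= r -> (forall z, disc z0 rho z -> 1 < modulus (f z)) ->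
  [/\ hol (fun z => (f z)^-1) z0 rho, forall z, disc z0 rho z -> (f z)^-1 != 0 &
      forall z, disc z0 rho z -> modulus (f z)^-1 <= 1].
Proof.
move=> rho0 rhor fg.
have f0 z : disc z0 rho z -> f z != 0 by move=> /fg h; rewrite -modulus_gt0; lra.
split.
- move=> z zr; eexists; apply: cderiv_inv (f0 z zr) (hol_cderiv fh _).
  by move: zr; rewrite /disc /=; lra.
- by move=> z /f0 ?; rewrite invr_eq0.
- by move=> z /fg h; rewrite modulusV invf_le1; lra.
Qed.

Lemma superlevel_harnack rho z : 0 < rho -> rho <= r ->
  (forall z, disc z0 rho z -> 1 < modulus (f z)) -> disc z0 rho z ->
  ln (modulus (f z0)) * (1 - modulus (z - z0) / rho) <=
  ln (modulus (f z)) * (1 + modulus (z - z0) / rho).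
Proof.
move=> rho0 rhor fg zr; have [gh g0 g1] := inv_hol rho0 rhor fg.
have pz := lt_trans ltr01 (fg z zr).
have := harnack rho0 gh g0 g1 zr; rewrite ln1 !modulusV !lnV ?posrE //.
by rewrite !sub0r !opprK.
Qed.

Lemma superlevel_log_derivative rho : 0 < rho -> rho <= r ->
  (forall z, disc z0 rho z -> 1 < modulus (f z)) ->
  modulus (dc f z0) <= modulus (f z0) * (2 * ln (modulus (f z0)) / rho).
Proof.
move=> rho0 rhor fg; have [gh g0 g1] := inv_hol rho0 rhor fg.
have := log_derivative_bound rho0 gh g0 g1.
have fz0 : f z0 != 0 by rewrite -modulus_gt0.
have z0r : disc z0 r z0 by rewrite /disc /= subrr modulus0; lra.
rewrite (cderiv_dc (cderiv_inv fz0 (hol_cderiv fh z0r))).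
rewrite (_ : _ / _ = - (dc f z0 / f z0)); last by move: (dc f z0) => v; field.
rewrite modulusN modulusM !modulusV lnV ?posrE //.
by rewrite ln1 sub0r opprK ler_pdivrMr // [X in _ <= X]mulrC.
Qed.

(** Hopf's lemma in quantitative form. On the radius to [q], at distance [t * rho] from [q],
    Harnack's inequality gives [t * ln |f z0| <= (2 - t) * ln |f| <= 2 * (|f| - 1)] when [|f| > 1],
    while the derivative bound at [q] gives [|f| - 1 <= M * t * rho] up to [o(t)]. Dividing by [t]
    leaves the claim. *)
Lemma superlevel_growth q : disc z0 r q -> 0 < modulus (q - z0) -> modulus (f q) <= 1 ->
  (forall z, disc z0 (modulus (q - z0)) z -> 1 < modulus (f z)) ->
  ln (modulus (f z0)) <= 2 * M * modulus (q - z0).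
Proof.
move=> qr rho0 fq fg; set rho := modulus (q - z0) in rho0 fg *.
have M0 : 0 <= M := le_trans (modulus_ge0 _) (fM qr fq).
apply/ler_addgt0Pr => e e0.
have e1 : 0 < e / (2 * rho) by rewrite divr_gt0 // mulr_gt0.
have [d d0 H] := hol_cderiv fh qr e1.
pose t := Num.min (1 / 2) (d / (2 * rho)).
have t0 : 0 < t by rewrite lt_min !divr_gt0 // mulr_gt0.
have t1 : t <= 1 / 2 by rewrite ge_min lexx.
have t2 : t * (2 * rho) <= d by rewrite -ler_pdivlMr ?mulr_gt0 // ge_min lexx orbT.
clearbody t.
pose h := (- t)%:C * (q - z0).
have hm : modulus h = t * rho by rewrite modulusM modulus_real normrN gtr0_norm.
have tr : 0 < t * rho by rewrite mulr_gt0.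
have hd : modulus h < d by rewrite hm; lra.
have zE : q + h - z0 = (1 - t)%:C * (q - z0).
  by rewrite /h rmorphN rmorphB rmorph1; ring.
have zm : modulus (q + h - z0) = (1 - t) * rho.
  by rewrite zE modulusM modulus_real ger0_norm //; lra.
have zr : disc z0 rho (q + h) by rewrite /disc /= zm; nra.
have rhor : rho <= r by rewrite ltW.
have := superlevel_harnack rho0 rhor fg zr.
rewrite zm mulfK ?lt0r_neq0 //.
set v := ln _ => har.
have fz := fg _ zr.
have lnz : ln (modulus (f (q + h))) <= modulus (f (q + h)) - 1.
  by have := @le_ln1Dx R (modulus (f (q + h)) - 1); rewrite [1 + _]addrC subrK; apply; lra.
have ln0 : 0 <= ln (modulus (f (q + h))) by apply: ln_ge0; lra.
have fqh : modulus (f (q + h)) - modulus (f q) <= (M + e / (2 * rho)) * (t * rho).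
  have := H h hd; rewrite hm.
  have := modulus_leD (f (q + h)) (f q).
  have := modulus_leD (f (q + h) - f q) (dc f q * h); rewrite modulusM hm.
  have : modulus (dc f q) * (t * rho) <= M * (t * rho).
    by apply: ler_wpM2r; [exact: ltW|exact: fM].
  by rewrite mulrDl; lra.
have E : (M + e / (2 * rho)) * (t * rho) * 2 = t * (2 * M * rho + e).
  by field; exact: lt0r_neq0.
rewrite -(ler_pM2l t0) -E; move: har; rewrite (_ : 1 - (1 - t) = t); last by ring.
by nra.
Qed.

Theorem level_growth p : disc z0 r p -> modulus (f p) <= 1 ->
  ln (modulus (f z0)) <= 2 * M * modulus (p - z0).
Proof.
move=> pr fp; have [q [q0 qp fq fg]] := nearest_sublevel fh f1 pr fp.
have qr : disc z0 r q by move: pr; rewrite /disc /=; lra.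
have M0 : 0 <= M := le_trans (modulus_ge0 _) (fM qr fq).
apply: le_trans (superlevel_growth qr q0 fq fg) _.
by rewrite ler_wpM2l // mulr_ge0.
Qed.

(** With [rho] the radius of the largest disc where [|f| > 1], [|f' / f| <= 2 * ln |f| / rho] at the
    centre. If that disc ends at a point of the level set, [ln |f z0| <= 2 * M * rho] turns this
    into [4 * M]. *)
Theorem level_derivative : 0 < r ->
  modulus (dc f z0) <= modulus (f z0) * Num.max (4 * M) (2 * ln (modulus (f z0)) / r).
Proof.
move=> r0.
have [[p [pr fp]]|no] := pselect (exists p, disc z0 r p /\ modulus (f p) <= 1).
  have [q [q0 qp fq fg]] := nearest_sublevel fh f1 pr fp.
  have qr : disc z0 r q by move: pr; rewrite /disc /=; lra.
  apply: le_trans (superlevel_log_derivative q0 (ltW qr) fg) _.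
  rewrite ler_wpM2l ?modulus_ge0 // le_max; apply/orP; left.
  rewrite ler_pdivrMr //; have := superlevel_growth qr q0 fq fg; lra.
have fg z : disc z0 r z -> 1 < modulus (f z).
  by move=> zr; rewrite ltNge; apply/negP => h; apply: no; exists z.
apply: le_trans (superlevel_log_derivative r0 (lexx r) fg) _.
by rewrite ler_wpM2l ?modulus_ge0 // le_max lexx orbT.
Qed.

End Level.
End Harnack.

(** * Convergent sequences, Hurwitz's theorem and functions of exponential type *)

Section Sequences.
Variable R : realType.
Local Notation C := R[i].
Implicit Types (f g : C -> C) (fs gs : nat -> C -> C).

Lemma tends_hol fs g z0 (r B : R) : 0 < r ->
  most (fun m => bounded_hol (fs m) z0 r B) ->
  (forall z, disc z0 r z -> tends (fun m => fs m z) (g z)) ->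
  exists l, cderiv g z0 l /\ tends (fun m => dc (fs m) z0) l.
Proof.
move=> r0 fB fg.
have z0r : disc z0 (r / 8) z0 by rewrite /disc /= subrr modulus0 divr_gt0.
have [|l dl] := @most_lim R (fun m => dc (fs m) z0) (4 * B / r).
  by apply: most_sub fB => m; exact: cauchy_bound.
exists l; split => //.
apply: (@cderiv_square _ _ _ _ (r / 8) (256 * B / r ^+ 2)); first by rewrite divr_gt0.
move=> h hr.
have z0h : disc z0 (r / 8) (z0 + h) by rewrite /disc /= addrC addKr.
have sub : disc z0 (r / 8) `<=` disc z0 r by apply: disc_sub; rewrite subrr modulus0; lra.
have T := tendsD (tendsD (fg _ (sub _ z0h)) (tendsM (tends_cst (-1)) (fg _ (sub _ z0r))))
  (tendsM (tends_cst (- h)) dl).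
have := tends_le (w := 0) T; rewrite subr0 => /(_ (256 * B / r ^+ 2 * modulus h ^+ 2)).
rewrite (_ : _ + _ + _ = g (z0 + h) - g z0 - l * h); last by ring.
apply; apply: most_sub fB => m fB.
have := second_order r0 fB z0r z0h; rewrite [z0 + h - z0]addrC addKr.
rewrite (_ : _ + _ + _ - 0 = fs m (z0 + h) - fs m z0 - dc (fs m) z0 * h) //.
by move: (dc _ _) => v; ring.
Qed.

Definition locbdd fs := forall r : R, exists B : R, most (fun m => bounded_hol (fs m) 0 r B).

(** Given local bounds, pointwise convergence already carries the derivatives along ([nconv_dc]), so
    no uniformity is recorded. *)
Definition nconv fs g := locbdd fs /\ forall z, tends (fun m => fs m z) (g z).

Lemma disc_in0 (z : C) (r : R) : disc z r `<=` disc 0 (modulus z + r).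
Proof. by apply: disc_sub; rewrite subr0. Qed.

Lemma nconv_cderiv fs g z : nconv fs g ->
  exists l, cderiv g z l /\ tends (fun m => dc (fs m) z) l.
Proof.
move=> [fb fg]; have [B HB] := fb (modulus z + 1).
apply: (@tends_hol _ _ _ 1 B) => //; first by apply: most_sub HB => m; exact/bounded_hol_sub/disc_in0.
Qed.

Lemma nconv_entire fs g : nconv fs g -> entire g.
Proof. by move=> fg z; have [l [gl _]] := nconv_cderiv z fg; exists l. Qed.

Lemma nconv_dc fs g : nconv fs g -> nconv (fun m => dc (fs m)) (dc g).
Proof.
move=> fg; split => [r|z]; last first.
  by have [l [/cderiv_dc -> ]] := nconv_cderiv z fg.
pose r1 := Num.max r 1.
have r1r : r <= r1 by rewrite le_max lexx.
have r10 : 0 < r1 by rewrite lt_max ltr01 orbT.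
have [B HB] := fg.1 (2 * r1); exists (8 * B / (2 * r1)).
have sub : disc (0 : C) r `<=` disc 0 (2 * r1).
  by apply: disc_sub; rewrite subrr modulus0; lra.
apply: most_sub HB => m [fh fB]; split; first exact/(hol_sub sub)/hol_dc.
move=> z zr; apply: cauchy_bound_half; first lra.
  by split; [exact: fh|exact: fB].
by move: zr; rewrite /disc /=; lra.
Qed.

Lemma nconv_iter fs g t : nconv fs g -> nconv (fun m => iter t dc (fs m)) (iter t dc g).
Proof. by move=> fg; elim: t => [//|t IH]; exact: nconv_dc IH. Qed.

Lemma nconv_cst c : nconv (fun _ _ => c) (fun=> c).
Proof.
split => [r|z]; last exact: tends_cst.
exists (modulus c); apply: most_all => m; split => // z _; by exists 0; exact: cderiv_cst.
Qed.

Lemma nconvM fs gs f g : nconv fs f -> nconv gs g ->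
  nconv (fun m z => fs m z * gs m z) (fun z => f z * g z).
Proof.
move=> [fb ff] [gb gg]; split => [r|z]; last exact: tendsM.
have [A HA] := fb r; have [B HB] := gb r; exists (A * B).
apply: most_sub2 HA HB => m [h1 h2] [h3 h4]; split => z zr.
  by eexists; exact: cderivM (hol_cderiv h1 zr) (hol_cderiv h3 zr).
by rewrite modulusM ler_pM ?modulus_ge0 ?h2 ?h4.
Qed.

Lemma nconvD fs gs f g : nconv fs f -> nconv gs g ->
  nconv (fun m z => fs m z + gs m z) (fun z => f z + g z).
Proof.
move=> [fb ff] [gb gg]; split => [r|z]; last exact: tendsD.
have [A HA] := fb r; have [B HB] := gb r; exists (A + B).
apply: most_sub2 HA HB => m [h1 h2] [h3 h4]; split => z zr.
  by eexists; exact: cderivD (hol_cderiv h1 zr) (hol_cderiv h3 zr).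
by apply: le_trans (modulusD _ _) _; rewrite lerD ?h2 ?h4.
Qed.

Lemma nconvX fs f n : nconv fs f -> nconv (fun m z => fs m z ^+ n) (fun z => f z ^+ n).
Proof.
move=> ff; elim: n => [|n IH]; first exact: (nconv_cst 1).
have -> : (fun m z => fs m z ^+ n.+1) = (fun m z => fs m z * fs m z ^+ n).
  by apply/funext => m; apply/funext => z; rewrite exprS.
have -> : (fun z => f z ^+ n.+1) = (fun z => f z * f z ^+ n).
  by apply/funext => z; rewrite exprS.
exact: nconvM.
Qed.

Lemma nconv_prod k (fs : 'I_k -> nat -> C -> C) (g : 'I_k -> C -> C) :
  (forall j, nconv (fs j) (g j)) ->
  nconv (fun m z => \prod_j fs j m z) (fun z => \prod_j g j z).
Proof.
elim: k fs g => [|k IH] fs g fg.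
  have -> : (fun m z => \prod_j fs j m z) = (fun _ _ => 1).
    by apply/funext => m; apply/funext => z; rewrite big_ord0.
  have -> : (fun z => \prod_j g j z) = (fun=> 1) by apply/funext => z; rewrite big_ord0.
  exact: nconv_cst.
have -> : (fun m z => \prod_j fs j m z) =
    (fun m z => fs ord0 m z * \prod_(j < k) fs (lift ord0 j) m z).
  by apply/funext => m; apply/funext => z; rewrite big_ord_recl.
have -> : (fun z => \prod_j g j z) = (fun z => g ord0 z * \prod_(j < k) g (lift ord0 j) z).
  by apply/funext => z; rewrite big_ord_recl.
by apply: nconvM => //; apply: IH.
Qed.

(** Harnack's inequality with ratio at most 1/2 reads [3 * ln |f z| <= 2 * ln B + ln |f w|]; in
    exponential form it survives a limit in which [f w] tends to 0. *)
Lemma harnack_cube f w z (r B : R) : 0 < r -> hol f w r ->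
  (forall u, disc w r u -> f u != 0) -> (forall u, disc w r u -> modulus (f u) <= B) ->
  modulus (z - w) <= r / 2 -> modulus (f z) ^+ 3 <= B ^+ 2 * modulus (f w).
Proof.
move=> r0 fh f0 fB zw.
have zr : disc w r z by rewrite /disc /=; lra.
have wr : disc w r w by rewrite /disc /= subrr modulus0.
have := harnack r0 fh f0 fB zr.
have pz : 0 < modulus (f z) by rewrite modulus_gt0 f0.
have pw : 0 < modulus (f w) by rewrite modulus_gt0 f0.
have B0 : 0 < B := lt_le_trans pz (fB z zr).
have lz : ln (modulus (f z)) <= ln B by rewrite ler_ln ?posrE ?fB.
have lw : ln (modulus (f w)) <= ln B by rewrite ler_ln ?posrE ?fB.
set t := modulus (z - w) / r; have t2 : t <= 1 / 2 by rewrite ler_pdivrMr //; lra.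
move=> h; rewrite -ler_ln ?posrE ?mulr_gt0 ?exprn_gt0 // lnM ?posrE ?exprn_gt0 //.
rewrite !lnXn // -[ln (modulus (f z)) *+ 3]mulr_natr -[ln B *+ 2]mulr_natr.
have q1 : (ln B - ln (modulus (f w))) * (1 / 2) <= (ln B - ln (modulus (f w))) * (1 - t).
  by apply: ler_wpM2l; lra.
have q2 : (ln B - ln (modulus (f z))) * (1 + t) <= (ln B - ln (modulus (f z))) * (3 / 2).
  by apply: ler_wpM2l; lra.
by move: (ln B) (ln (modulus (f z))) (ln (modulus (f w))) h q1 q2 => *; lra.
Qed.

Theorem hurwitz Qs Q : nconv Qs Q ->
  (forall r : R, most (fun m => forall z, disc 0 r z -> Qs m z != 0)) ->
  forall w z, Q w = 0 -> Q z = 0.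
Proof.
move=> [Qb QQ] Q0 w z Qw; apply/eqP/negPn/negP; rewrite -modulus_gt0 => Qz.
pose r := 2 * modulus (z - w) + 1.
have r0 : 0 < r by rewrite ltr_wpDl // mulr_ge0 ?modulus_ge0.
have [B HB] := Qb (modulus w + r).
pose eta := modulus (Q z) / 2; have eta0 : 0 < eta by rewrite divr_gt0.
(* With this [d], the bounds [|Qs m w| < d] and [|Qs m z| > eta] together contradict
   [harnack_cube]. *)
pose d := eta ^+ 3 / (B ^+ 2 + 1).
have B1 : 0 < B ^+ 2 + 1 by rewrite ltr_wpDl ?sqr_ge0.
have d0 : 0 < d by rewrite divr_gt0 // exprn_gt0.
have [m [[h1 h2] [[h3 h4] h5]]] := most_ex (most_and (most_and (QQ z eta eta0) (QQ w d d0))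
  (most_and HB (Q0 (modulus w + r)))).
have sub := @disc_in0 w r.
have := @harnack_cube (Qs m) w z r B r0 (hol_sub sub h3) (fun u ur => h5 u (sub u ur))
  (fun u ur => h4 u (sub u ur)).
rewrite Qw subr0 in h2.
have e1 : eta < modulus (Qs m z).
  by have := modulus_leD (Q z) (Qs m z); rewrite (modulusC (Q z)); rewrite /eta in h1 *; lra.
have e3 : eta ^+ 3 < modulus (Qs m z) ^+ 3 by rewrite ltr_pXn2r ?nnegrE ?modulus_ge0 // ltW.
have e4 : B ^+ 2 * modulus (Qs m w) <= B ^+ 2 * d by rewrite ler_wpM2l ?sqr_ge0 // ltW.
have e5 : B ^+ 2 * d <= eta ^+ 3.
  by rewrite /d mulrCA ler_piMr ?exprn_ge0 ?ltW // ltr_pdivrMr // mul1r ltrDl.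
by rewrite /r => /(_ ltac:(lra)); lra.
Qed.

Lemma entireM f g : entire f -> entire g -> entire (fun z => f z * g z).
Proof. by move=> fe ge z; eexists; apply: cderivM (dcP (fe z)) (dcP (ge z)). Qed.

Lemma entire_dc f : entire f -> entire (dc f).
Proof.
move=> fe z; have := @hol_dc R f z 1 (@entire_hol _ f _ _ fe) z.
by apply; rewrite /disc /= subrr modulus0.
Qed.

Definition exp_type f := entire f /\
  exists A B : R, 0 <= B /\ forall z, modulus (f z) <= expR (A + B * modulus z).

Lemma exp_type_cst c : exp_type (fun=> c).
Proof.
split; first by move=> z; exists 0; exact: cderiv_cst.
exists (modulus c), 0; split => // z; rewrite mul0r addr0.
by apply: le_trans (expR_ge1Dx _); rewrite lerDr.
Qed.

Lemma exp_typeM f g : exp_type f -> exp_type g -> exp_type (fun z => f z * g z).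
Proof.
move=> [fe [A [B [B0 fB]]]] [ge [A' [B' [B'0 gB]]]]; split; first exact: entireM.
exists (A + A'), (B + B'); split => [|z]; first exact: addr_ge0.
rewrite mulrDl addrACA expRD modulusM ler_pM ?modulus_ge0 //.
Qed.

Lemma exp_typeD f g : exp_type f -> exp_type g -> exp_type (fun z => f z + g z).
Proof.
move=> [fe [A [B [B0 fB]]]] [ge [A' [B' [B'0 gB]]]]; split.
  by move=> z; eexists; apply: cderivD (dcP (fe z)) (dcP (ge z)).
exists (Num.max A A' + ln 2), (Num.max B B'); split => [|z].
  by rewrite le_max B0.
have l2 : expR (ln 2) = 2 :> R by rewrite lnK // posrE.
apply: le_trans (modulusD _ _) _.
rewrite [X in expR X]addrAC expRD l2 mulr_natr mulr2n lerD //; [apply: le_trans (fB z) _|apply: le_trans (gB z) _];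
  by rewrite ler_expR lerD ?ler_wpM2r ?modulus_ge0 ?le_max ?lexx ?orbT.
Qed.

Lemma exp_typeX f n : exp_type f -> exp_type (fun z => f z ^+ n).
Proof.
move=> fe; elim: n => [|n IH]; first exact: (exp_type_cst 1).
have -> : (fun z => f z ^+ n.+1) = (fun z => f z * f z ^+ n).
  by apply/funext => z; rewrite exprS.
exact: exp_typeM.
Qed.

Lemma exp_type_prod k (f : 'I_k -> C -> C) : (forall j, exp_type (f j)) ->
  exp_type (fun z => \prod_j f j z).
Proof.
elim: k f => [|k IH] f fe.
  have -> : (fun z => \prod_j f j z) = (fun=> 1) by apply/funext => z; rewrite big_ord0.
  exact: exp_type_cst.
have -> : (fun z => \prod_j f j z) = (fun z => f ord0 z * \prod_(j < k) f (lift ord0 j) z).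
  by apply/funext => z; rewrite big_ord_recl.
by apply: exp_typeM => //; apply: IH.
Qed.

Lemma exp_type_dc f : exp_type f -> exp_type (dc f).
Proof.
move=> [fe [A [B [B0 fB]]]]; split; first exact: entire_dc.
exists (ln 4 + A + B), B; split => // z.
have bh : bounded_hol f z 1 (expR (A + B * (modulus z + 1))).
  split; first exact: entire_hol.
  move=> w; rewrite /disc /= => wz; apply: le_trans (fB w) _.
  rewrite ler_expR lerD2l ler_wpM2l //.
  by have := modulus_leD w z; lra.
apply: le_trans (cauchy_bound ltr01 bh) _.
have l4 : expR (ln 4) = 4 :> R by rewrite lnK // posrE.
have -> : ln 4 + A + B + B * modulus z = ln 4 + (A + B * (modulus z + 1)) by ring.
by rewrite divr1 [X in _ <= X]expRD l4.
Qed.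

Lemma exp_type_iter f t : exp_type f -> exp_type (iter t dc f).
Proof. by move=> fe; elim: t => [//|t IH]; exact: exp_type_dc IH. Qed.

(** On the disc of radius [r] about [z], [ln |f|] exceeds its value at [z] by at most [c + B * r],
    so [log_derivative_bound] gives [|f' / f| <= 2 * (c + B * r) / r], which tends to [2 * B];
    Liouville's theorem makes [f' / f] constant. *)
Theorem exp_type_zero_free f : exp_type f -> (forall z, f z != 0) ->
  exists b, forall z, dc f z = b * f z.
Proof.
move=> [fe [A [B [B0 fB]]]] f0; pose phi z := dc f z / f z.
have phie : entire phi.
  move=> z; eexists; apply: cderivM (dcP (entire_dc fe z)) _.
  exact: cderiv_inv (f0 z) (dcP (fe z)).
have phiB z : modulus (phi z) <= 2 * B.
  apply/ler_addgt0Pr => e e0.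
  pose c := A + B * modulus z - ln (modulus (f z)).
  pose r := (2 * `|c| + 1) / e.
  have r0 : 0 < r by rewrite divr_gt0 // ltr_wpDl // mulr_ge0.
  have := @log_derivative_bound R f z r (expR (A + B * (modulus z + r))) r0
    (@entire_hol _ f _ _ fe) (fun u _ => f0 u).
  rewrite expRK -/(phi z) => /(_ _)/le_trans; apply.
    move=> u; rewrite /disc /= => uz; apply: le_trans (fB u) _.
    rewrite ler_expR lerD2l ler_wpM2l //.
    by have := modulus_leD u z; lra.
  have er : e * r = 2 * `|c| + 1 by rewrite /r mulrC divfK // lt0r_neq0.
  rewrite ler_pdivrMr //.
  have -> : (2 * B + e) * r = 2 * (B * r) + (2 * `|c| + 1) by rewrite -er; ring.
  have -> : A + B * (modulus z + r) - ln (modulus (f z)) = c + B * r by rewrite /c; ring.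
  by have := ler_norm c; lra.
exists (phi 0) => z.
have phic : phi z = phi 0.
  apply: (@hol_const R phi 0 (modulus z + 1)).
  - move=> u _; have := dcP (phie u); by rewrite (liouville_derive u phie phiB).
  - by rewrite /disc /mkset subrr modulus0 ltr_wpDl ?modulus_ge0.
  - by rewrite /disc /mkset subr0 ltrDl.
by rewrite -phic /phi divfK.
Qed.

End Sequences.

(** * The order of a zero of an entire function *)

Section Zeros.
Variable R : realType.
Local Notation C := R[i].
Implicit Types (f g p : C -> C).

Lemma entire_cst (c : C) : entire (fun=> c).
Proof. by move=> z; exists 0; exact: cderiv_cst. Qed.

Lemma entireX f n : entire f -> entire (fun z => f z ^+ n).
Proof. by move=> fe z; eexists; apply: cderivX (dcP (fe z)). Qed.

Lemma dc_fun f (df : C -> C) : (forall z, cderiv f z (df z)) -> dc f = df.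
Proof. by move=> fd; apply/funext => z; exact: cderiv_dc. Qed.

Definition zero_order s f w := exists p, [/\ entire p, p w != 0 &
  f = fun z => (z - w) ^+ s * p z].

Lemma zero_orderM s r f g w : zero_order s f w -> zero_order r g w ->
  zero_order (s + r) (fun z => f z * g z) w.
Proof.
move=> [p [pe p0 ->]] [q [qe q0 ->]]; exists (fun z => p z * q z); split.
- exact: entireM.
- exact: mulf_neq0.
- by apply/funext => z; rewrite exprD mulrACA.
Qed.

Lemma zero_orderX s f w n : zero_order s f w -> zero_order (n * s) (fun z => f z ^+ n) w.
Proof.
move=> fs; elim: n => [|n IH].
  exists (fun=> 1); split; [exact: entire_cst|exact: oner_neq0|].
  by apply/funext => z; rewrite mul0n !expr0 mulr1.
have -> : (fun z => f z ^+ n.+1) = (fun z => f z * f z ^+ n).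
  by apply/funext => z; rewrite exprS.
exact: zero_orderM.
Qed.

Lemma zero_order_prod k (s : 'I_k -> nat) (f : 'I_k -> C -> C) w :
  (forall j, zero_order (s j) (f j) w) ->
  zero_order (\sum_j s j) (fun z => \prod_j f j z) w.
Proof.
elim: k s f => [|k IH] s f fs.
  rewrite big_ord0; exists (fun=> 1); split; [exact: entire_cst|exact: oner_neq0|].
  by apply/funext => z; rewrite big_ord0 expr0 mulr1.
rewrite big_ord_recl.
have -> : (fun z => \prod_j f j z) = (fun z => f ord0 z * \prod_(j < k) f (lift ord0 j) z).
  by apply/funext => z; rewrite big_ord_recl.
by apply: zero_orderM => //; apply: IH.
Qed.

Lemma zero_order_dc s f w : zero_order s.+1 f w -> zero_order s (dc f) w.
Proof.
move=> [p [pe p0 ->]]; exists (fun z => s.+1%:R * p z + (z - w) * dc p z); split.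
- move=> z; eexists; apply: cderivD (cderivZ _ (dcP (pe z))) _.
  exact: cderivM (cderivB (cderiv_id z) (cderiv_cst w z)) (dcP (entire_dc pe z)).
- by rewrite subrr mul0r addr0 mulf_neq0 // pnatr_eq0.
apply: dc_fun => z.
have := cderivM (cderivX s.+1 (cderivB (cderiv_id z) (cderiv_cst w z))) (dcP (pe z)).
rewrite (_ : _ + _ = (z - w) ^+ s * (s.+1%:R * p z + (z - w) * dc p z)) //=.
by rewrite subr0 exprSr; move: (dc p z) (s.+1%:R) => v u; ring.
Qed.

Lemma zero_order_iter s t f w : (t <= s)%N -> zero_order s f w ->
  zero_order (s - t) (iter t dc f) w.
Proof.
elim: t => [|t IH] ts fs; first by rewrite subn0.
by rewrite iterS; apply: zero_order_dc; rewrite subnSK //; apply: IH => //; exact: ltnW.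
Qed.

(** If [f] were divisible by every power of [z - w], the maximum modulus principle for the quotient
    on the circle of radius [r = 2 * |z - w| + 1] would give [|f z| <= B * (|z - w| / r) ^+ k <= B /
    2 ^+ k] for all [k], hence [f z = 0]. *)
Lemma zero_order_ex f w : entire f -> f w = 0 -> (exists z, f z != 0) ->
  exists2 s, (0 < s)%N & zero_order s f w.
Proof.
move=> fe fw [z fz]; pose div k q := entire q /\ f = fun z => (z - w) ^+ k * q z.
have [[s [q [[qe fE] qw]]]|no] := pselect (exists s q, div s q /\ q w != 0).
  case: s fE => [|s] fE; first by move: fw; rewrite fE /= expr0 mul1r => /eqP; rewrite (negPf qw).
  by exists s.+1 => //; exists q.
have all_div k : exists q, div k q.
  elim: k => [|k [q [qe qE]]].
    by exists f; split => //; apply/funext => u; rewrite expr0 mul1r.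
  have qw : q w = 0 by apply/eqP/negPn/negP => qw; apply: no; exists k, q.
  exists (dquot q w); split.
    move=> u; have := @hol_dquot R q u (modulus (w - u) + 1) w (@entire_hol _ _ _ _ qe).
    apply; first by rewrite /disc /mkset ltrDl.
    by rewrite /disc /mkset subrr modulus0 ltr_wpDl ?modulus_ge0.
  by rewrite {1}qE; apply/funext => u; rewrite {1}(dquotE q w) qw add0r exprSr mulrA.
pose r := 2 * modulus (z - w) + 1.
have n0 := modulus_ge0 (z - w).
have r0 : 0 < r by rewrite /r; lra.
have [u _ e e0|p pr pmax] := @closed_disc_max R (fun u => modulus (f u)) w r (ltW r0).
  have [d d0 H] := cderiv_continuous (dcP (fe u)) e0.
  exists d => // v vd; apply: le_lt_trans (modulus_leD _ (f u)) _.
  by rewrite ltrD2l; exact: H.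
set B := modulus (f p) in pmax.
exfalso; move: fz; rewrite -modulus_gt0 => fz.
have [k hk] := exp2_small B fz.
have [q [qe fE]] := all_div k.
have qB : modulus (q z) <= B / r ^+ k.
  have := @maximum_modulus R q w (r + 1) r (B / r ^+ k) z (@entire_hol _ _ _ _ qe); apply.
  - by rewrite r0 /=; lra.
  - move=> u ur; rewrite ler_pdivlMr ?exprn_gt0 //.
    have := pmax u; rewrite ur => /(_ (lexx r)).
    by rewrite {1}fE modulusM modulusX ur mulrC.
  - by rewrite /r; lra.
move: hk; rewrite ltNge => /negP; apply.
rewrite fE modulusM modulusX.
apply: le_trans (ler_wpM2l (exprn_ge0 k n0) qB) _.
rewrite mulrCA ler_wpM2l ?modulus_ge0 // -exprVn -exprVn -exprMn lerXn2r //.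
- by rewrite nnegrE divr_ge0 // ltW.
- by rewrite nnegrE invr_ge0.
by rewrite ler_pdivrMr // mulrC ler_pdivlMr // /r; lra.
Qed.

End Zeros.

(** * The differential monomial and the limit equation *)

Section DifferentialMonomial.
Variables (R : realType) (n k : nat) (n_ t_ : 'I_k -> nat).
Local Notation C := R[i].

Definition diffmon (f : C -> C) z : C :=
  f z ^+ n * \prod_(j < k) iter (t_ j) dc (fun w => f w ^+ n_ j) z.

Lemma nconv_diffmon fs g : nconv fs g -> nconv (fun m => diffmon (fs m)) (diffmon g).
Proof.
move=> fg; apply: nconvM; first exact: nconvX.
by apply: nconv_prod => j; apply: nconv_iter; exact: nconvX.
Qed.

Lemma exp_type_diffmon f : exp_type f -> exp_type (diffmon f).
Proof.
move=> fe; apply: exp_typeM; first exact: exp_typeX.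
by apply: exp_type_prod => j; apply: exp_type_iter; exact: exp_typeX.
Qed.

Hypotheses (hn : forall j, (0 < n_ j)%N)
  (ha : forall j, (t_ j <= n_ j)%N)
  (hb : (2 + \sum_(j < k) t_ j <= n + \sum_(j < k) n_ j)%N).

(** The order is [n * s + sum (n_j * s - t_j)]. Since [t_j <= n_j <= n_j * s] no subtraction is
    truncated, and [s >= 1] gives at least [n + sum n_j - sum t_j >= 2]. *)
Lemma zero_order_diffmon f w s : (0 < s)%N -> zero_order s f w ->
  exists2 S, (2 <= S)%N & zero_order S (diffmon f) w.
Proof.
move=> s0 fs; exists (n * s + \sum_j (n_ j * s - t_ j))%N; last first.
  apply: zero_orderM; first exact: zero_orderX.
  apply: zero_order_prod => j; apply: zero_order_iter; last exact: zero_orderX.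
  by apply: leq_trans (ha j) _; rewrite leq_pmulr.
rewrite -(leq_add2r (\sum_j t_ j)); apply: leq_trans hb _.
rewrite -addnA -big_split /=; apply: leq_add; first by rewrite leq_pmulr.
apply: leq_sum => j _; rewrite subnK ?leq_pmulr //.
by apply: leq_trans (ha j) _; rewrite leq_pmulr.
Qed.

(** If [f' = b f], differentiation multiplies [f ^+ m] by [m * b]; the constant is the product of
    the [(n_j * b) ^+ t_j], nonzero because [n_j > 0] and [b != 0]. *)
Lemma diffmon_exponential f (b : C) : entire f -> (forall z, dc f z = b * f z) ->
  b != 0 -> exists2 c, c != 0 & diffmon f = fun z => c * f z ^+ (n + \sum_j n_ j).
Proof.
move=> fe fb b0.
have dcX m : dc (fun z => f z ^+ m) = fun z => (m%:R * b) * f z ^+ m.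
  apply: dc_fun => z; have := cderivX m (dcP (fe z)); rewrite fb.
  case: m => [|m]; first by rewrite !mul0r.
  by rewrite (_ : _ * (_ * _) = m.+1%:R * b * f z ^+ m.+1) // exprS /=; ring.
have itX m t : iter t dc (fun z => f z ^+ m) = fun z => (m%:R * b) ^+ t * f z ^+ m.
  elim: t => [|t IH]; first by apply/funext => z; rewrite expr0 mul1r.
  rewrite iterS IH; apply: dc_fun => z; rewrite exprSr -mulrA.
  apply: cderivZ; rewrite -[_ * _](congr1 (fun h => h z) (dcX m)).
  by apply: dcP; exact: entireX.
exists (\prod_j ((n_ j)%:R * b) ^+ t_ j).
  by apply/prodf_neq0 => j _; rewrite expf_neq0 // mulf_neq0 // pnatr_eq0 -lt0n.
apply/funext => z; rewrite /diffmon.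
rewrite (eq_bigr _ (fun j _ => congr1 (fun h => h z) (itX (n_ j) (t_ j)))).
rewrite big_split /= exprD mulrCA; congr (_ * (_ * _)).
by rewrite -expr_sum.
Qed.

Theorem no_exp_type_solution (a : C) f : a != 0 -> exp_type f -> dc f 0 != 0 ->
  (forall z, diffmon f z - a != 0) \/ (forall z, diffmon f z - a = 0) -> False.
Proof.
move=> a0 fe df0 Q0; have [fent _] := fe.
pose Q z := diffmon f z - a.
have Qe : exp_type Q.
  by apply: exp_typeD; [exact: exp_type_diffmon|exact: exp_type_cst].
have Pent : entire (diffmon f) by case: (exp_type_diffmon fe).
have dQ z : dc Q z = dc (diffmon f) z.
  by apply: cderiv_dc; have := cderivB (dcP (Pent z)) (cderiv_cst a z); rewrite subr0.
have [b Qb] : exists b, forall z, dc Q z = b * Q z.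
  case: Q0 => [Q0|Q0]; first exact: exp_type_zero_free.
  exists 0 => z; rewrite mul0r.
  have -> : Q = fun=> 0 by apply/funext => u; exact: Q0.
  exact/cderiv_dc/cderiv_cst.
have fnz : exists z, f z != 0.
  apply: contrapT => f0; move/eqP: df0; apply.
  have -> : f = fun=> 0 by apply/funext => u; apply: contrapT => /eqP fu; apply: f0; exists u.
  exact/cderiv_dc/cderiv_cst.
have [[w fw]|fz] := pselect (exists w, f w = 0).
  have [s s0 fs] := zero_order_ex fent fw fnz.
  have [S S2 [p [pe pw PE]]] := zero_order_diffmon s0 fs.
  have Pw : diffmon f w = 0.
    by rewrite PE subrr expr0n -[S == 0%N]negbK -lt0n (ltnW S2) mul0r.
  have dPw : dc (diffmon f) w = 0.
    have zo : zero_order S (diffmon f) w by exists p.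
    case: S S2 zo {PE} => // S S2 /zero_order_dc[q [_ _ ->]].
    by rewrite subrr expr0n -[S == 0%N]negbK -lt0n -ltnS S2 mul0r.
  have bE : b = 0.
    have := Qb w; rewrite dQ dPw /Q Pw sub0r mulrN => /esym/eqP.
    by rewrite oppr_eq0 mulf_eq0 (negPf a0) orbF => /eqP.
  have Pz z : diffmon f z = 0.
    rewrite -Pw; apply: (@hol_const R (diffmon f) w (modulus (z - w) + 1)).
    - by move=> u _; have := dcP (Pent u); rewrite -dQ Qb bE mul0r.
    - by rewrite /disc /mkset subrr modulus0 ltr_wpDl ?modulus_ge0.
    - by rewrite /disc /mkset ltrDl.
  (* Near [w] the factor [p] has no zero, so [diffmon f] can vanish there only at [w] itself. *)
  have [d d0 pn] := cderiv_neq0_near (dcP (pe w)) pw.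
  pose h : C := (d / 2)%:C.
  have hm : modulus h = d / 2 by rewrite modulus_real gtr0_norm // divr_gt0.
  have h0 : h != 0 by rewrite -modulus_gt0 hm divr_gt0.
  have := Pz (w + h); rewrite PE [w + h - w]addrC addKr => /eqP.
  rewrite mulf_eq0 expf_eq0 (negPf h0) andbF /=; apply/negP; apply: pn.
  by rewrite addrC addKr hm; lra.
have f0 z : f z != 0 by apply/negP => /eqP fz0; apply: fz; exists z.
have [be fbe] := exp_type_zero_free fe f0.
have be0 : be != 0 by apply: contraNneq df0 => be0; rewrite fbe be0 mul0r.
have [c c0 PE] := diffmon_exponential fent fbe be0.
set N := (n + \sum_j n_ j)%N in PE.
have N0 : (0 < N)%N by apply: leq_trans hb.
have dPE z : dc (diffmon f) z = N%:R * be * (c * f z ^+ N).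
  rewrite PE; apply: cderiv_dc; have := cderivZ c (cderivX N (dcP (fent z))).
  rewrite fbe (_ : _ * (_ * _) = N%:R * be * (c * f z ^+ N)) //.
  by case: (N) N0 => // m _; rewrite exprS /=; ring.
have key z : (N%:R * be - b) * (c * f z ^+ N) = - (b * a).
  have := Qb z; rewrite dQ dPE /Q {1}PE => E.
  by rewrite mulrBl E; ring.
have Nbe : N%:R * be != 0 by rewrite mulf_neq0 // pnatr_eq0 -lt0n.
have cf z : c * f z ^+ N != 0 by rewrite mulf_neq0 // expf_neq0.
have Nb : N%:R * be - b = 0.
  have : dc (fun z => (N%:R * be - b) * (c * f z ^+ N)) 0 = 0.
    have -> : (fun z => (N%:R * be - b) * (c * f z ^+ N)) = fun=> - (b * a).
      by apply/funext => z; exact: key.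
    exact/cderiv_dc/cderiv_cst.
  rewrite (_ : dc _ 0 = (N%:R * be - b) * (N%:R * be * (c * f 0 ^+ N))); last first.
    apply: cderiv_dc; apply: cderivZ; rewrite -dPE PE; apply: dcP.
    by rewrite -PE; exact: Pent.
  by move/eqP; rewrite mulf_eq0 mulf_eq0 (negPf Nbe) (negPf (cf 0)) !orbF => /eqP.
have := key 0; rewrite Nb mul0r => /esym/eqP.
rewrite oppr_eq0 mulf_eq0 (negPf a0) orbF => /eqP b0.
by move: Nb; rewrite b0 subr0 => /eqP; rewrite (negPf Nbe).
Qed.

End DifferentialMonomial.

(** * Invariance of the monomial under rescaling *)

Section Rescaling.
Variables (R : realType) (n k : nat) (n_ t_ : 'I_k -> nat).
Local Notation C := R[i].
Local Notation diffmon := (@diffmon R n k n_ t_).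
Let N := (n + \sum_j n_ j)%N.
Let T := (\sum_j t_ j)%N.

Lemma cderiv_scale (h : C -> C) b c z1 u l : cderiv h (z1 + c * u) l ->
  cderiv (fun v => b * h (z1 + c * v)) u (b * (l * c)).
Proof.
by move=> hl; apply: cderivZ; apply: (cderiv_comp (cderiv_affine z1 c u)).
Qed.

Lemma iter_dc_hol (h : C -> C) z0 r t : hol h z0 r -> hol (iter t dc h) z0 r.
Proof. by move=> hh; elim: t => [//|t IH]; exact: hol_dc. Qed.

Lemma disc_center_near (z0 : C) (r : R) u : disc z0 r u ->
  exists2 d : R, 0 < d & forall v, disc u d v -> disc z0 r v.
Proof.
move=> ur; exists (r - modulus (u - z0)); first by rewrite subr_gt0.
by apply: disc_sub; rewrite addrC subrK.
Qed.

Lemma iter_dc_scale (h : C -> C) b c z1 z0 (r rho : R) t u : hol h z0 r ->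
  (forall v, disc 0 rho v -> disc z0 r (z1 + c * v)) -> disc 0 rho u ->
  iter t dc (fun v => b * h (z1 + c * v)) u = b * c ^+ t * iter t dc h (z1 + c * u).
Proof.
move=> hh sub; elim: t u => [|t IH] u ur; first by rewrite expr0 mulr1.
have [d d0 dsub] := disc_center_near ur.
rewrite iterS; apply: cderiv_dc.
have := cderiv_scale (b * c ^+ t) (hol_cderiv (iter_dc_hol t hh) (sub u ur)).
rewrite (_ : b * c ^+ t * (_ * c) = b * c ^+ t.+1 * iter t.+1 dc h (z1 + c * u)).
  by apply: cderiv_near d0 _ => v /dsub /IH.
by rewrite iterS exprSr; move: (dc _ _) => v; ring.
Qed.

Lemma diffmon_scale (f : C -> C) (s : C) z1 z0 (r rho : R) u : s != 0 -> hol f z0 r ->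
  (forall v, disc 0 rho v -> disc z0 r (z1 + s ^+ N * v)) -> disc 0 rho u ->
  diffmon (fun v => s ^- T * f (z1 + s ^+ N * v)) u = diffmon f (z1 + s ^+ N * u).
Proof.
move=> s0 fh sub ur; rewrite /diffmon.
have E j : iter (t_ j) dc (fun v => (s ^- T * f (z1 + s ^+ N * v)) ^+ n_ j) u =
   (s ^- T) ^+ n_ j * (s ^+ N) ^+ t_ j * iter (t_ j) dc (fun v => f v ^+ n_ j) (z1 + s ^+ N * u).
  rewrite -(@iter_dc_scale (fun v => f v ^+ n_ j) _ _ _ z0 r rho) //.
    by congr (iter _ _ _ u); apply/funext => v; rewrite exprMn.
  by move=> v vr; eexists; apply: cderivX (hol_cderiv fh vr).
rewrite (eq_bigr _ (fun j _ => E j)) !big_split /= exprMn -!expr_sum.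
(* [s ^- T] enters once for each of the [N] factors [f], and [s ^+ N] once for each of the [T]
   derivatives. *)
have key : (s ^- T) ^+ N * (s ^+ N) ^+ T = 1.
  by rewrite exprVn -!exprM [(N * T)%N]mulnC mulVf // expf_neq0.
rewrite /N exprD -/N in key.
move: key; set x := (s ^- T) ^+ n; set y := (s ^- T) ^+ _; set d := (s ^+ N) ^+ _.
set P := \prod_(_ < _) _; set F := f _ ^+ n => key.
by rewrite -[RHS]mul1r -key; ring.
Qed.

End Rescaling.

(** * Zalcman's lemma relative to a level set *)

Section Zalcman.
Variables (R : realType) (n k : nat) (n_ t_ : 'I_k -> nat).
Local Notation C := R[i].
Local Notation diffmon := (@diffmon R n k n_ t_).
Hypotheses (hn : forall j, (0 < n_ j)%N) (ha : forall j, (t_ j <= n_ j)%N)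
  (hb : (2 + \sum_(j < k) t_ j <= n + \sum_(j < k) n_ j)%N).
Variable a : C.
Hypothesis a0 : a != 0.
Let N := (n + \sum_j n_ j)%N.
Let T := (\sum_j t_ j)%N.
Let T_lt_N : (T < N)%N. Proof. exact: ltnW hb. Qed.
Let T_le_N : (T <= N)%N. Proof. exact: ltnW. Qed.
Let NT_gt0 : (0 < N - T)%N. Proof. by rewrite subn_gt0. Qed.
Definition omitting z0 r f := hol f z0 r /\ forall z, disc z0 r z -> diffmon f z - a != 0.

(** In [rescaled_ex] the nearly extremal [s] is tested against [s / 4]: the conditions
    [|f| <= (s / 4) ^+ T] and [|f'| * (s / 4) ^+ (N - T) >= 1] become [|g| <= c] and [|g'| >= M1]
    for the rescaled function. *)
Let c : R := 4 ^- T.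
Let M1 : R := 4 ^+ (N - T).
Definition rescaled r g := [/\ omitting 0 r g, modulus (g 0) <= 1, 1 <= modulus (dc g 0) &
  forall z, disc 0 r z -> modulus (g z) <= c -> modulus (dc g z) <= M1].

Let c0 : 0 < c. Proof. by rewrite invr_gt0 exprn_gt0. Qed.
Let c1 : c <= 1. Proof. by rewrite invf_le1 ?exprn_gt0 // exprn_ege1 // ler1n. Qed.
(** Let [F = g / c]. If [|F| > 1] held on the disc of radius [rho], [superlevel_log_derivative]
    would give [|F' 0| <= c^-1 * (2 * ln c^-1) / rho < c^-1], against [|g' 0| >= 1]. *)
Let rho := 2 * ln c^-1 + 1.
Let M2 := M1 / c.
Let M20 : 0 <= M2. Proof. by rewrite divr_ge0 ?exprn_ge0 // ltW. Qed.
Let rho0 : 0 < rho.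
Proof. by rewrite ltr_wpDl // mulr_ge0 // ln_ge0 // invf_ge1. Qed.

(** Dividing by [c] moves the level [c] to 1, with derivative bound [M2]. Some point [p] of the disc
    of radius [rho] has [|F p| <= 1], and [level_growth] compares [z] with it, as
    [|p - z| <= rho + |z|]. *)
Lemma rescaled_growth r g z : rescaled r g -> 2 * modulus z + rho + 1 <= r ->
  modulus (g z) <= expR (2 * M2 * rho + 2 * M2 * modulus z).
Proof.
move=> [[gh _] g0 dg0 gM] zr; have nz := modulus_ge0 z.
have ci : 0 < c^-1 by rewrite invr_gt0.
have rho_gt0 : 0 < rho := rho0.
pose F u := (c^-1)%:C * g u.
have Fm u : modulus (F u) = c^-1 * modulus (g u).
  by rewrite modulusM modulus_real gtr0_norm.
have Fd u : disc 0 r u -> cderiv F u ((c^-1)%:C * dc g u).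
  by move=> ur; apply: cderivZ; exact: hol_cderiv gh ur.
have Fh : hol F 0 r by move=> u ur; eexists; exact: Fd.
have FM u : disc 0 r u -> modulus (F u) <= 1 -> modulus (dc F u) <= M2.
  move=> ur; rewrite Fm mulrC ler_pdivrMr // mul1r => gu.
  rewrite (cderiv_dc (Fd u ur)) modulusM modulus_real gtr0_norm //.
  by rewrite /M2 mulrC ler_pM2r ?invr_gt0 //; exact: gM.
have r0' : disc 0 r (0 : C) by rewrite /disc /mkset subrr modulus0; lra.
have [p pr Fp] : exists2 p, modulus p < rho & modulus (F p) <= 1.
  apply: contrapT => no.
  have Fg u : disc 0 rho u -> 1 < modulus (F u).
    rewrite /disc /mkset subr0 => ur; rewrite ltNge; apply/negP => Fu.
    by apply: no; exists u.
  have F1 : 1 < modulus (F 0) by apply: Fg; rewrite /disc /mkset subrr modulus0.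
  have rr : rho <= r by lra.
  have := superlevel_log_derivative Fh F1 rho0 rr Fg.
  rewrite (cderiv_dc (Fd 0 r0')) modulusM modulus_real gtr0_norm //.
  rewrite leNgt => /negP; apply.
  apply: (@lt_le_trans _ _ c^-1); last by rewrite ler_peMr // ltW.
  have Fc : modulus (F 0) <= c^-1 by rewrite Fm ler_piMr // ltW.
  apply: (@le_lt_trans _ _ (c^-1 * (2 * ln c^-1 / rho))).
    apply: ler_pM => //; first exact: modulus_ge0.
      by rewrite divr_ge0 ?mulr_ge0 ?ln_ge0 ?ltW.
    by rewrite ler_wpM2r ?invr_ge0 ?(ltW rho0) // ler_wpM2l // ler_ln ?posrE //; lra.
  by rewrite gtr_pMr // ltr_pdivrMr // mul1r /rho ltrDl.
have bound : modulus (F z) <= expR (2 * M2 * rho + 2 * M2 * modulus z).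
  have E0 : 0 <= 2 * M2 * rho + 2 * M2 * modulus z.
    have E2 : 0 <= 2 * M2 by rewrite mulr_ge0.
    by apply: addr_ge0; apply: mulr_ge0 => //; exact: ltW.
  have [Fz|Fz] := leP (modulus (F z)) 1.
    apply: le_trans Fz _; apply: le_trans (expR_ge1Dx _); by rewrite lerDl.
  have Fp0 : 0 < modulus (F z) := lt_trans ltr01 Fz.
  rewrite -[X in X <= _]lnK ?posrE // ler_expR.
  have sub : disc z (modulus z + rho + 1) `<=` disc 0 r by apply: disc_sub; rewrite subr0; lra.
  have pz : modulus (p - z) <= rho + modulus z by have := modulusB p z; lra.
  have := @level_growth R F z (modulus z + rho + 1) M2 (hol_sub sub Fh) Fz
     (fun u ur => FM u (sub u ur)) p _ Fp.
  have pd : disc z (modulus z + rho + 1) p by rewrite /disc /=; lra.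
  move=> /(_ pd) /le_trans; apply.
  by rewrite -mulrDr ler_wpM2l // mulr_ge0.
apply: le_trans bound; rewrite Fm ler_peMl ?modulus_ge0 // invf_ge1 //.
Qed.

(** The growth bound does not depend on [m]: it yields a limit [G] at every point and makes it of
    exponential type. [1 <= |g' 0|] keeps [G' 0] from vanishing, and Hurwitz's theorem leaves the
    two alternatives for [diffmon G - a]. *)
Lemma no_rescaled_sequence (gs : nat -> C -> C) : (forall m, rescaled m.+1%:R (gs m)) -> False.
Proof.
move=> gsP.
have large (r : R) : most (fun m => r <= m.+1%:R).
  have b0 : `|r| < (Num.bound `|r|)%:R by apply: archi_boundP.
  apply: most_sub (most_geq (Num.bound `|r|)) => m bm.
  apply: le_trans (ler_norm r) _; apply: le_trans (ltW b0) _.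
  by rewrite ler_nat (leq_trans bm).
have gb z : most (fun m => modulus (gs m z) <= expR (2 * M2 * rho + 2 * M2 * modulus z)).
  by apply: most_sub (large (2 * modulus z + rho + 1)) => m; exact: rescaled_growth (gsP m).
have lim_ex z : exists l, tends (fun m => gs m z) l by exact: most_lim (gb z).
have [G GP] := choice lim_ex.
have conv : nconv gs G.
  split => // r; exists (expR (2 * M2 * rho + 2 * M2 * r)).
  apply: most_sub2 (large r) (large (2 * r + rho + 1)) => m m1 m2.
  have [[gh _] _ _ _] := gsP m; split.
    by apply: hol_sub gh; apply: disc_sub; rewrite subrr modulus0 add0r.
  move=> z; rewrite /disc /mkset subr0 => zr.
  apply: le_trans (rescaled_growth (gsP m) _) _; first lra.
  by rewrite ler_expR lerD2l; apply: ler_wpM2l; [exact: mulr_ge0|exact: ltW].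
have Gexp : exp_type G.
  split; first exact: nconv_entire conv.
  exists (2 * M2 * rho), (2 * M2); split => [|z]; first exact: mulr_ge0.
  have := tends_le (w := 0) (GP z); rewrite subr0; apply.
  by apply: most_sub (gb z) => m; rewrite subr0.
have dG0 : dc G 0 != 0.
  apply/eqP => dG.
  have [l [/cderiv_dc <-]] := nconv_cderiv 0 conv; rewrite dG => /(_ 1 ltr01) h.
  have [m] := most_ex h; rewrite subr0 => h1; have [_ _ h2 _] := gsP m.
  by move: h1; rewrite ltNge h2.
have Qconv : nconv (fun m z => diffmon (gs m) z + - a) (fun z => diffmon G z + - a).
  by apply: nconvD; [exact: nconv_diffmon|exact: nconv_cst].
have Q0 (r : R) : most (fun m => forall z, disc 0 r z -> diffmon (gs m) z + - a != 0).
  apply: most_sub (large r) => m mr z zr; have [[_ om] _ _ _] := gsP m.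
  by apply: om; apply: disc_sub zr; rewrite subrr modulus0 add0r.
apply: (no_exp_type_solution hn ha hb a0 Gexp dG0).
have [[w Qw]|no] := pselect (exists w, diffmon G w - a = 0).
  by right => z; exact: (hurwitz Qconv Q0 z Qw).
by left => z; apply/eqP => Qz; apply: no; exists z.
Qed.

(* Zalcman's rescaling, at a point where [s = mu * (r1 - |z - z0|)] satisfies
   [|f| <= s ^ T] and [|f'| >= s ^ -(N - T)] with mu minimal up to a factor 2. *)
Lemma rescaled_ex z0 (r0 r : R) : 0 < r0 -> 0 < r ->
  (forall d M : R, 0 < d -> d <= 1 -> 0 < M -> exists f q, [/\ omitting z0 r0 f,
     disc z0 (3 / 4 * r0) q, modulus (f q) <= d & M < modulus (dc f q)]) ->
  exists g, rescaled r g.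
Proof.
move=> r00 r_0 H.
(* [mu0 * r0 <= 1] keeps every [s] at most 1; [mu0 * (2 * r) <= 1] keeps the image of the disc of
   radius [r] where [dist] is at least half of [dist z1]. *)
have [mu0 [mu00 mur0 mur]] : exists mu0 : R, [/\ 0 < mu0, mu0 * r0 <= 1 & mu0 * (2 * r) <= 1].
  exists (Num.min r0^-1 (2 * r)^-1); split.
  - by rewrite lt_min !invr_gt0 r00 mulr_gt0.
  - by rewrite -ler_pdivlMr // div1r ge_min lexx.
  - by rewrite -ler_pdivlMr ?mulr_gt0 // div1r ge_min lexx orbT.
pose s0 := mu0 * (r0 / 8).
have s00 : 0 < s0 by rewrite mulr_gt0 // divr_gt0.
have s01 : s0 <= 1 by rewrite /s0; lra.
have [||| f [q [fo qr fq dfq]]] := H (s0 ^+ T) (s0 ^- (N - T)).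
- exact: exprn_gt0.
- exact: exprn_ile1 (ltW s00) s01.
- by rewrite invr_gt0 exprn_gt0.
have [fh fa] := fo.
(* A radius between [3 / 4 * r0] and [r0]: [dist q >= r0 / 8] at the given point [q], and [f'] is
   bounded where [dist > 0]. *)
pose r1 := 7 / 8 * r0.
have r10 : 0 < r1 by rewrite mulr_gt0.
pose dist z := r1 - modulus (z - z0).
pose E mu := exists z, [/\ 0 < dist z, modulus (f z) <= (mu * dist z) ^+ T &
  1 <= modulus (dc f z) * (mu * dist z) ^+ (N - T)].
have E0 : E mu0.
  have dq : r0 / 8 <= dist q by move: qr; rewrite /disc /= /dist /r1; lra.
  have sq : s0 <= mu0 * dist q by rewrite ler_wpM2l // ltW.
  exists q; split; first lra.
    by apply: le_trans fq _; rewrite lerXn2r ?nnegrE ?(ltW s00) // (le_trans (ltW s00)).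
  apply: (@le_trans _ _ (modulus (dc f q) * s0 ^+ (N - T))).
    by rewrite -ler_pdivrMr ?exprn_gt0 // div1r ltW.
  by rewrite ler_wpM2l ?modulus_ge0 // lerXn2r ?nnegrE ?(ltW s00) // (le_trans (ltW s00)).
have [K K0 KP] : exists2 K : R, 0 < K & forall z, 0 < dist z -> modulus (dc f z) <= K.
  have [|z zr1 x x0|p pr pmax] := @closed_disc_max R (fun z => modulus (dc f z)) z0 r1.
  - exact: ltW.
  - have zr : disc z0 r0 z by rewrite /disc /=; move: zr1; rewrite /r1; lra.
    have [d d0 Hd] := cderiv_continuous (hol_cderiv (hol_dc fh) zr) x0.
    exists d => // w wd; apply: le_lt_trans (modulus_leD _ (dc f z)) _.
    by rewrite ltrD2l; exact: Hd.
  exists (modulus (dc f p) + 1); first by rewrite ltr_wpDl ?modulus_ge0.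
  move=> z; rewrite /dist => zr; have := pmax z; lra.
pose S := [set mu | [/\ 0 < mu, mu <= mu0 & E mu]].
(* The infimum of the admissible [mu] is positive, as [1 <= |f'| * s ^+ (N - T) <= K * s] with
   [s = mu * dist z]; this is where [T < N] enters. *)
have Slb mu : S mu -> ((K + 1) * r1)^-1 <= mu.
  move=> [mu_0 mu_1 [z [dz fz dfz]]].
  have K1 : 0 < (K + 1) * r1 by rewrite mulr_gt0 // ltr_wpDl // ltW.
  rewrite -[_^-1]mul1r ler_pdivrMr //.
  have dr : dist z <= r1 by rewrite /dist; have := modulus_ge0 (z - z0); lra.
  have s_0 : 0 < mu * dist z by rewrite mulr_gt0.
  have s_1 : mu * dist z <= 1.
    apply: le_trans mur0; apply: ler_pM; rewrite ?(ltW mu_0) ?(ltW dz) //.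
    by apply: le_trans dr _; rewrite /r1; lra.
  have sN : (mu * dist z) ^+ (N - T) <= mu * dist z.
    by rewrite -[X in _ <= X]expr1 ler_wiXn2l // ltW.
  apply: le_trans dfz _; apply: (@le_trans _ _ (K * (mu * dist z))).
    by apply: ler_pM; rewrite ?modulus_ge0 ?exprn_ge0 ?(ltW s_0) ?KP.
  rewrite [X in _ <= X](_ : _ = (K + 1) * (mu * r1)); last by ring.
  apply: ler_pM; rewrite ?(ltW K0) ?(ltW s_0) //; first by rewrite lerDl.
  by rewrite ler_wpM2l // ltW.
have Sinf : has_inf S.
  by split; [exists mu0|exists ((K + 1) * r1)^-1].
have inf0 : 0 < inf S.
  apply: (@lt_le_trans _ _ ((K + 1) * r1)^-1).
    by rewrite invr_gt0 mulr_gt0 // ltr_wpDl // ltW.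
  by apply: lb_le_inf => //; case: Sinf.
(* Being positive, the infimum is less than twice itself, so some admissible [mu] is below
   [2 * inf S], and nothing up to [mu / 2] is admissible. *)
have [mu [mu_0 mu_1 [z1 [dz fz dfz]]] mulow] := inf_adherent inf0 Sinf.
have minE mu' : 0 < mu' -> mu' <= mu / 2 -> ~ E mu'.
  move=> mu'0 mu'1 Emu'.
  suff : inf S <= mu' by lra.
  by apply: ge_inf; [case: Sinf|split => //; lra].
set s := mu * dist z1 in fz dfz.
have s_0 : 0 < s by rewrite mulr_gt0.
have s_1 : s <= 1.
  apply: le_trans mur0; apply: ler_pM; rewrite ?(ltW mu_0) ?(ltW dz) //.
  by rewrite /dist /r1; have := modulus_ge0 (z1 - z0); lra.
have sN : s ^+ N <= s.
  by rewrite -[X in _ <= X]expr1 ler_wiXn2l ?(ltW s_0) // (leq_trans _ T_lt_N).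
have inside v : disc 0 r v -> dist z1 / 2 <= dist (z1 + (s%:C) ^+ N * v).
  rewrite /disc /mkset subr0 => vr.
  have h : modulus ((s%:C) ^+ N * v) <= dist z1 / 2.
    rewrite modulusM modulusX modulus_real gtr0_norm //.
    apply: (@le_trans _ _ (s * r)).
      by apply: ler_pM; rewrite ?exprn_ge0 ?modulus_ge0 // ltW.
    have : mu * (2 * r) <= 1.
      by apply: le_trans mur; rewrite ler_wpM2r // mulr_ge0 // ltW.
    rewrite /s => h; rewrite ler_pdivlMr // -[X in _ <= X]mul1r.
    have -> : mu * dist z1 * r * 2 = mu * (2 * r) * dist z1 by ring.
    by rewrite ler_wpM2r // ltW.
  have := modulus_trans z1 (z1 + (s%:C) ^+ N * v) z0.
  by rewrite [z1 + _ - z1]addrC addKr /dist in h *; lra.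
have in0 v : disc 0 r v -> disc z0 r0 (z1 + (s%:C) ^+ N * v).
  by move=> /inside; rewrite /disc /= /dist in dz *; rewrite /r1 in dz *; lra.
have sC0 : s%:C != 0 :> C by rewrite -modulus_gt0 modulus_real gtr0_norm.
pose g v := (s%:C) ^- T * f (z1 + (s%:C) ^+ N * v).
have gm v : modulus (g v) = s ^- T * modulus (f (z1 + (s%:C) ^+ N * v)).
  by rewrite modulusM modulusV modulusX modulus_real gtr0_norm.
have gd v : disc 0 r v -> cderiv g v ((s%:C) ^- T * (dc f (z1 + (s%:C) ^+ N * v) * (s%:C) ^+ N)).
  by move=> vr; apply: cderiv_scale; exact: hol_cderiv fh (in0 v vr).
have dgm v : disc 0 r v -> modulus (dc g v) =
    modulus (dc f (z1 + (s%:C) ^+ N * v)) * s ^+ (N - T).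
  move=> vr; rewrite (cderiv_dc (gd v vr)) !modulusM modulusV !modulusX modulus_real gtr0_norm //.
  rewrite mulrCA expfB_cond; last by rewrite (gt_eqF s_0) add0n.
  by rewrite [_ ^- _ * _]mulrC.
have zr : disc 0 r (0 : C) by rewrite /disc /mkset subrr modulus0.
exists g; split.
- split; first by move=> v vr; eexists; exact: gd.
  by move=> v vr; rewrite (@diffmon_scale R n k n_ t_ f s%:C z1 z0 r0 r v sC0 fh in0 vr); apply: fa; exact: in0.
- by rewrite gm mulr0 addr0 mulrC ler_pdivrMr ?exprn_gt0 // mul1r.
- by rewrite dgm // mulr0 addr0.
move=> v vr; rewrite gm dgm //; set z := z1 + _ * v => gz.
have dz' := inside v vr; rewrite -/z in dz'.
have dz0 : 0 < dist z by lra.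
rewrite leNgt; apply/negP => dfz'.
(* A violation at [z] would make this value admissible; it is at most [mu / 2] because
   [dist z1 <= 2 * dist z]. *)
apply: (minE (s / (4 * dist z))); first by rewrite divr_gt0 // mulr_gt0.
  rewrite ler_pdivrMr ?mulr_gt0 // /s.
  have : mu * dist z1 <= mu * (2 * dist z) by rewrite ler_wpM2l; lra.
  lra.
have sE : s / (4 * dist z) * dist z = s / 4 by field; exact: lt0r_neq0.
exists z; split => //; rewrite sE.
  rewrite expr_div_n -/c [X in _ <= X]mulrC.
  by move: gz; rewrite [X in X <= c]mulrC ler_pdivrMr ?exprn_gt0.
rewrite expr_div_n mulrA ler_pdivlMr ?exprn_gt0 // mul1r ltW //.
Qed.

(** A failure on [|f| <= 1] has to be moved to [|f| <= d] for every [d] in []0, 1]], as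
    [rescaled_ex] asks. If instead [|f'| <= M] wherever [|f| <= d], then [level_derivative] for
    [f / d] bounds [f'] on [|f| <= 1] as well. *)
Theorem level_derivative_bound z0 (r0 : R) : 0 < r0 -> exists M : R,
  forall f, omitting z0 r0 f -> forall z, disc z0 (r0 / 2) z -> modulus (f z) <= 1 ->
    modulus (dc f z) <= M.
Proof.
move=> r00; apply: contrapT => no.
have bad (M : R) : exists f p, [/\ omitting z0 r0 f, disc z0 (r0 / 2) p, modulus (f p) <= 1 &
    M < modulus (dc f p)].
  apply: contrapT => no2; apply: no; exists M => f fo z zr fz.
  by rewrite leNgt; apply/negP => h; apply: no2; exists f, z.
have small (d M : R) : 0 < d -> d <= 1 -> 0 < M -> exists f q, [/\ omitting z0 r0 f,
     disc z0 (3 / 4 * r0) q, modulus (f q) <= d & M < modulus (dc f q)].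
  move=> d0 d1 M0; apply: contrapT => no2.
  have [f [p [fo pr fp dfp]]] := bad (Num.max M (Num.max (4 * (M / d)) (2 * ln d^-1 / (r0 / 4)))).
  have fM q : disc z0 (3 / 4 * r0) q -> modulus (f q) <= d -> modulus (dc f q) <= M.
    by move=> qr fq; rewrite leNgt; apply/negP => h; apply: no2; exists f, q.
  move: dfp; rewrite !gt_max => /andP[dfM /andP[df1 df2]].
  have sub : disc p (r0 / 4) `<=` disc z0 (3 / 4 * r0).
    by apply: disc_sub; move: pr; rewrite /disc /=; lra.
  have sub0 : disc z0 (3 / 4 * r0) `<=` disc z0 r0.
    by apply: disc_sub; rewrite subrr modulus0; lra.
  have r4 : 0 < r0 / 4 by rewrite divr_gt0.
  have pp : disc p (r0 / 4) p by rewrite /disc /= subrr modulus0.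
  have [fh _] := fo.
  have [fpd|fpd] := leP (modulus (f p)) d.
    by have := fM p (sub _ pp) fpd; lra.
  pose F u := (d^-1)%:C * f u.
  have di : 0 < d^-1 by rewrite invr_gt0.
  have Fm u : modulus (F u) = d^-1 * modulus (f u).
    by rewrite modulusM modulus_real gtr0_norm.
  have Fd u : disc p (r0 / 4) u -> cderiv F u ((d^-1)%:C * dc f u).
    by move=> /sub/sub0 ur; apply: cderivZ; exact: hol_cderiv fh ur.
  have Fh : hol F p (r0 / 4) by move=> u ur; eexists; exact: Fd.
  have F1 : 1 < modulus (F p) by rewrite Fm mulrC ltr_pdivlMr // mul1r.
  have FM u : disc p (r0 / 4) u -> modulus (F u) <= 1 -> modulus (dc F u) <= M / d.
    move=> ur; rewrite Fm mulrC ler_pdivrMr // mul1r => fu.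
    rewrite (cderiv_dc (Fd u ur)) modulusM modulus_real gtr0_norm // mulrC ler_pM2r //.
    exact: fM (sub u ur) fu.
  have h := level_derivative Fh F1 FM r4.
  rewrite (cderiv_dc (Fd p pp)) modulusM modulus_real gtr0_norm // Fm -(mulrA d^-1) ler_pM2l // in h.
  move: h; rewrite leNgt => /negP; apply.
  apply: (@le_lt_trans _ _ (Num.max (4 * (M / d)) (2 * ln d^-1 / (r0 / 4)))); last first.
    by rewrite gt_max df1.
  have mx : 0 <= Num.max (4 * (M / d)) (2 * ln (d^-1 * modulus (f p)) / (r0 / 4)).
    by rewrite le_max mulr_ge0 // divr_ge0 // ltW.
  apply: (@le_trans _ _ (Num.max (4 * (M / d)) (2 * ln (d^-1 * modulus (f p)) / (r0 / 4)))).
    by rewrite ler_piMl.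
  rewrite ge_max !le_max lexx /=; apply/orP; right.
  rewrite ler_wpM2r ?invr_ge0 ?(ltW r4) // ler_wpM2l // ler_ln ?posrE //.
    by rewrite ler_piMr // ltW.
  by rewrite mulr_gt0 // (lt_trans d0).
have [gs gsP] := choice (fun m : nat => rescaled_ex r00 (ltr0Sn R m) small).
exact: no_rescaled_sequence gsP.
Qed.

End Zalcman.

(** * Spherical distance and extraction of a subsequence *)

Section Sphere.
Variable R : realType.
Local Notation C := R[i].

Lemma spherical_dist_small (e : R) : 0 < e -> exists2 d : R, 0 < d &
  forall p q : sphere R, 0 <= half_chord p q < d -> spherical_dist p q < e.
Proof.
move=> e0; have e2 : 0 < e / 2 by rewrite divr_gt0.
have asin0 : asin 0 = 0 :> R.
  by rewrite -[X in asin X]sin0 sinK // in_itv /= oppr_le0 divr_ge0 ?pi_ge0.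
have /cvgrPdist_lt /(_ _ e2) /nbhs_ballP[d /= d0 H] : {for 0, continuous (@asin R)}.
  by apply: continuous_asin; rewrite ltrN10 ltr01.
exists d => // p q /andP[h0 hd].
have := H (half_chord p q); rewrite /ball /= sub0r normrN ger0_norm // => /(_ hd).
rewrite asin0 sub0r normrN => h; have := ler_norm (asin (half_chord p q)).
by rewrite /spherical_dist; lra.
Qed.

Let den_ge (z : C) : 1 <= Num.sqrt (1 + modulus z ^+ 2) /\
  modulus z <= Num.sqrt (1 + modulus z ^+ 2).
Proof.
have m0 := modulus_ge0 z; split.
  by rewrite -[X in X <= _]sqrtr1 ler_sqrt ?lerDl ?sqr_ge0 // addr_ge0 ?sqr_ge0.
by rewrite -[X in X <= _](ger0_norm m0) -sqrtr_sqr ler_sqrt ?lerDr ?ler01 // addr_ge0 ?sqr_ge0.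
Qed.

Lemma half_chord_finite (z w : C) : 0 <= half_chord (Some z) (Some w) <= modulus (z - w).
Proof.
have [z1 _] := den_ge z; have [w1 _] := den_ge w; rewrite /half_chord.
set x := Num.sqrt _ in z1 *; set y := Num.sqrt _ in w1 *.
have xy : 1 <= x * y by rewrite -[X in X <= _]mulr1 ler_pM.
have xy0 : 0 < x * y by lra.
rewrite divr_ge0 ?modulus_ge0 ?(ltW xy0) //=.
by rewrite ler_pdivrMr // ler_peMr ?modulus_ge0.
Qed.

Lemma half_chord_infty (z : C) (B : R) : 0 < B -> B < modulus z ->
  0 <= half_chord (Some z) None < B^-1.
Proof.
move=> B0 Bz; have [_ z1] := den_ge z; rewrite /half_chord.
set x := Num.sqrt _ in z1 *.
have x0 : B < x by lra.
by rewrite invr_ge0 ltf_pV2 ?posrE ?x0 ?andbT; lra.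
Qed.

Section Subsequence.
Variables (D : set C) (u : nat -> C -> sphere R) (g : C -> sphere R).
Hypothesis openD : forall z, D z -> exists2 r : R, 0 < r & disc z r `<=` D.
Hypothesis ug : forall z, D z -> forall e : R, 0 < e -> exists2 r : R, 0 < r &
  most (fun m => forall w, disc z r w -> spherical_dist (u m w) (g w) < e).

(** The usual exhaustion of [D] by compact sets; [K_compact] is the form of compactness needed, with
    an ultralimit in [D]. *)
Let K (i : nat) := [set z : C | modulus z <= i%:R /\ disc z i.+1%:R^-1 `<=` D].

Let K_compact (v : nat -> C) i : most (fun m => K i (v m)) -> exists2 z, D z & tends v z.
Proof.
move=> vK; have [|z vz] := @most_lim R v i%:R; first by apply: most_sub vK => m [].
exists z => //; have i0 : 0 < i.+1%:R^-1 :> R by rewrite invr_gt0.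
have [m [[_ h1] h2]] := most_ex (most_and vK (vz _ i0)).
by apply: h1; rewrite /disc /= modulusC.
Qed.

(** Otherwise points [v m] of [K i] where, for most [m], the distance is at least [1 / (i + 1)]
    would have an ultralimit in [D], contrary to the closeness assumed near it. *)
Let K_uniform i : most (fun m => forall z, K i z -> spherical_dist (u m z) (g z) < i.+1%:R^-1).
Proof.
apply: contrapT => /most_not no.
have ex m : exists z, (~ forall z, K i z -> spherical_dist (u m z) (g z) < i.+1%:R^-1) ->
    K i z /\ ~ spherical_dist (u m z) (g z) < i.+1%:R^-1.
  have [H|H] := pselect (forall z, K i z -> spherical_dist (u m z) (g z) < i.+1%:R^-1).
    by exists 0.
  by move/existsNP: H => [z /not_implyP H]; exists z.
have [v vP] := choice ex.
have [|z Dz vz] := @K_compact v i.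
  by apply: most_sub no => m /vP[].
have i0 : 0 < i.+1%:R^-1 :> R by rewrite invr_gt0.
have [r r0 Hr] := ug Dz i0.
have [m [[h1 h2] h3]] := most_ex (most_and (most_and no (vz r r0)) Hr).
by have [_] := vP m h1; apply; exact: h3.
Qed.

(** Here the ultrafilter is exchanged for a genuine subsequence: [phi i] is an index beyond the
    previous one at which [u] is within [1 / (i + 1)] of [g] on [K i]. *)
Lemma subsequence_ex : exists phi : nat -> nat,
  {homo phi : i j / (i < j)%N} /\ locally_uniform_cvg D (u \o phi) g.
Proof.
have ex (ik : nat * nat) : exists m, (ik.2 < m)%N /\
    forall z, K ik.1 z -> spherical_dist (u m z) (g z) < ik.1.+1%:R^-1.
  by have [m [h1 h2]] := most_ex (most_and (most_geq ik.2.+1) (K_uniform ik.1)); exists m.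
have [next nextP] := choice ex.
pose phi := fix phi i := if i is j.+1 then next (j.+1, phi j) else next (0%N, 0%N).
exists phi; split.
  apply: homo_ltn; first by move=> y x z; exact: ltn_trans.
  by move=> i; have [] := nextP (i.+1, phi i).
have phiP i z : K i z -> spherical_dist (u (phi i) z) (g z) < i.+1%:R^-1.
  case: i => [|i] Kz; first by have [_] := nextP (0%N, 0%N); apply.
  by have [_] := nextP (i.+1, phi i); apply.
move=> z Dz; have [r r0 rD] := openD Dz; exists (disc z (r / 2)).
  by apply/nbhsCP; exists (r / 2) => //; rewrite divr_gt0.
move=> e e0.
have r20 : 0 < r / 2 by rewrite divr_gt0.
have [i1 Hi1] := inv_small r20; have [i2 Hi2] := inv_small e0.
have b0 : 0 <= modulus z + r by rewrite addr_ge0 ?modulus_ge0 // ltW.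
have Hi3 := archi_boundP b0; set i3 := Num.bound _ in Hi3.
(* From [i3] on [|w| <= i], from [i1] on the disc of radius [1 / (i + 1)] about [w] lies in
   [disc z r], and from [i2] on [1 / (i + 1) < e]. *)
exists (maxn i3 (maxn i1 i2)) => // i /=; rewrite !geq_max => /and3P[j3 j1 j2] w wr Dw.
have s1 : i.+1%:R^-1 <= i1.+1%:R^-1 :> R by rewrite lef_pV2 ?posrE // ler_nat.
have s2 : i.+1%:R^-1 <= i2.+1%:R^-1 :> R by rewrite lef_pV2 ?posrE // ler_nat.
have s3 : i3%:R <= i%:R :> R by rewrite ler_nat.
apply: lt_trans (le_lt_trans s2 Hi2); apply: phiP; split.
  by have := modulus_leD w z; move: wr; rewrite /disc /=; lra.
apply: subset_trans rD; apply: disc_sub; move: wr s1 Hi1; rewrite /disc /=.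
by move: (i.+1%:R^-1) (i1.+1%:R^-1) => x y; lra.
Qed.

End Subsequence.
End Sphere.

(** * The dichotomy and normality of sequences *)

Section Normality.
Variables (R : realType) (D : set R[i]) (u : nat -> R[i] -> R[i]).
Local Notation C := R[i].
Hypothesis domD : domain D.
Hypothesis uhol : forall m z, D z -> exists l, cderiv (u m) z l.
Hypothesis ulevel : forall z r, 0 < r -> disc z r `<=` D -> exists M : R,
  forall m w, disc z (r / 2) w -> modulus (u m w) <= 1 -> modulus (dc (u m) w) <= M.

Let openD z : D z -> exists2 r : R, 0 < r & disc z r `<=` D.
Proof.
move=> Dz; have [_ oD _] := domD.
have /nbhsCP[r r0 H] : nbhs z D by exact: open_nbhs_nbhs.
by exists r.
Qed.

(** If [|f| <= 1] somewhere within [3 * r] of [z], [level_growth] gives [exp (2 * M * 3 * r)].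
    Otherwise Harnack's inequality for [ln |f|] on that disc, with [|w - z| < 2 * r], gives
    [ln |f z| / 3 <= 5 / 3 * ln |f w|], whence the exponent 5. *)
Lemma level_comparison (f : C -> C) z0 (r M B : R) z w : 0 < r -> hol f z0 (4 * r) ->
  (forall v, disc z0 (4 * r) v -> modulus (f v) <= 1 -> modulus (dc f v) <= M) ->
  disc z0 r z -> disc z0 r w -> 1 <= B -> modulus (f w) <= B ->
  modulus (f z) <= Num.max (B ^+ 5) (expR (6 * M * r)).
Proof.
move=> r0 fh fM zr wr B1 fw; rewrite le_max.
have [fz|fz] := leP (modulus (f z)) 1.
  by apply/orP; left; apply: le_trans fz _; rewrite exprn_ege1.
have p0 : 0 < modulus (f z) := lt_trans ltr01 fz.
have sub : disc z (3 * r) `<=` disc z0 (4 * r).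
  by apply: disc_sub; move: zr; rewrite /disc /=; lra.
have r3 : 0 < 3 * r by rewrite mulr_gt0.
have fh' := hol_sub sub fh.
have fM' v : disc z (3 * r) v -> modulus (f v) <= 1 -> modulus (dc f v) <= M.
  by move=> /sub; exact: fM.
have [[p [pr fp]]|no] := pselect (exists p, disc z (3 * r) p /\ modulus (f p) <= 1).
  apply/orP; right; rewrite -[X in X <= _]lnK ?posrE // ler_expR.
  apply: le_trans (level_growth fh' fz fM' pr fp) _.
  have M0 : 0 <= M := le_trans (modulus_ge0 _) (fM' p pr fp).
  rewrite (_ : 6 * M * r = 2 * M * (3 * r)); last by ring.
  by rewrite ler_wpM2l ?mulr_ge0 // ltW.
have fg v : disc z (3 * r) v -> 1 < modulus (f v).
  by move=> vr; rewrite ltNge; apply/negP => h; apply: no; exists v.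
have wz : modulus (w - z) < 2 * r.
  by have := modulus_trans z0 w z; rewrite (modulusC z0); move: zr wr; rewrite /disc /=; lra.
have wd : disc z (3 * r) w by rewrite /disc /=; lra.
have := superlevel_harnack fh' fz r3 (lexx _) fg wd.
have fw1 := fg w wd; have fw0 : 0 < modulus (f w) := lt_trans ltr01 fw1.
set t := modulus (w - z) / (3 * r).
have t1 : t <= 2 / 3 by rewrite ler_pdivrMr //; lra.
have lz : 0 <= ln (modulus (f z)) by rewrite ln_ge0 // ltW.
have lw : 0 <= ln (modulus (f w)) by rewrite ln_ge0 // ltW.
move=> h; apply/orP; left.
have B0 : 0 < B by lra.
rewrite -ler_ln ?posrE ?exprn_gt0 // lnXn // -[ln B *+ 5]mulr_natr.
have lB : ln (modulus (f w)) <= ln B by rewrite ler_ln ?posrE.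
have q1 : ln (modulus (f z)) * (1 / 3) <= ln (modulus (f z)) * (1 - t).
  by apply: ler_wpM2l => //; lra.
have q2 : ln (modulus (f w)) * (1 + t) <= ln (modulus (f w)) * (5 / 3).
  by apply: ler_wpM2l => //; lra.
by move: (ln B) (ln (modulus (f z))) (ln (modulus (f w))) h q1 q2 lB => *; lra.
Qed.

Let local_comparison z0 : D z0 -> exists r : R, [/\ 0 < r, disc z0 r `<=` D &
  forall B : R, exists B' : R, forall m z w, disc z0 r z -> disc z0 r w ->
    modulus (u m w) <= B -> modulus (u m z) <= B'].
Proof.
move=> Dz0; have [s s0 sD] := openD Dz0; have [M HM] := ulevel s0 sD.
pose r := s / 8; have r0 : 0 < r by rewrite divr_gt0.
have sub : disc z0 (4 * r) `<=` disc z0 s.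
  by apply: disc_sub; rewrite subrr modulus0 /r; lra.
exists r; split => //.
  by apply: subset_trans sD; apply: disc_sub; rewrite subrr modulus0 /r; lra.
move=> B; exists (Num.max ((Num.max B 1) ^+ 5) (expR (6 * M * r))) => m z w zr wr uw.
apply: (@level_comparison (u m) z0 r M (Num.max B 1) z w) => //.
- by move=> v /sub /sD; exact: uhol.
- by move=> v vr; apply: HM; move: vr; rewrite /disc /= /r; lra.
- by rewrite le_max lexx orbT.
- by rewrite le_max uw.
Qed.

Let fin z := exists B : R, most (fun m => modulus (u m z) <= B).

Let fin_local z0 : D z0 -> exists r : R, [/\ 0 < r, disc z0 r `<=` D &
  forall z w, disc z0 r z -> disc z0 r w -> fin w -> fin z].
Proof.
move=> /local_comparison[r [r0 rD H]]; exists r; split => // z w zr wr [B wB].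
by have [B' HB'] := H B; exists B'; apply: most_sub wB => m; exact: HB'.
Qed.

(** By [fin_local] both [fin] and its complement are open in [D], and [D] is connected. *)
Let fin_dichotomy : (forall z, D z -> fin z) \/ (forall z, D z -> ~ fin z).
Proof.
have [_ oD cD] := domD.
have [[z [Dz fz]]|no] := pselect (exists z, D z /\ fin z); last first.
  by right => z Dz fz; apply: no; exists z.
left; have open_of (P : set C) : (forall z, D z /\ P z -> exists2 r : R, 0 < r & disc z r `<=` P) ->
    open (D `&` P).
  move=> HP; rewrite openE => w [Dw Pw]; have [r r0 rP] := HP w (conj Dw Pw).
  have [s s0 sD] := openD Dw.
  apply/nbhsCP; exists (Num.min r s) => [|v]; first by rewrite lt_min r0.
  by rewrite lt_min => /andP[/rP Pv /sD Dv].
have self (z0 : C) (r : R) : 0 < r -> disc z0 r z0 by rewrite /disc /mkset subrr modulus0.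
have E : D `&` fin = D.
  apply: cD; first by exists z.
    exists (D `&` fin); last by rewrite setIA setIid.
    apply: open_of => w [Dw fw]; have [r [r0 _ H]] := fin_local Dw.
    by exists r => // v vr; exact: (H _ _ vr (self _ _ r0) fw).
  exists (~` (D `&` ~` fin)).
    apply: open_closedC; apply: open_of => w [Dw fw]; have [r [r0 _ H]] := fin_local Dw.
    by exists r => // v vr fv; apply: fw; exact: (H _ _ (self _ _ r0) vr fv).
  rewrite setCI setCK setIUr setICr set0U //.
by move=> w Dw; have : (D `&` fin) w by [rewrite E]; case.
Qed.

Theorem sequence_normal : exists (phi : nat -> nat) (g : C -> sphere R),
  [/\ {homo phi : i j / (i < j)%N},
      meromorphic_on D g \/ (forall z, D z -> g z = None)
    & locally_uniform_cvg D ((fun m => to_sphere (u m)) \o phi) g].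
Proof.
have self (z0 : C) (r : R) : 0 < r -> disc z0 r z0 by rewrite /disc /mkset subrr modulus0.
have [allfin|noneinf] := fin_dichotomy; last first.
  have [|phi [homo cvg]] := @subsequence_ex R D (fun m => to_sphere (u m)) (fun=> None) openD.
    move=> z Dz e e0; have [d d0 Hd] := spherical_dist_small e0.
    have [r [r0 rD Hr]] := local_comparison Dz; exists r => //.
    (* Read backwards, the comparison says that [|u m z| > B'] at the centre forces
       [|u m w| > 1 / d] on the whole disc. *)
    have [B' HB'] := Hr d^-1.
    have : most (fun m => ~ modulus (u m z) <= B').
      by apply: most_not => h; apply: (noneinf z Dz); exists B'.
    apply: most_sub => m /negP; rewrite -ltNge => um w wr.
    apply: Hd; rewrite -[X in _ < X]invrK; apply: half_chord_infty.
      by rewrite invr_gt0.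
    rewrite ltNge; apply/negP => h; move: um; rewrite ltNge => /negP; apply.
    exact: (HB' m _ _ (self _ _ r0) wr h).
  by exists phi, (fun=> None); split => //; right.
have ex z : exists l, D z -> tends (fun m => u m z) l.
  have [Dz|nD] := pselect (D z); last by exists 0.
  by have [B /most_lim[l ul]] := allfin z Dz; exists l.
have [G GP] := choice ex.
have bounded z : D z -> exists (r B : R), [/\ 0 < r, disc z r `<=` D &
    most (fun m => bounded_hol (u m) z r B)].
  move=> Dz; have [r [r0 rD Hr]] := local_comparison Dz.
  have [B zB] := allfin z Dz; have [B' HB'] := Hr B; exists r, B'; split => //.
  apply: most_sub zB => m zB; split => [w /rD|w wr]; first exact: uhol.
  exact: (HB' m _ _ wr (self _ _ r0) zB).
have Gd z : D z -> exists l, cderiv G z l.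
  move=> Dz; have [r [B [r0 rD Hb]]] := bounded z Dz.
  have [|l [Gl _]] := tends_hol r0 Hb (g := G); last by exists l.
  by move=> w /rD; exact: GP.
have [|phi [homo cvg]] := @subsequence_ex R D (fun m => to_sphere (u m)) (to_sphere G) openD.
  move=> z Dz e e0; have [d d0 Hd] := spherical_dist_small e0.
  have [r [B [r0 rD Hb]]] := bounded z Dz.
  have [l Gl] := Gd z Dz.
  have d3 : 0 < d / 3 by rewrite divr_gt0.
  have [s s0 Gs] := cderiv_continuous Gl d3.
  have B0 : 0 <= B.
    have [m [_ h]] := most_ex Hb; exact: le_trans (modulus_ge0 _) (h z (self _ _ r0)).
  (* Most [u m] are Lipschitz near [z] with this same constant, so the closeness to [G] at [z]
     spreads to a disc; [d] is split in three. *)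
  pose L := 8 * B / r + 1.
  have L0 : 0 < L by rewrite ltr_wpDl // divr_ge0 ?mulr_ge0 // ltW.
  exists (Num.min (Num.min s (r / 2)) (d / 3 / L)).
    by rewrite !lt_min s0 !divr_gt0.
  apply: most_sub2 Hb (GP z Dz _ d3) => m bm um w.
  rewrite /disc /mkset !lt_min => /andP[/andP[/Gs w1 w2] w3].
  apply: Hd; have /andP[h0 h1] := half_chord_finite (u m w) (G w).
  rewrite h0 /=; apply: le_lt_trans h1 _.
  have half : disc z (r / 2) `<=` disc z r by apply: disc_sub; rewrite subrr modulus0; lra.
  have lip : modulus (u m w - u m z) <= L * modulus (w - z).
    apply: (@disc_lipschitz R (u m) z (r / 2)) => //; first exact: hol_sub half bm.1.
      move=> v vr; apply: le_trans (cauchy_bound_half r0 bm vr) _.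
      by rewrite lerDl.
    by apply: self; rewrite divr_gt0.
  have Lw : L * modulus (w - z) < d / 3 by rewrite mulrC -ltr_pdivlMr.
  have := modulus_trans (u m z) (u m w) (G w); have := modulus_trans (G z) (u m z) (G w).
  by rewrite (modulusC (G z) (G w)); lra.
exists phi, (to_sphere G); split => //; left => z Dz; split => [|/=]; last first.
  by have [l /cderivP[]] := Gd z Dz.
have [_ oD _] := domD.
have : nbhs z D by exact: open_nbhs_nbhs.
apply: filterS => w Dw _; split => //.
by have [l /cderivP[]] := Gd w Dw.
Qed.

End Normality.

(** * Passage from [derive1n] and sphere-valued maps to the preceding results *)

Theorem corollary4 (R : realType) (a : R[i]) (ha : a != 0)
    (n k : nat) (hk : (1 <= k)%N) (n_ t_ : 'I_k -> nat)
    (hn_ : forall j, (0 < n_ j)%N) (ht_ : forall j, (0 < t_ j)%N)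
    (D : set R[i]) (hD : domain D) (F : set (R[i] -> R[i]))
    (hol : forall f, F f -> holomorphic_on D f)
    (omit : forall f, F f -> forall z, D z ->
      f z ^+ n * \prod_(j < k) derive1n (t_ j) (fun w => f w ^+ n_ j) z - a != 0)
    (hyp_a : forall j, (t_ j <= n_ j)%N)
    (hyp_b : (2 + \sum_(j < k) t_ j <= n + \sum_(j < k) n_ j)%N) :
  normal_on D [set to_sphere f | f in F].
Proof.
move=> v vF.
have ex m : exists f, F f /\ to_sphere f = v m by case: (vF m) => f; exists f.
have [u uP] := choice ex.
have -> : v = fun m => to_sphere (u m) by apply/funext => m; case: (uP m).
have uF m : F (u m) by case: (uP m).
have uhol m z : D z -> exists l, cderiv (u m) z l.
  by move=> Dz; exists (derive1 (u m) z); apply/cderivP; split => //; exact: hol (uF m) z Dz.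
apply: sequence_normal => // z r r0 rD.
have [M HM] := level_derivative_bound hn_ hyp_a hyp_b ha z r0.
exists M => m w; apply: HM; split => [x /rD|x /rD Dx]; first exact: uhol.
have dcE' : @dc R = @derive1 _ _ by apply/funext => f; exact: dcE.
rewrite /diffmon dcE'; exact: omit (uF m) x Dx.
Qed.
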